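(* For any $\varepsilon>0$, the colength $l_n(\widetilde{\mathbf V}_3)$ of the variety $\widetilde{\mathbf V}_3$ of Leibniz algebras satisfies $$ l_n(\widetilde{\mathbf V}_3)=\frac{n^2}{3}+o(n^{1+\varepsilon})\qquad (n\to\infty). $$
   Context: $\Phi$ is a field of characteristic zero. A Leibniz algebra over $\Phi$ is a $\Phi$-vector space with a bilinear multiplication satisfying $(xy)z=(xz)y+x(yz)$ for all $x,y,z$. The algebra $\widetilde H$: let $T=\Phi[t]$ be the polynomial ring in one variable $t$, and let $H$ be the three-dimensional Heisenberg Lie algebra with basis $\{a,b,c\}$ and multiplication $ba=-ab=c$, all other products of basis elements being zero. Make $T$ a right $H$-module by $fa=f'$ (the derivative of $f$ with respect to $t$), $fb=tf$, $fc=f$ for $f\in T$. Let $\widetilde H=H\oplus T$ (direct sum of vector spaces) with multiplication $(x+f)(y+g)=xy+fy$ for $x,y\in H$, $f,g\in T$, where $xy$ is the product in $H$ and $fy$ is the module action. Then $\widetilde H$ is a Leibniz algebra. The variety $\widetilde{\mathbf V}_3$ is the variety of Leibniz algebras generated by $\widetilde H$, i.e. the class of all algebras over $\Phi$ satisfying every (nonassociative) polynomial identity satisfied by $\widetilde H$. Let $F(X,\widetilde{\mathbf V}_3)$ be its relatively free algebra on the countable set $X=\{x_1,x_2,\dots\}$ of free generators, and let $P_n(\widetilde{\mathbf V}_3)\subset F(X,\widetilde{\mathbf V}_3)$ be the space of multilinear elements in $x_1,\dots,x_n$ (the span of all products, with any bracketing, in which each of $x_1,\dots,x_n$ occurs exactly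 once). The symmetric group $S_n$ acts on $P_n(\widetilde{\mathbf V}_3)$ on the left by permuting variables: $q\in S_n$ sends the left-normed product $x_{i_1}x_{i_2}\cdots x_{i_n}$ to $x_{q(i_1)}x_{q(i_2)}\cdots x_{q(i_n)}$ (left-normed products span $P_n(\widetilde{\mathbf V}_3)$). Decompose the character of this $\Phi S_n$-module as $\chi_n(\widetilde{\mathbf V}_3)=\sum_{\lambda\vdash n}m_\lambda(\widetilde{\mathbf V}_3)\chi_\lambda$, where $\chi_\lambda$ is the irreducible character of $S_n$ corresponding to the partition $\lambda$ of $n$. The colength of the variety is $l_n(\widetilde{\mathbf V}_3)=\sum_{\lambda\vdash n}m_\lambda(\widetilde{\mathbf V}_3)$. *)

(* Defs.v *)
From HB Require Import structures.
From mathcomp Require Import all_boot all_order all_algebra all_fingroup.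
From mathcomp Require Import all_character.
From mathcomp Require Import all_classical all_reals all_analysis.
From mathcomp Require Import ring.
From mathcomp.multinomials Require Import freeg.

Set Implicit Arguments.
Unset Strict Implicit.
Unset Printing Implicit Defensive.

Import Order.TTheory GRing.Theory Num.Theory.
Import numFieldNormedType.Exports.

Local Open Scope ring_scope.

(* Nonassociative monomials, i.e. elements of the free magma. *)
Inductive monom (X : Type) := MVar of X | MMul of monom X & monom X.
Arguments MVar {X} x.

Section Monom.
Variable X : Type.

Fixpoint monom_tree (m : monom X) : GenTree.tree X :=
  match m with
  | MVar x => GenTree.Leaf x
  | MMul u v => GenTree.Node 0 [:: monom_tree u; monom_tree v]
  end.

Fixpoint tree_monom (t : GenTree.tree X) : option (monom X) :=
  match t with
  | GenTree.Leaf x => Some (MVar x)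
  | GenTree.Node _ [:: t1; t2] =>
      if (tree_monom t1, tree_monom t2) is (Some u, Some v)
      then Some (MMul u v) else None
  | _ => None
  end.

Lemma monom_treeK : pcancel monom_tree tree_monom.
Proof. by elim=> //= u -> v ->. Qed.

Fixpoint leaves (m : monom X) : seq X :=
  match m with MVar x => [:: x] | MMul u v => leaves u ++ leaves v end.

Fixpoint mmap Y (h : X -> Y) (m : monom X) : monom Y :=
  match m with MVar x => MVar (h x) | MMul u v => MMul (mmap h u) (mmap h v) end.

Lemma size_leaves m : (0 < size (leaves m))%N.
Proof. by elim: m => //= u hu v hv; rewrite size_cat addn_gt0 hu. Qed.

Fixpoint bracketings (k : nat) (w : seq X) : seq (monom X) :=
  if k is k'.+1 then
    if w is [:: x] then [:: MVar x] else
    flatten [seq [seq MMul u v | u <- bracketings k' (take i w),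
                                 v <- bracketings k' (drop i w)]
            | i <- iota 1 (size w).-1]
  else [::].
End Monom.

HB.instance Definition _ (X : eqType) :=
  Equality.copy (monom X) (pcan_type (@monom_treeK X)).
HB.instance Definition _ (X : choiceType) :=
  Choice.copy (monom X) (pcan_type (@monom_treeK X)).
HB.instance Definition _ (X : countType) :=
  Countable.copy (monom X) (pcan_type (@monom_treeK X)).

Lemma leaves_mmap X Y (h : X -> Y) m : leaves (mmap h m) = map h (leaves m).
Proof. by elim: m => //= u -> v ->; rewrite map_cat. Qed.

Lemma mmap_comp X Y Z (g : Y -> Z) (h : X -> Y) m :
  mmap g (mmap h m) = mmap (g \o h) m.
Proof. by elim: m => //= u -> v ->. Qed.

Lemma eq_mmap X Y (g h : X -> Y) m : g =1 h -> mmap g m = mmap h m.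
Proof. by move=> e; elim: m => [x|u hu v hv] /=; rewrite ?e ?hu ?hv. Qed.

Lemma mmap_id X (m : monom X) : mmap id m = m.
Proof. by elim: m => //= u -> v ->. Qed.

Lemma mem_bracketings (X : eqType) (m : monom X) k :
  (size (leaves m) <= k)%N -> m \in bracketings k (leaves m).
Proof.
elim: m k => [x|u hu v hv] [|k] //=; rewrite ?inE //.
  by rewrite leqNgt size_cat addn_gt0 size_leaves.
rewrite size_cat => le_k; have u0 := size_leaves u; have v0 := size_leaves v.
case E: (leaves u ++ leaves v) => [|x [|y w]].
- by move: (congr1 size E); rewrite size_cat /=; case: (size _) u0.
- move: (congr1 size E) u0 v0; rewrite size_cat /=.
  by case: (size _) => [|[|?]] //; case: (size _).
rewrite -E; apply/flatten_mapP; exists (size (leaves u)).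
  have := congr1 size E; rewrite size_cat /= => Es.
  have : (size (leaves u) < (size w).+2)%N by rewrite -Es -addn1 leq_add2l.
  by rewrite mem_iota u0 Es.
rewrite take_size_cat // drop_size_cat //; apply/allpairsP; exists (u, v) => /=; split=> //.
  by apply: hu; rewrite -ltnS (leq_trans _ le_k) // -addn1 leq_add2l.
by apply: hv; rewrite -ltnS (leq_trans _ le_k) // -add1n leq_add2r.
Qed.

(* The multilinear monomials, with all bracketings; the variables x_1, ..., x_n
   are indexed by 0, ..., n-1. *)
Definition mlmon n := {m : monom 'I_n | perm_eq (leaves m) (enum 'I_n)}.
HB.instance Definition _ n := SubCountable.on (mlmon n).

Definition mlmon_enum n : seq (mlmon n) :=
  undup (pmap insub (flatten [seq bracketings n w | w <- permutations (enum 'I_n)])).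

Fact mlmon_enumP n : Finite.axiom (mlmon_enum n).
Proof.
apply: Finite.uniq_enumP; first exact: undup_uniq.
move=> m; rewrite mem_undup mem_pmap_sub /=.
have pm := valP m; apply/flattenP; exists (bracketings n (leaves (val m))).
  by apply/map_f; rewrite mem_permutations.
by apply: mem_bracketings; rewrite (perm_size pm) size_enum_ord.
Qed.
HB.instance Definition _ n := fintype.isFinite.Build (mlmon n) (@mlmon_enumP n).

Fact mlact_subproof n (s : 'S_n) (m : mlmon n) :
  perm_eq (leaves (mmap s (val m))) (enum 'I_n).
Proof.
rewrite leaves_mmap; apply: uniq_perm; rewrite ?enum_uniq //.
  by rewrite map_inj_uniq ?(perm_uniq (valP m)) ?enum_uniq //; apply: perm_inj.
move=> i; rewrite mem_enum inE; apply/mapP; exists (s^-1%g i); rewrite ?permKV //.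
by rewrite (perm_mem (valP m)) mem_enum.
Qed.
Definition mlact n (s : 'S_n) (m : mlmon n) : mlmon n :=
  Sub (mmap s (val m)) (mlact_subproof s m).

Lemma mlact1 n (m : mlmon n) : mlact 1 m = m.
Proof. by apply: val_inj => /=; rewrite (eq_mmap _ (@perm1 _)) mmap_id. Qed.

(* In MathComp [(s * t) i = t (s i)], so the left action of permutations on
   variables is a right action for the group law of ['S_n], as required by the
   row-vector convention of [mx_representation]. *)
Lemma mlactM n (s t : 'S_n) (m : mlmon n) : mlact (s * t) m = mlact t (mlact s m).
Proof.
by apply: val_inj => /=; rewrite mmap_comp; apply: eq_mmap => i; rewrite permM.
Qed.

Section Perm.
Variables (K : fieldType) (n : nat).

Definition mlmx (s : 'S_n) : 'M[K]_#|{: mlmon n}| :=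
  \matrix_i delta_mx 0 (enum_rank (mlact s (enum_val i))).

Fact mlmx_repr : mx_repr [set: 'S_n] mlmx.
Proof.
split=> [|s t _ _]; apply/row_matrixP=> i; rewrite rowK.
  by rewrite mlact1 enum_valK row1.
by rewrite row_mul rowK -rowE rowK enum_rankK mlactM.
Qed.

(* The S_n-module of multilinear elements of degree n of the free
   nonassociative algebra; the basis vector of index [enum_rank m] stands for
   the monomial m. *)
Definition mlrepr := MxRepresentation mlmx_repr.
End Perm.

Record nalg (K : fieldType) := NAlg {
  nalg_sort :> lmodType K;
  nmul : {bilinear nalg_sort -> nalg_sort -> nalg_sort}
}.

Definition leibniz_law (K : fieldType) (A : nalg K) := forall x y z : A,
  nmul A (nmul A x y) z = nmul A (nmul A x z) y + nmul A x (nmul A y z).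

Section Variety.
Variable K : fieldType.

Fixpoint meval (A : nalg K) X (v : X -> A) (m : monom X) : A :=
  match m with
  | MVar x => v x
  | MMul p q => nmul A (meval v p) (meval v q)
  end.

(* The value of the nonassociative polynomial f under the substitution v. *)
Definition npeval (A : nalg K) (X : choiceType) (v : X -> A)
    (f : {freeg (monom X) / K}) : A :=
  fglift (meval v) f.

Definition satisfies (A : nalg K) (f : {freeg (monom nat) / K}) :=
  forall v : nat -> A, npeval v f = 0.

Definition variety_of (A : nalg K) : nalg K -> Prop :=
  fun B => forall f, satisfies A f -> satisfies B f.

(* The T-ideal Id(V); the relatively free algebra of V on x_0, x_1, ... is the
   quotient of the free nonassociative algebra by it. *)
Definition identity_of (V : nalg K -> Prop) (f : {freeg (monom nat) / K}) :=
  forall B, V B -> satisfies B f.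

Definition mlpoly n (u : 'rV[K]_#|{: mlmon n}|) : {freeg (monom nat) / K} :=
  \sum_(m : mlmon n) Freeg [:: (u 0 (enum_rank m), mmap val (val m))].

Lemma npeval_mlpoly (A : nalg K) n (v : nat -> A) (u : 'rV[K]_#|{: mlmon n}|) :
  npeval v (mlpoly u) =
  \sum_(m : mlmon n) u 0 (enum_rank m) *: meval (v \o val) (val m).
Proof.
pose L := GRing.isZmodMorphism.Build _ _ (fglift (meval v)) (lift_is_additive _).
pose F : {additive _ -> _} := HB.pack (fglift (meval v)) L.
apply: etrans (raddf_sum F _ _ _) _; apply: eq_bigr => m _ /=.
rewrite liftU; congr (_ *: _); elim: (val m) => //= p -> q -> //.
Qed.

(* Classically every subspace of a finite-dimensional space is a row space. *)
Lemma rowspace_ex N (P : 'rV[K]_N -> Prop) :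
  P 0 -> (forall a u v, P u -> P v -> P (a *: u + v)) ->
  exists U : 'M[K]_N, forall v, (v <= U)%MS <-> P v.
Proof.
move=> P0 PD.
pose ok (r : nat) := `[< exists U : 'M[K]_N,
  (forall v : 'rV_N, (v <= U)%MS -> P v) /\ \rank U = r >].
have ok0 : exists r, ok r.
  exists 0%N; apply/asboolP; exists 0; rewrite mxrank0; split=> // v.
  by rewrite submx0 => /eqP->.
have okN r : ok r -> (r <= N)%N by move=> /asboolP[U [_ <-]]; apply: rank_leq_row.
case: (ex_maxnP ok0 okN) => r /asboolP[U [sUP rU]] rmax.
exists U => v; split=> [/sUP //|Pv]; apply/negPn/negP => nvU.
suff /rmax : ok (\rank (U + v)%MS).
  rewrite -rU leqNgt => /negP; apply; apply: (@rank_ltmx K _ _ _ U (U + v)%MS).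
  rewrite ltmxE addsmxSl /=; apply: contra nvU; apply: submx_trans.
  exact: addsmxSr.
apply/asboolP; exists (U + v)%MS; split=> // w /sub_addsmxP[[a b] ->] /=.
rewrite addrC [b]mx11_scalar mul_scalar_mx.
by apply: PD => //; apply: sUP; apply: submxMl.
Qed.

Variable V : nalg K -> Prop.
Variable n : nat.

(* A matrix whose row space is the intersection of Id(V) with the space of
   multilinear elements of degree n. *)
Definition mlid : 'M[K]_#|{: mlmon n}| :=
  xget 0 [set U | forall u : 'rV_#|{: mlmon n}|,
    (u <= U)%MS <-> identity_of V (mlpoly u)]%classic.

Lemma mlidP (u : 'rV_#|{: mlmon n}|) :
  (u <= mlid)%MS <-> identity_of V (mlpoly u).
Proof.
suff ex : exists U : 'M[K]_#|{: mlmon n}|, forall u : 'rV_#|{: mlmon n}|,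
    (u <= U)%MS <-> identity_of V (mlpoly u).
  exact: (xgetPex (0 : 'M[K]_#|{: mlmon n}|) ex u).
apply: (rowspace_ex (P := fun u => identity_of V (mlpoly u))).
  move=> B _ v; rewrite npeval_mlpoly big1 // => m _; by rewrite mxE scale0r.
move=> a {}u w Hu Hw B VB v.
suff -> : npeval v (mlpoly (a *: u + w)) =
    a *: npeval v (mlpoly u) + npeval v (mlpoly w).
  by rewrite Hu // Hw // scaler0 addr0.
rewrite !npeval_mlpoly scaler_sumr -big_split; apply: eq_bigr => m _ /=.
by rewrite !mxE scalerDl scalerA.
Qed.

Lemma mlid_module : mxmodule (mlrepr K n) mlid.
Proof.
apply/mxmoduleP => s _; apply/row_subP => i; rewrite row_mul.
have /mlidP := row_sub i mlid; move: (row i mlid) => u Hu.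
apply/mlidP => B VB v; rewrite npeval_mlpoly.
pose v' (k : nat) := if insub k is Some j then v (s j) else v k.
rewrite -[RHS](Hu B VB v') npeval_mlpoly.
have act_inj : injective (@mlact n s).
  by apply: (can_inj (g := mlact s^-1%g)) => m; rewrite -mlactM mulgV mlact1.
rewrite (reindex_inj act_inj); apply: eq_bigr => m _ /=; congr (_ *: _).
  rewrite mxE (bigD1 (enum_rank m)) //= big1 ?addr0.
    by rewrite mxE enum_rankK mxE !eqxx mulr1.
  move=> j ne_j; rewrite mxE mxE eqxx /= -[X in _ == X]enum_valK.
  rewrite (inj_eq (can_inj (@enum_rankK _))) enum_rankK.
  case: eqP => [/act_inj e|]; last by rewrite mulr0.
  by rewrite e enum_valK eqxx in ne_j.
elim: (val m) => /= [j|p -> q -> //].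
by rewrite /v' valK.
Qed.

(* P_n(V), the image of the multilinear elements in the relatively free
   algebra, as the quotient of [mlrepr] by the kernel of the projection. *)
Definition Pn_repr := factmod_repr mlid_module.

Definition cocharacter (s : 'S_n) : K := \tr (Pn_repr s).
End Variety.

(* Partitions of n, padded with zeros to length n. *)
Definition partn n := {t : n.-tuple 'I_n.+1 |
  sorted geq (map val t) && (sumn (map val t) == n)}.

Section Specht.
Variables (K : fieldType) (n : nat) (lam : partn n).

(* The tableau of shape lam whose rows, read from top to bottom, are filled
   with 0, 1, ..., n-1. *)
Definition tab_row (i : 'I_n) := reshape_index (map val (val lam)) i.
Definition tab_col (i : 'I_n) := reshape_offset (map val (val lam)) i.

Definition row_stab := [set s : 'S_n | [forall i, tab_row (s i) == tab_row i]].
Definition col_stab := [set s : 'S_n | [forall i, tab_col (s i) == tab_col i]].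

Definition sym_regular := regular_repr K [set: 'S_n]%G.

Definition young_symmetrizer :=
  \sum_(p in row_stab) \sum_(q in col_stab) (-1) ^+ q *: sym_regular (p * q)%g.

(* The Specht module, generated by the Young symmetrizer. The group acts on
   row vectors by right multiplication; since permutations compose from left to
   right here, this is the usual left ideal of the group algebra. *)
Definition specht_repr :=
  submod_repr (cyclic_mx_module sym_regular (gring_row young_symmetrizer)).

Definition specht_char (s : 'S_n) : K := \tr (specht_repr s).
End Specht.

Section Colength.
Variables (K : fieldType) (V : nalg K -> Prop) (n : nat).

(* The multiplicities m_lam of the decomposition of the cocharacter; they exist
   and are unique when K has characteristic zero. *)
Definition multiplicity : {ffun partn n -> nat} :=
  xget [ffun=> 0%N] [set m : {ffun partn n -> nat} | forall s : 'S_n,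
    cocharacter V s = \sum_(lam : partn n) (m lam)%:R * specht_char K lam s]%classic.

Definition colength : nat := \sum_(lam : partn n) multiplicity lam.
End Colength.

Section Htilde.
Variable K : fieldType.

(* Elements of the Heisenberg algebra are given by their coordinates in the
   basis a, b, c, in this order. *)
Definition heis_mul (x y : 'rV[K]_3) : 'rV[K]_3 :=
  (x 0 1 * y 0 0 - x 0 0 * y 0 1) *: delta_mx 0 2.

Definition heis_act (f : {poly K}) (y : 'rV[K]_3) : {poly K} :=
  y 0 0 *: f^`() + y 0 1 *: ('X * f) + y 0 2 *: f.

Definition Htilde_mul (u v : 'rV[K]_3 * {poly K}) : 'rV[K]_3 * {poly K} :=
  (heis_mul u.1 v.1, heis_act u.2 v.1).

Fact Htilde_mul_bilinear : bilinear_for *:%R *:%R Htilde_mul.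
Proof.
split=> [[y g] k [x f] [x' f']|[x f] k [y g] [y' g']];
  rewrite /Htilde_mul /heis_mul /heis_act /=; congr (_, _) => /=.
- rewrite scalerA -scalerDl !mxE; congr (_ *: _).
  by rewrite mulrBr !mulrDl !mulrA opprD addrACA.
- rewrite derivD derivZ !scalerDr !scalerA mulrDr -scalerAr !scalerDr !scalerA.
  by rewrite ![y _ _ * k]mulrC [RHS]addrACA; congr (_ + _); rewrite addrACA.
- rewrite scalerA -scalerDl !mxE; congr (_ *: _).
  by rewrite mulrBr !mulrDr !mulrA ![x _ _ * k]mulrC opprD addrACA.
- rewrite !mxE !scalerDl !scalerDr !scalerA.
  by rewrite [RHS]addrACA; congr (_ + _); rewrite addrACA.
Qed.
HB.instance Definition _ := bilinear_isBilinear.Build K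
  ('rV[K]_3 * {poly K})%type ('rV[K]_3 * {poly K})%type ('rV[K]_3 * {poly K})%type
  *:%R *:%R Htilde_mul Htilde_mul_bilinear.

Definition Htilde : nalg K := @NAlg K ('rV[K]_3 * {poly K})%type Htilde_mul.

Lemma Htilde_leibniz : leibniz_law Htilde.
Proof.
move=> [x f] [y g] [z h]; rewrite /= /Htilde_mul /heis_mul /heis_act /=.
congr (_, _) => /=.
  rewrite !mxE /= !(mulr0, mul0r, subrr, scale0r, addr0) //.
rewrite !derivD !derivZ derivM derivX mul1r !mxE /=.
rewrite !mulr0 !mulr1 !scale0r !add0r.
rewrite -!mul_polyC ?polyCB ?polyCM.
ring.
Qed.
End Htilde.

(* Main.v *)
(* Label each variable by I, A, B or C according to whether it is replaced by an
   element of T or by a, b, c. For n > 2 a multilinear element is an identity of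
   Htilde iff its value with T-argument 1 has constant term 0 for all labelings
   with one I and as many A as B, because the derivations a, b, h of Htilde
   determine all other values. Such values satisfy one family of relations, coming
   from the derivation e and indexed by labelings with one I and two more A than B.
   The sl_2-representation theory of tensor powers of the plane shows that the
   relations are independent and that there are no others. Hence the cocharacter
   is the difference of the permutation characters on these two sets of labelings.

   Specht characters have Frobenius-Schur indicator 1, as they come from
   idempotents fixed by g |-> g^-1, so the colength is the average over S_n of the
   cocharacter at h^2. For a set of labelings stable under S_n, the average number
   of labelings fixed by h^2 counts the symmetric 4 x 4 matrices of natural numbers
   of total n whose row sums are the label counts. The difference of the two counts
   is p(n-1) + p(n-2) + p(n-3) + p(n-4) with p(m) = #{3x + 2y <= m} ~ m^2/12. *)
Require Import Defs.
From HB Require Import structures.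
From mathcomp Require Import all_boot all_order all_algebra all_fingroup.
From mathcomp Require Import all_character.
From mathcomp Require Import all_classical all_reals all_analysis.
From mathcomp Require Import ring zify lra.

Import Order.TTheory GRing.Theory Num.Theory.
Import numFieldNormedType.Exports.

Set Implicit Arguments.
Unset Strict Implicit.

Local Open Scope ring_scope.

(** * Primitive idempotents of group algebras *)

(** [K] is any field of characteristic zero, possibly not algebraically closed, so each Specht
    module is handled through one explicit idempotent F for which F u F = tau(u) F; this relation
    plays the part of Schur's lemma. The multiplicities enter the colength only through their
    existence: the Specht characters are orthogonal and not fewer than the conjugacy classes, so
    they span the class functions, and each coefficient is the rank of an idempotent, hence a
    natural number. Independence and completeness of the relations both rest on filtering labelings
    by the number of labels A. In a relation, the term from sl_2 reads a function at labelings with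
    one label A fewer, the term from the polynomial argument at labelings with two fewer. On the
    part of a function with an extreme number of labels A only the sl_2 term survives. Neither of
    the two matrix counts is evaluated alone: their summands cancel except on and next to a
    diagonal, which leaves a count with two parameters, hence quadratic in n. *)

Section GroupAlgebra.
Variables (K : fieldType) (gT : finGroupType).

Local Notation aG := (regular_repr K [set: gT]%G).
Local Notation N := (#|[set: gT]%G|).
Local Notation gi := (@gring_index gT [set: gT]%G).

(** Group algebra elements are encoded by their matrices of right multiplication, so that products,
    the involution g |-> g^-1 and the coefficient of 1 become matrix products, transposes and
    traces. *)
Definition galg (x : gT -> K) : 'M[K]_N := \sum_g x g *: aG g.

Lemma regM g h : aG (g * h)%g = aG g *m aG h.
Proof. by rewrite repr_mxM ?inE. Qed.

Lemma enum_valGK i : gi (enum_val i) = i.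
Proof. exact: gring_valK. Qed.

Lemma gring_indexGK (g : gT) : enum_val (gi g) = g.
Proof. by rewrite gring_indexK ?inE. Qed.

Lemma regE g h k : aG g (gi h) (gi k) = ((h * g)%g == k)%:R.
Proof.
rewrite /= mxE gring_indexGK mxE eqxx /= eq_sym; congr (_%:R).
by rewrite (inj_eq (can_inj gring_indexGK)).
Qed.

Lemma reindex_gi (R : nmodType) (F : 'I_N -> R) :
  \sum_i F i = \sum_(g : gT) F (gi g).
Proof.
rewrite (reindex gi) //; exists enum_val => i _; [exact: gring_indexGK|exact: enum_valGK].
Qed.

Lemma trmx_reg g : (aG g)^T = aG g^-1%g.
Proof.
apply/matrixP => i j; rewrite mxE -(enum_valGK i) -(enum_valGK j) !regE.
by congr (_%:R); rewrite eq_sym -(inj_eq (mulIg g^-1%g)) mulgK eq_sym.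
Qed.

Lemma tr_reg g : \tr (aG g) = N%:R *+ (g == 1%g).
Proof.
rewrite /mxtrace reindex_gi (eq_bigr (fun=> (g == 1%g)%:R)); last first.
  by move=> h _; rewrite regE; congr (_%:R); rewrite -{2}(mulg1 h) (inj_eq (mulgI h)).
by rewrite sumr_const -cardsT; case: eqP => _ //; rewrite mul0rn.
Qed.

Lemma tr_galg x g : \tr (galg x *m aG g) = N%:R * x g^-1%g.
Proof.
rewrite /galg mulmx_suml raddf_sum (bigD1 g^-1%g) //= big1 ?addr0.
  by rewrite -scalemxAl -regM mulVg linearZ /= tr_reg eqxx mulrC.
move=> h nh; rewrite -scalemxAl -regM linearZ /= tr_reg.
by rewrite -{1}(invgK g) -eq_mulgV1 (negPf nh) mulr0.
Qed.

Lemma trmx_galg x : (galg x)^T = galg (fun g => x g^-1%g).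
Proof.
rewrite /galg linear_sum (reindex_inj invg_inj); apply: eq_bigr => g _ /=.
by rewrite linearZ /= trmx_reg invgK.
Qed.

Lemma galg_coef x g : galg x (gi 1%g) (gi g) = x g.
Proof.
rewrite /galg summxE (bigD1 g) //= big1 ?addr0 => [|h nh].
  by rewrite mxE regE mul1g eqxx mulr1.
by rewrite mxE regE mul1g (negPf nh) mulr0.
Qed.

Section Specht.
Variables (x : gT -> K) (alpha : K).
Hypotheses (alpha0 : alpha != 0) (xx : galg x *m galg x = alpha *: galg x).

Let M := galg x.
(* L is left multiplication by the idempotent alpha^-1 x, so its trace against
   right multiplications is the character of the ideal generated by x. *)
Let L : 'M[K]_N := \matrix_i gring_row (alpha^-1 *: (M *m aG (enum_val i))).

Let LC g : L *m aG g = aG g *m L.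
Proof.
apply/row_matrixP => i; rewrite !row_mul !rowK.
rewrite -rowE rowK -gring_row_mul -scalemxAl -mulmxA -regM.
by rewrite gring_indexGK.
Qed.

Let Lgr y : gring_row (galg y) *m L = alpha^-1 *: gring_row (M *m galg y).
Proof.
have : forall g, gring_row (galg y) 0 (gi g) = y g.
  by move=> g; rewrite /gring_row mxE galg_coef.
move: (gring_row _) => v vE; rewrite mulmx_sum_row [LHS]reindex_gi /galg mulmx_sumr.
rewrite !linear_sum /=; apply: eq_bigr => g _.
by rewrite rowK gring_indexGK -scalemxAr !linearZ /= vE scalerA scalerA mulrC.
Qed.

(** Row h of [L] holds the coefficients of alpha^-1 x h, so the diagonal entries of [aG g *m L] are
    multiples of the values of x at conjugates of g^-1. *)
Lemma tr_specht_galg g :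
  \tr (submod_repr (cyclic_mx_module aG (gring_row M)) g)
  = alpha^-1 * \sum_h x (h * g^-1 * h^-1)%g.
Proof.
set U := cyclic_mx _ _.
have gL : gring_row M *m L = gring_row M.
  by rewrite Lgr xx linearZ /= scalerA mulVf // scale1r.
have UL : (U :=: L)%MS.
  apply/eqmxP/andP; split.
    apply: cyclic_mx_sub.
      by apply/mxmoduleP => h _; rewrite LC submxMl.
    rewrite -[X in (X <= _)%MS]gL.
    exact: submxMl.
  apply/row_subP => i; rewrite rowK linearZ /= scalemx_sub //; apply/cyclic_mxP.
  by exists (aG (enum_val i)); rewrite ?envelop_mx_id ?inE ?gring_row_mul.
have LL : L *m L = L.
  apply/row_matrixP => i; rewrite row_mul rowK.
  have -> : gring_row (alpha^-1 *: (M *m aG (enum_val i))) =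
     gring_row M *m (alpha^-1 *: aG (enum_val i)) by rewrite -gring_row_mul -scalemxAr.
  by rewrite -mulmxA -scalemxAl -LC scalemxAr mulmxA gL.
have BL : val_submod (U := U) 1%:M *m L = val_submod 1%:M.
  have : (val_submod (U := U) 1%:M <= L)%MS by rewrite val_submod1 UL.
  by case/submxP => C ->; rewrite -mulmxA LL.
have [C LE] : exists C, L = C *m val_submod (U := U) 1%:M.
  by apply/submxP; rewrite val_submod1 UL.
(* [B] is a basis of the ideal and [P] a right inverse of it. As L = C B and B L = B, cyclicity of
   the trace passes from the ideal to the whole algebra. *)
have -> : \tr (submod_repr (cyclic_mx_module aG (gring_row M)) g) = \tr (L *m aG g).
  rewrite /= /submod_mx /in_submod /=.
  have := @val_submodK _ _ U _ 1%:M; rewrite /in_submod /=.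
  set B := val_submod _ in BL LE *; set P := (_ *m pid_mx _) => BP.
  clearbody B P.
  change (\tr (B *m aG g *m P) = \tr (L *m aG g)).
  have -> : B *m aG g = B *m (aG g *m C *m B) by rewrite -mulmxA -LE -LC mulmxA BL.
  by rewrite -!mulmxA BP mulmx1 LC mxtrace_mulC LE !mulmxA.
rewrite /mxtrace reindex_gi big_distrr /=; apply: eq_bigr => h _.
rewrite LC mxE (bigD1 (gi (h * g)%g)) //= big1 ?addr0.
  rewrite regE eqxx mul1r mxE gring_indexGK linearZ /= mxE; congr (_ * _); rewrite mxE.
  rewrite /M /galg mulmx_suml summxE (bigD1 (h * g^-1 * h^-1)%g) //= big1 ?addr0.
    by rewrite -scalemxAl mxE -regM regE mul1g -!mulgA mulKg mulVg mulg1 eqxx mulr1.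
  move=> k nk; rewrite -scalemxAl mxE -regM regE mul1g.
  by rewrite -(inj_eq (mulIg (h * g)^-1%g)) mulgK invMg mulgA (negPf nk) mulr0.
move=> k nk; rewrite -(enum_valGK k) regE.
have [e|_] := eqVneq (h * g)%g (enum_val k); last by rewrite mul0r.
by rewrite e enum_valGK eqxx in nk.
Qed.
End Specht.
End GroupAlgebra.

(** Factor A as a column base times a row base. Cancelling both full-rank factors in A A = a A shows
    that the product in the other order is the scalar matrix a, whose size is the rank. *)
Lemma mxtrace_quasi_idem (K : fieldType) n (A : 'M[K]_n) (a : K) :
  A *m A = a *: A -> \tr A = a * (\rank A)%:R.
Proof.
move=> AA; rewrite -{1}(mulmx_base A) mxtrace_mulC.
suff -> : row_base A *m col_base A = a%:M by rewrite mxtrace_scalar mulr_natr.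
apply: (row_free_inj (row_base_free A)); rewrite mul_scalar_mx.
apply: (@row_full_inj _ _ _ _ (col_base A)); first exact: col_base_full.
rewrite mulmxA [col_base A *m (_ *m _)]mulmxA mulmx_base -mulmxA mulmx_base AA.
by rewrite -scalemxAr mulmx_base.
Qed.

Section Primitive.
Variables (K : fieldType) (gT : finGroupType).
Hypothesis char0 : [pchar K] =i pred0.

Local Notation aG := (regular_repr K [set: gT]%G).
Local Notation N := (#|[set: gT]%G|).

Lemma natr_card_neq0 : (N%:R : K) != 0.
Proof. by rewrite (proj1 (pcharf0P K) char0) -lt0n cardG_gt0. Qed.

(* A self-adjoint primitive idempotent of the group algebra; the matrix
   transpose is the involution g |-> g^-1. *)
Definition primitive_idem (f : gT -> K) (tau : gT -> K) :=
  [/\ galg f *m galg f = galg f, (galg f)^T = galg f, \tr (galg f) != 0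
    & forall u, galg f *m aG u *m galg f = tau u *: galg f].

(** The case alpha = 1 of [tr_specht_galg]: the character of the ideal generated by an
    idempotent. *)
Definition idem_char (f : gT -> K) g : K := \sum_h f (h * g^-1 * h^-1)%g.

Lemma idem_charE f g :
  N%:R * idem_char f g = \sum_h \tr (galg f *m aG (h * g * h^-1)%g).
Proof.
rewrite /idem_char mulr_sumr; apply: eq_bigr => h _.
by rewrite tr_galg !invMg invgK mulgA.
Qed.

Lemma idem_charJ f g h : idem_char f (h * g * h^-1)%g = idem_char f g.
Proof.
rewrite /idem_char (reindex_inj (mulIg h^-1%g)) /=; apply: eq_bigr => k _.
by rewrite !invMg invgK !mulgA !mulgKV.
Qed.

Definition class_galg (M : 'M[K]_N) := \sum_g aG g *m M *m aG g^-1%g.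

Lemma class_galgC M h : class_galg M *m aG h = aG h *m class_galg M.
Proof.
rewrite /class_galg mulmx_suml mulmx_sumr [RHS](reindex_inj (mulgI h^-1%g)) /=.
apply: eq_bigr => g _; rewrite !mulmxA -regM mulKVg.
by rewrite invMg invgK regM !mulmxA.
Qed.

Lemma mul_class_galg (A M B : 'M[K]_N) :
  A *m class_galg M *m B = \sum_g A *m aG g *m M *m aG g^-1%g *m B.
Proof.
by rewrite mulmx_sumr mulmx_suml; apply: eq_bigr => g _; rewrite !mulmxA.
Qed.

Lemma mul_sum_mx (A B : 'M[K]_N) (c : gT -> K) (M : gT -> 'M[K]_N) :
  A *m (\sum_g c g *: M g) *m B = \sum_g c g *: (A *m M g *m B).
Proof.
rewrite mulmx_sumr mulmx_suml; apply: eq_bigr => g _.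
by rewrite -scalemxAr -scalemxAl.
Qed.

Lemma idem_char_class f g :
  N%:R * idem_char f g = \tr (class_galg (galg f) *m aG g).
Proof.
rewrite idem_charE /class_galg mulmx_suml raddf_sum (reindex_inj invg_inj) /=.
apply: eq_bigr => h _; rewrite invgK !regM !mulmxA.
by rewrite -!mulmxA [RHS]mxtrace_mulC !mulmxA.
Qed.

Section One.
Variables (f tau : gT -> K).
Hypothesis prim : primitive_idem f tau.
Let F := galg f.
Let t := \tr F.

Let tauE u : tau u = N%:R * f u^-1%g / t.
Proof.
case: prim => FF _ t0 Ftau; rewrite -tr_galg -/F.
apply: (canRL (mulfK t0)); rewrite -[LHS]linearZ /= -Ftau -/F.
by rewrite mxtrace_mulC mulmxA FF.
Qed.

Let sum_tau : \sum_u tau u *: aG u = (N%:R / t) *: F.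
Proof.
case: prim => _ FT _ _; rewrite /F -FT trmx_galg /galg scaler_sumr.
by apply: eq_bigr => u _; rewrite tauE scalerA mulrAC.
Qed.

Let sum_tauV : \sum_u tau u *: aG u^-1%g = (N%:R / t) *: F.
Proof.
rewrite -sum_tau (reindex_inj invg_inj); apply: eq_bigr => u _; rewrite invgK.
congr (_ *: _); case: prim => _ FT t0 Ftau.
have := congr1 trmx (Ftau u); rewrite !trmx_mul linearZ /= trmx_reg FT mulmxA Ftau.
move/(congr1 mxtrace); rewrite !linearZ /=; exact: mulIf.
Qed.

(** Between two copies of F, each conjugate g F g^-1 becomes tau(g) F g^-1 F, and by [sum_tauV] the
    sum of the tau(g) g^-1 is again a multiple of F. *)
Lemma class_idem_mul : class_galg F *m F = (N%:R / t) *: F.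
Proof.
case: prim => FF _ _ Ftau.
have -> : class_galg F *m F = F *m class_galg F *m F.
  suff {1}-> : F *m class_galg F = class_galg F *m F by rewrite -mulmxA FF.
  rewrite /F {1 3}/galg mulmx_suml mulmx_sumr; apply: eq_bigr => g _.
  by rewrite -scalemxAl -scalemxAr class_galgC.
rewrite mul_class_galg.
under eq_bigr => g _ do rewrite Ftau -!scalemxAl.
by rewrite -mul_sum_mx sum_tauV -scalemxAr -scalemxAl !FF.
Qed.

(* As F is self-adjoint, [tau u = tau u^-1]; this is why the Frobenius-Schur
   indicator of the module generated by F is 1. *)
Lemma sum_idem_mul : \sum_h \tr (F *m aG h *m aG h) = N%:R.
Proof.
have N0 := natr_card_neq0; case: (prim) => FF FT t0 Ftau.
apply: (mulfI (mulf_neq0 N0 (invr_neq0 t0))); rewrite -/F -/t mulr_sumr.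
(* Writing (N/t) F as [class_galg F *m F] surrounds one h by two copies of F; F h F = tau(h) F then
   removes this h from the trace. *)
have -> : \sum_h N%:R / t * \tr (F *m aG h *m aG h) =
   \sum_h \sum_g \tr (F *m aG h *m F *m aG (g^-1 * h * g^-1)%g).
  transitivity (\sum_h \sum_g \tr (F *m aG h *m aG g *m F *m aG g^-1%g *m aG h)).
    apply: eq_bigr => h _; rewrite -raddf_sum -mul_class_galg -linearZ /=.
    rewrite !scalemxAl -class_idem_mul -[_ *m F *m _]mulmxA -[_ *m (F *m _) *m _]mulmxA.
    by rewrite mxtrace_mulC -[LHS]mxtrace_mulC mxtrace_mulC -!mulmxA -class_galgC !mulmxA.
  rewrite exchange_big [RHS]exchange_big; apply: eq_bigr => g _ /=.
  rewrite [RHS](reindex_inj (mulIg g)) /=; apply: eq_bigr => h _.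
  by rewrite !mulgA mulgK !regM !mulmxA.
transitivity (\sum_g \sum_h tau h * \tr (F *m aG (g^-1 * h * g^-1)%g)).
  rewrite exchange_big; apply: eq_bigr => g _; apply: eq_bigr => h _ /=.
  by rewrite Ftau -scalemxAl linearZ.
transitivity (\sum_g \tr (F *m aG g^-1%g *m ((N%:R / t) *: F) *m aG g^-1%g)).
  apply: eq_bigr => g _; rewrite -sum_tau mul_sum_mx raddf_sum.
  by apply: eq_bigr => h _; rewrite [RHS]mxtraceZ !regM !mulmxA.
transitivity (\sum_g (N%:R / t) * (tau g^-1%g * \tr (F *m aG g^-1%g))).
  apply: eq_bigr => g _; rewrite -scalemxAr -scalemxAl linearZ /=.
  by rewrite Ftau -scalemxAl linearZ.
rewrite -mulr_sumr; congr (_ * _).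
rewrite (reindex_inj invg_inj) /=.
transitivity (\tr (F *m (\sum_g tau g *: aG g) *m 1%:M)); last first.
  by rewrite sum_tau mulmx1 -scalemxAr FF linearZ /= divfK.
rewrite mul_sum_mx raddf_sum; apply: eq_bigr => g _.
by rewrite invgK mulmx1 [RHS]mxtraceZ.
Qed.

Lemma sum_idem_char_sqr : \sum_h idem_char f (h * h)%g = N%:R.
Proof.
have N0 := natr_card_neq0; apply: (mulfI N0).
rewrite mulr_sumr.
transitivity (\sum_(x : gT) \sum_h \tr (F *m aG h *m aG h)); last first.
  by rewrite sum_idem_mul sumr_const -cardsT -[LHS]mulr_natl.
under eq_bigr => h _ do rewrite idem_charE.
rewrite exchange_big; apply: eq_bigr => x _ /=.
rewrite [RHS](reindex_inj (mulgI x)) [RHS](reindex_inj (mulIg x^-1%g)) /=.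
apply: eq_bigr => h _; rewrite -[in RHS]mulmxA -regM; congr (\tr (_ *m aG _)).
by rewrite !mulgA mulgKV.
Qed.
End One.

Section Complete.
Variables (I : finType) (f : I -> gT -> K) (tau : I -> gT -> K).
Hypothesis prim : forall i, primitive_idem (f i) (tau i).
Hypothesis orth : forall i j u, i != j -> galg (f i) *m aG u *m galg (f j) = 0.

(** Up to the factor N, the pairing is the trace of the central element [class_galg (galg (f i))]
    times [galg (f j)]. It is N for i = j by [class_idem_mul]; otherwise every term contains a
    vanishing sandwich. *)
Lemma idem_char_orth i j :
  \sum_g f j g * idem_char (f i) g = (i == j)%:R.
Proof.
have N0 := natr_card_neq0; apply: (mulfI N0); rewrite mulr_sumr.
transitivity (\tr (class_galg (galg (f i)) *m galg (f j))).
  rewrite /galg mulmx_sumr raddf_sum; apply: eq_bigr => g _.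
  by rewrite -scalemxAr [RHS]mxtraceZ -idem_char_class mulrCA.
have [<-|ne] := eqVneq i j.
  rewrite (class_idem_mul (prim i)) linearZ /= divfK ?mulr1 //.
  by case: (prim i).
rewrite mulr0 mxtrace_mulC -[galg (f j) *m _]mulmx1 mul_class_galg.
rewrite raddf_sum big1 // => g _; rewrite orth 1?eq_sym //.
by rewrite !mul0mx; apply: mxtrace0.
Qed.

Hypothesis classesI : (#|classes [set: gT]| <= #|I|)%N.

(* Orthogonality makes the [#|I|] class functions independent, and there are at
   most [#|I|] classes. *)
Lemma idem_char_span (phi : gT -> K) :
  (forall g h, phi (h * g * h^-1)%g = phi g) ->
  exists c : I -> K, forall g, phi g = \sum_i c i * idem_char (f i) g.
Proof.
move=> phiJ; pose rep (j : 'I_#|classes [set: gT]|) := repr (enum_val j).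
pose A := \matrix_(i < #|I|, j < #|classes [set: gT]|) idem_char (f (enum_val i)) (rep j).
have cf (psi : gT -> K) : (forall g h, psi (h * g * h^-1)%g = psi g) ->
    forall g, exists j, psi g = psi (rep j) /\ forall i, idem_char (f i) g = idem_char (f i) (rep j).
  move=> psiJ g.
  have cg : (g ^: [set: gT])%g \in classes [set: gT] by rewrite mem_classes ?inE.
  exists (enum_rank_in cg (g ^: [set: gT])%g).
  rewrite /rep enum_rankK_in //.
  have [h _ ->] := repr_class [set: gT]%G g.
  have J (xi : gT -> K) : (forall g h, xi (h * g * h^-1)%g = xi g) ->
      xi (g ^ h)%g = xi g.
    by move=> xiJ; rewrite -(xiJ g h^-1%g) invgK /conjg mulgA.
  by split=> [|i]; rewrite J //; apply: idem_charJ.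
have Afree : row_free A.
  apply: inj_row_free => v vA; apply/rowP => k; rewrite mxE.
  have v0 g : \sum_i v 0 (enum_rank i) * idem_char (f i) g = 0.
    have [j [_ e]] := cf (fun=> 0) (fun _ _ => erefl) g.
    transitivity ((v *m A) 0 j); last by rewrite vA mxE.
    rewrite mxE.
    rewrite [RHS](reindex enum_rank) /=; last first.
      by exists enum_val => i _; [apply: enum_rankK|apply: enum_valK].
    by apply: eq_bigr => i _; rewrite mxE enum_rankK e.
  have : \sum_g f (enum_val k) g * (\sum_i v 0 (enum_rank i) * idem_char (f i) g) = 0.
    by rewrite big1 // => g _; rewrite v0 mulr0.
  under eq_bigr => g _ do rewrite mulr_sumr.
  rewrite exchange_big (bigD1 (enum_val k)) //= [X in _ + X]big1 ?addr0.
    under eq_bigr => g _ do rewrite mulrCA.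
    by rewrite -mulr_sumr idem_char_orth eqxx mulr1 enum_valK.
  move=> i ni; under eq_bigr => g _ do rewrite mulrCA.
  by rewrite -mulr_sumr idem_char_orth (negPf ni) mulr0.
have Afull : row_full A.
  rewrite /row_full eqn_leq rank_leq_col /=.
  by move: Afree; rewrite /row_free => /eqP->.
have /submxP[v vA] := submx_full (\row_j phi (rep j)) Afull.
exists (fun i => v 0 (enum_rank i)) => g.
have [j [-> e]] := cf phi phiJ g.
move/rowP/(_ j): vA; rewrite !mxE => ->.
rewrite (reindex enum_rank) /=; last first.
  by exists enum_val => i _; [apply: enum_rankK|apply: enum_valK].
by apply: eq_bigr => i _; rewrite mxE enum_rankK e.
Qed.

(** By orthogonality each coefficient is the trace of the operator by which f_i acts on the module;
    this operator is idempotent, so its trace is its rank. *)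
Lemma idem_char_decomp n (rG : mx_representation K [set: gT]%G n) :
  exists m : I -> nat, forall g, \tr (rG g) = \sum_i (m i)%:R * idem_char (f i) g.
Proof.
have [|c cE] := @idem_char_span (fun g => \tr (rG g)).
  by move=> g h; rewrite !repr_mxM ?inE // mxtrace_mulC mulmxA -repr_mxM ?inE // mulVg repr_mx1 mul1mx.
exists (fun i => \rank (gring_op rG (galg (f i)))) => g; rewrite cE.
apply: eq_bigr => i _; congr (_ * _).
have opE : gring_op rG (galg (f i)) = \sum_g f i g *: rG g.
  rewrite /galg linear_sum; apply: eq_bigr => h _.
  by rewrite linearZ /= gring_opG ?inE.
have opM A : gring_op rG (A *m galg (f i)) = gring_op rG A *m gring_op rG (galg (f i)).
  rewrite opE /galg !mulmx_sumr linear_sum; apply: eq_bigr => h _.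
  by rewrite -!scalemxAr linearZ /= gring_opE gring_row_mul gring_mxJ ?inE.
rewrite -[(\rank _)%:R]mul1r -mxtrace_quasi_idem; last first.
  by rewrite -opM scale1r; case: (prim i) => ->.
rewrite opE raddf_sum /=.
under eq_bigr => h _ do rewrite linearZ /= cE mulr_sumr.
rewrite exchange_big (bigD1 i) //= [X in _ + X]big1 ?addr0.
  under eq_bigr => h _ do rewrite mulrCA.
  by rewrite -mulr_sumr idem_char_orth eqxx mulr1.
move=> j nj; under eq_bigr => h _ do rewrite mulrCA.
by rewrite -mulr_sumr idem_char_orth (negPf nj) mulr0.
Qed.
End Complete.
End Primitive.

(** * Young symmetrizers *)

Section Tableaux.
Variable n : nat.
Implicit Types lam mu : Defs.partn n.

Let sh lam := map val (val lam).

Lemma sumn_partn lam : sumn (sh lam) = n.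
Proof. by case/andP: (valP lam) => _ /eqP. Qed.

Lemma nth_partn_mono lam r s : (r <= s)%N -> (nth 0 (sh lam) s <= nth 0 (sh lam) r)%N.
Proof.
move=> rs; case/andP: (valP lam) => so _.
have [ls|ls] := leqP (size (sh lam)) s; first by rewrite nth_default.
have := sorted_leq_nth (leT := geq) _ _ 0 so.
move=> /(_ (fun a b c h1 h2 => leq_trans h2 h1) (fun a => leqnn a)).
apply; rewrite ?inE //; exact: leq_ltn_trans ls.
Qed.

Lemma tab_col_lt lam (i : 'I_n) : (tab_col lam i < nth 0 (sh lam) (tab_row lam i))%N.
Proof. by apply: reshape_offsetP; rewrite sumn_partn. Qed.

Lemma tab_inj lam (i j : 'I_n) :
  tab_row lam i = tab_row lam j -> tab_col lam i = tab_col lam j -> i = j.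
Proof.
rewrite /tab_row /tab_col => er ec; apply: ord_inj.
by rewrite -(reshape_indexK (sh lam) i) -(reshape_indexK (sh lam) j) /sh er ec.
Qed.

Lemma tab_surj lam r c : (c < nth 0 (sh lam) r)%N ->
  exists i : 'I_n, tab_row lam i = r /\ tab_col lam i = c.
Proof.
move=> lt; have := flatten_indexP lt; rewrite sumn_partn => ltn.
by exists (Ordinal ltn); rewrite /tab_row /tab_col /= flatten_indexKl ?flatten_indexKr.
Qed.

Lemma tab_col_ltn lam (i : 'I_n) : (tab_col lam i < n)%N.
Proof. exact: leq_ltn_trans (leq_subr _ _) (ltn_ord i). Qed.

Lemma card_tab_row lam r : #|[set i | tab_row lam i == r]| = nth 0 (sh lam) r.
Proof.
set m := nth _ _ _; pose f (i : 'I_n) : option 'I_m := insub (tab_col lam i).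
have fin (i : 'I_n) : tab_row lam i = r -> exists2 c : 'I_m, f i = Some c & c = tab_col lam i :> nat.
  move=> er; have := tab_col_lt lam i; rewrite er -/m /f => lt.
  by exists (Ordinal lt); rewrite ?insubT.
rewrite -(card_ord m) -cardsT -(card_imset [set: 'I_m] Some_inj) -(card_in_imset (f := f)).
  apply: eq_card => o; apply/imsetP/imsetP => [[i] | [c _ ->]].
    by rewrite inE => /eqP /fin[c -> _] ->; exists c.
  have [i [er ec]] := @tab_surj lam r c (ltn_ord c).
  exists i; first by rewrite inE er.
  by have [d -> ed] := fin i er; congr Some; apply: ord_inj; rewrite ed.
move=> i j; rewrite !inE => /eqP ei /eqP ej.
have [c -> ec] := fin i ei; have [d -> ed] := fin j ej => -[cd].
by apply: (@tab_inj lam); [rewrite ei ej|rewrite -ec cd].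
Qed.

Lemma card_split_col lam (A : {set 'I_n}) (h : 'I_n -> 'I_n) :
  #|A| = (\sum_(c < n) #|[set i in A | tab_col lam (h i) == c]|)%N.
Proof.
rewrite -sum1_card (partition_big (fun i => Ordinal (tab_col_ltn lam (h i))) predT) //=.
by apply: eq_bigr => c _; rewrite -sum1dep_card; apply: eq_bigl => i; rewrite -val_eqE.
Qed.

(** Either the column reaches row k, and then each of the first k rows meets it, or it lies entirely
    within these rows. *)
Lemma card_tab_low lam k c :
  (minn k #|[set i | tab_col lam i == c]|
     <= #|[set i in [set i | tab_row lam i < k] | tab_col lam i == c]|)%N.
Proof.
have [/existsP[i /andP[/eqP ec ki]]|/existsPn no] :=
  boolP [exists i, (tab_col lam i == c) && (k <= tab_row lam i)%N].
  rewrite geq_min; apply/orP; left.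
  have ex (r : 'I_k) : [exists j, (tab_row lam j == r) && (tab_col lam j == c)].
    have [|j [er ej]] := @tab_surj lam r c; last by apply/existsP; exists j; rewrite er ej !eqxx.
    rewrite -ec; apply: leq_trans (tab_col_lt lam i) _; apply: nth_partn_mono.
    exact: leq_trans (ltnW (ltn_ord r)) ki.
  pose g r := xchoose (existsP (ex r)).
  have gP r : tab_row lam (g r) = r /\ tab_col lam (g r) = c.
    by have /andP[/eqP ? /eqP ?] := xchooseP (existsP (ex r)).
  rewrite -[X in (X <= _)%N](card_ord k) -(@card_imset _ _ g).
    apply: subset_leq_card; apply/fintype.subsetP => _ /imsetP[r _ ->]; rewrite !inE.
    by have [-> ->] := gP r; rewrite ltn_ord eqxx.
  by move=> r s e; apply: ord_inj; rewrite -(gP r).1 -(gP s).1 e.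
rewrite geq_min; apply/orP; right; apply: subset_leq_card; apply/fintype.subsetP => i.
rewrite !inE => ec; rewrite ec andbT ltnNge; have := no i.
by rewrite ec.
Qed.

(* If no column of mu contains the images of two cells of a row of lam, then the
   first k rows of lam have at most as many cells as those of mu: compare column
   by column, a column of mu receiving at most k cells of these rows. *)
Section Compare.
Variables (lam mu : Defs.partn n) (x : 'S_n).
Hypothesis inj : forall i j, tab_row lam i = tab_row lam j ->
  tab_col mu (x i) = tab_col mu (x j) -> i = j.

Lemma card_low_le k c :
  (#|[set i in [set i | tab_row lam i < k] | tab_col mu (x i) == c]|
   <= #|[set i in [set i | tab_row mu i < k] | tab_col mu i == c]|)%N.
Proof.
apply: leq_trans (card_tab_low mu k c); rewrite leq_min; apply/andP; split.
  case: k => [|k]; first by rewrite leqn0 cards_eq0; apply/eqP/setP => i; rewrite !inE.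
  rewrite -[X in (_ <= X)%N](card_ord k.+1).
  rewrite -(@card_in_imset _ _ (fun i : 'I_n => inord (tab_row lam i) : 'I_k.+1)) ?max_card //.
  move=> i j; rewrite !inE => /andP[ik /eqP ei] /andP[jk /eqP ej] /(congr1 val).
  rewrite /= !inordK // => er; apply: inj => //; by rewrite ei.
rewrite -(@card_in_imset _ _ x); last by move=> i j _ _; apply: perm_inj.
apply: subset_leq_card; apply/fintype.subsetP => y /imsetP[i]; rewrite !inE => /andP[_ /eqP <-] ->.
by [].
Qed.

Lemma card_rows_le k :
  (#|[set i | (tab_row lam i < k)%N]| <= #|[set i | (tab_row mu i < k)%N]|)%N.
Proof.
rewrite (card_split_col mu _ x) (card_split_col mu _ id).
by apply: leq_sum => c _; apply: card_low_le.
Qed.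
End Compare.

Lemma card_rows_inj lam mu :
  (forall k, #|[set i | (tab_row lam i < k)%N]| = #|[set i | (tab_row mu i < k)%N]|) ->
  lam = mu.
Proof.
move=> e; apply: val_inj; apply: val_inj => /=.
apply: (inj_map val_inj); apply: (@eq_from_nth _ 0%N); first by rewrite !size_map !size_tuple.
move=> r _; rewrite -!/(sh _) -!card_tab_row.
have S (nu : Defs.partn n) : #|[set i | (tab_row nu i < r.+1)%N]| =
    (#|[set i | (tab_row nu i < r)%N]| + #|[set i | tab_row nu i == r]|)%N.
  rewrite -cardsUI [X in (_ + #|pred_of_set X|)%N](_ : _ = finset.set0).
    by rewrite cards0 addn0; apply: eq_card => i; rewrite !inE ltnS leq_eqVlt orbC.
  by apply/setP => i; rewrite !inE; case: ltngtP.
by apply/eqP; rewrite -(eqn_add2l #|[set i | (tab_row lam i < r)%N]|) -S (e r) -S e.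
Qed.

(** With lam = mu the columnwise inequalities of [card_low_le] have equal sums, so they are
    equalities. Subtracting them for consecutive k yields, in the row of i, a cell in the column of
    x i; this cell is taken as the image of i under the row permutation. *)
Lemma tab_perm lam (x : 'S_n) :
  (forall i j, tab_row lam i = tab_row lam j ->
     tab_col lam (x i) = tab_col lam (x j) -> i = j) ->
  exists2 p : 'S_n, p \in row_stab lam & (p^-1 * x)%g \in col_stab lam.
Proof.
move=> inj.
have eqN k c : (c < n)%N ->
    #|[set i in [set i | tab_row lam i < k] | tab_col lam (x i) == c]|%N
    = #|[set i in [set i | tab_row lam i < k] | tab_col lam i == c]|%N.
  move=> cn; have /leqif_sum := fun (c : 'I_n) (_ : true) => leqif_eq (card_low_le inj k c).
  move=> -[_]; rewrite -(card_split_col lam _ x) -(card_split_col lam _ id) eqxx.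
  by move=> /esym /forallP/(_ (Ordinal cn)) /eqP.
have cell (i : 'I_n) : exists j, (tab_row lam j == tab_row lam i) && (tab_col lam j == tab_col lam (x i)).
  set k := tab_row lam i; set c := tab_col lam (x i).
  have cn : (c < n)%N by apply: tab_col_ltn.
  have S (h : 'S_n) : #|[set i in [set i | tab_row lam i < k.+1] | tab_col lam (h i) == c]|%N =
      (#|[set i in [set i | tab_row lam i < k] | tab_col lam (h i) == c]| +
       #|[set i | (tab_row lam i == k) && (tab_col lam (h i) == c)]|)%N.
    rewrite -cardsUI [X in (_ + #|pred_of_set X|)%N](_ : _ = finset.set0).
      by rewrite cards0 addn0; apply: eq_card => j; rewrite !inE ltnS leq_eqVlt -andb_orl orbC.
    by apply/setP => j; rewrite !inE; case: ltngtP; rewrite ?andbF.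
  have := eqN k.+1 c cn; rewrite S eqN //.
  have -> : #|[set i in [set i | tab_row lam i < k.+1] | tab_col lam i == c]|%N =
    #|[set i in [set i | tab_row lam i < k.+1] | tab_col lam ((1 : 'S_n)%g i) == c]|%N.
    by apply: eq_card => j; rewrite !inE perm1.
  rewrite S; have -> : #|[set i in [set i | tab_row lam i < k] | tab_col lam ((1 : 'S_n)%g i) == c]|%N =
    #|[set i in [set i | tab_row lam i < k] | tab_col lam i == c]|%N.
    by apply: eq_card => j; rewrite !inE perm1.
  move/addnI => e; apply/existsP; rewrite -[[exists _, _]]negbK; apply/negP => /existsPn no.
  have : (0 < #|[set i | (tab_row lam i == k) && (tab_col lam (x i) == c)]|)%N.
    by apply/card_gt0P; exists i; rewrite inE !eqxx.
  rewrite e; apply/negP; rewrite -leqNgt leqn0 cards_eq0; apply/eqP/setP => j.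
  by rewrite !inE perm1; apply/negbTE/no.
pose p0 i := xchoose (cell i).
have p0P i : tab_row lam (p0 i) = tab_row lam i /\ tab_col lam (p0 i) = tab_col lam (x i).
  by have /andP[/eqP ? /eqP ?] := xchooseP (cell i).
have p0i : injective p0.
  move=> i j e; apply: inj; first by rewrite -(p0P i).1 e (p0P j).1.
  by rewrite -(p0P i).2 e (p0P j).2.
exists (perm p0i); rewrite inE; apply/forallP => i; first by rewrite permE (p0P i).1.
have [j ->] : exists j, i = perm p0i j by exists ((perm p0i)^-1%g i); rewrite permKV.
by rewrite permM permK permE (p0P j).2.
Qed.
End Tableaux.

Section GroupRing.
Variables (K : fieldType) (gT : finGroupType).
Local Notation aG := (regular_repr K [set: gT]%G).
Local Notation N := (#|[set: gT]%G|).
Local Notation gi := (@gring_index gT [set: gT]%G).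

Definition gcoef (M : 'M[K]_N) g := M (gi 1%g) (gi g).

Definition in_gring (M : 'M[K]_N) := galg (gcoef M) = M.

Lemma galg_in_gring x : in_gring (galg x).
Proof. by rewrite /in_gring {1}/galg; apply: eq_bigr => g _; rewrite /gcoef galg_coef. Qed.

Lemma in_gringP M : reflect (in_gring M) (M \in enveloping_algebra_mx aG)%MS.
Proof.
apply: (iffP envelop_mxP) => [[x ->] | <-].
  suff -> : \sum_(g in [set: gT]%G) x g *: aG g = galg x by exact: galg_in_gring.
  by apply: eq_bigl => g; rewrite inE.
by exists (gcoef M); rewrite /galg; apply: eq_bigl => g; rewrite inE.
Qed.

Lemma in_gringM A B : in_gring A -> in_gring B -> in_gring (A *m B).
Proof. by move=> /in_gringP a /in_gringP b; apply/in_gringP; apply: envelop_mxM. Qed.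

Lemma in_gringZ c A : in_gring A -> in_gring (c *: A).
Proof.
by move=> /in_gringP a; apply/in_gringP; rewrite linearZ scalemx_sub.
Qed.

Lemma in_gring_sum (P : pred gT) (c : gT -> K) : in_gring (\sum_(g | P g) c g *: aG g).
Proof.
apply/in_gringP; rewrite linear_sum summx_sub // => g _.
by rewrite linearZ scalemx_sub // envelop_mx_id ?inE.
Qed.

(** In the sum over all conjugates, a group element h passes from one side of M to the other by
    substituting g h for g. *)
Lemma class_galg_mulC (A M : 'M[K]_N) : in_gring A ->
  class_galg (A *m M) = class_galg (M *m A).
Proof.
move=> <-; rewrite /class_galg.
transitivity (\sum_g \sum_h gcoef A h *: (aG g *m aG h *m M *m aG g^-1%g)).
  apply: eq_bigr => g _; rewrite /galg mulmx_suml mulmx_sumr mulmx_suml.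
  by apply: eq_bigr => h _; rewrite -scalemxAl -scalemxAr -scalemxAl !mulmxA.
transitivity (\sum_g \sum_h gcoef A h *: (aG g *m M *m aG h *m aG g^-1%g)); last first.
  apply: eq_bigr => g _; rewrite /galg mulmx_sumr mulmx_sumr mulmx_suml.
  by apply: eq_bigr => h _; rewrite -scalemxAr -scalemxAr -scalemxAl !mulmxA.
rewrite exchange_big [RHS]exchange_big /=; apply: eq_bigr => h _.
rewrite [RHS](reindex_inj (mulIg h)) /=; apply: eq_bigr => g _.
by rewrite -[X in _ = _ *: X]mulmxA -!regM invMg mulKVg.
Qed.

Lemma gring_sandwich0 (A B M : 'M[K]_N) : in_gring M ->
  (forall x, A *m aG x *m B = 0) -> A *m M *m B = 0.
Proof. by move=> <- AB; rewrite mul_sum_mx big1 // => x _; rewrite AB scaler0. Qed.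
End GroupRing.

Section Young.
Variables (K : fieldType) (n : nat).
Hypothesis char0 : [pchar K] =i pred0.
Implicit Types lam mu : Defs.partn n.
Local Notation aG := (regular_repr K [set: 'S_n]%G).
Local Notation N := (#|[set: 'S_n]%G|).

Lemma row_stabP lam (s : 'S_n) :
  reflect (forall i, tab_row lam (s i) = tab_row lam i) (s \in row_stab lam).
Proof. by rewrite inE; apply: (iffP forallP) => h i; apply/eqP. Qed.

Lemma col_stabP lam (s : 'S_n) :
  reflect (forall i, tab_col lam (s i) = tab_col lam i) (s \in col_stab lam).
Proof. by rewrite inE; apply: (iffP forallP) => h i; apply/eqP. Qed.

Lemma row_stabM lam (s t : 'S_n) : s \in row_stab lam ->
  ((s * t)%g \in row_stab lam) = (t \in row_stab lam).
Proof.
move=> /row_stabP sR; apply/row_stabP/row_stabP => tR i; last by rewrite permM tR.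
by have := tR (s^-1%g i); rewrite permM permKV => ->; rewrite -{2}(permKV s i) sR.
Qed.

Lemma col_stabM lam (s t : 'S_n) : s \in col_stab lam ->
  ((s * t)%g \in col_stab lam) = (t \in col_stab lam).
Proof.
move=> /col_stabP sR; apply/col_stabP/col_stabP => tR i; last by rewrite permM tR.
by have := tR (s^-1%g i); rewrite permM permKV => ->; rewrite -{2}(permKV s i) sR.
Qed.

Lemma row_stab1 lam : 1%g \in row_stab lam.
Proof. by apply/row_stabP => i; rewrite perm1. Qed.

Lemma col_stab1 lam : 1%g \in col_stab lam.
Proof. by apply/col_stabP => i; rewrite perm1. Qed.

Lemma row_stabV lam (s : 'S_n) : (s^-1%g \in row_stab lam) = (s \in row_stab lam).
Proof.
suff V t : t \in row_stab lam -> t^-1%g \in row_stab lam.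
  by apply/idP/idP => /V //; rewrite invgK.
by move=> tR; rewrite -(row_stabM _ tR) mulgV row_stab1.
Qed.

Lemma col_stabV lam (s : 'S_n) : (s^-1%g \in col_stab lam) = (s \in col_stab lam).
Proof.
suff V t : t \in col_stab lam -> t^-1%g \in col_stab lam.
  by apply/idP/idP => /V //; rewrite invgK.
by move=> tR; rewrite -(col_stabM _ tR) mulgV col_stab1.
Qed.

Definition row_sym lam : 'M[K]_N := \sum_(p in row_stab lam) aG p.
Definition col_alt lam : 'M[K]_N := \sum_(q in col_stab lam) (-1) ^+ q *: aG q.

Lemma young_symmetrizerE lam :
  young_symmetrizer K lam = row_sym lam *m col_alt lam.
Proof.
rewrite /young_symmetrizer mulmx_suml; apply: eq_bigr => p _.
rewrite mulmx_sumr; apply: eq_bigr => q _.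
by rewrite -scalemxAr -regM.
Qed.

Lemma row_sym_in_gring lam : in_gring (row_sym lam).
Proof.
rewrite (_ : row_sym lam = \sum_(p in row_stab lam) 1 *: aG p); first exact: in_gring_sum.
by apply: eq_bigr => p _; rewrite scale1r.
Qed.

Lemma col_alt_in_gring lam : in_gring (col_alt lam).
Proof. exact: in_gring_sum. Qed.

Lemma row_symR lam p : p \in row_stab lam -> row_sym lam *m aG p = row_sym lam.
Proof.
move=> pR; rewrite mulmx_suml [RHS](reindex_inj (mulIg p)) /=.
apply: eq_big => [q|q _]; last by rewrite -regM.
by rewrite -row_stabV -[in RHS]row_stabV invMg row_stabM // row_stabV.
Qed.

Lemma col_altL lam q : q \in col_stab lam -> aG q *m col_alt lam = (-1) ^+ q *: col_alt lam.
Proof.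
move=> qC; rewrite mulmx_sumr scaler_sumr [RHS](reindex_inj (mulgI q)) /=.
apply: eq_big => [p|p _]; first by rewrite col_stabM.
by rewrite -scalemxAr -regM scalerA -signr_addb odd_permM addKb.
Qed.

Lemma row_symT lam : (row_sym lam)^T = row_sym lam.
Proof.
rewrite linear_sum [RHS](reindex_inj invg_inj) /=.
by apply: eq_big => [p|p _]; rewrite ?row_stabV ?trmx_reg.
Qed.

Lemma col_altT lam : (col_alt lam)^T = col_alt lam.
Proof.
rewrite linear_sum [RHS](reindex_inj invg_inj) /=.
by apply: eq_big => [p|p _]; rewrite ?col_stabV // linearZ /= trmx_reg odd_permV.
Qed.

Lemma row_sym_sqr lam : row_sym lam *m row_sym lam = #|row_stab lam|%:R *: row_sym lam.
Proof.
rewrite {2}/row_sym mulmx_sumr (eq_bigr (fun=> row_sym lam)) => [|p pR]; last exact: row_symR.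
by rewrite sumr_const scaler_nat.
Qed.

(** The transposition of i and j is absorbed by the row sum; moved across x it becomes a column
    transposition, absorbed with sign -1. The product equals its own negative. *)
Lemma row_col_cancel lam mu (x : 'S_n) (i j : 'I_n) : i != j ->
  tab_row lam i = tab_row lam j -> tab_col mu (x i) = tab_col mu (x j) ->
  row_sym lam *m aG x *m col_alt mu = 0.
Proof.
move=> nij er ec; pose t := tperm i j.
have tR : t \in row_stab lam by apply/row_stabP => k; rewrite /t; case: tpermP => [->|->|].
have tC : tperm (x i) (x j) \in col_stab mu.
  by apply/col_stabP => k; case: tpermP => [->|->|].
have e : row_sym lam *m aG x *m col_alt mu = - (row_sym lam *m aG x *m col_alt mu).
  rewrite -{1}(row_symR tR) -mulmxA -[_ *m aG t *m _]mulmxA [aG t *m _]mulmxA -regM.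
  have -> : (t * x = x * tperm (x i) (x j))%g.
    by rewrite -tpermJ conjgE !mulgA mulgV mul1g.
  rewrite regM -mulmxA col_altL // odd_tperm (inj_eq perm_inj) nij expr1 scaleN1r.
  by rewrite !mulmxN mulmxA.
move/eqP: e; rewrite -subr_eq0 opprK -mulr2n -scaler_nat scaler_eq0.
by rewrite (proj1 (pcharf0P K) char0) /= => /eqP.
Qed.

(** By [row_col_cancel] a nonzero sandwich meets the hypothesis of [card_rows_le], which gives a
    dominance inequality. Nonzero sandwiches in both orders give it both ways, hence equal
    shapes. *)
Lemma row_col_orth lam mu : lam != mu ->
  (forall x, row_sym lam *m aG x *m col_alt mu = 0) \/
  (forall x, row_sym mu *m aG x *m col_alt lam = 0).
Proof.
move=> ne.
have le (nu rho : Defs.partn n) : ~ (forall x, row_sym nu *m aG x *m col_alt rho = 0) ->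
    forall k, (#|[set i | (tab_row nu i < k)%N]| <= #|[set i | (tab_row rho i < k)%N]|)%N.
  move=> /existsNP[x nz]; apply: (@card_rows_le _ _ _ x) => i j er ec.
  apply/eqP; apply: contra_notT nz => nij; exact: (row_col_cancel nij er ec).
have [h|/le h1] := pselect (forall x, row_sym lam *m aG x *m col_alt mu = 0); first by left.
have [h|/le h2] := pselect (forall x, row_sym mu *m aG x *m col_alt lam = 0); first by right.
move: ne; rewrite (card_rows_inj (lam := lam) (mu := mu)) ?eqxx // => k.
by apply/eqP; rewrite eqn_leq h1 h2.
Qed.

(** If no transposition cancels the sandwich, [tab_perm] factors x into a row and a column
    permutation, which are absorbed up to sign. *)
Lemma row_col_scalar lam x : exists c : K,
  row_sym lam *m aG x *m col_alt lam = c *: (row_sym lam *m col_alt lam).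
Proof.
have [[i [j [nij er ec]]]|no] := pselect (exists i j, [/\ i != j,
    tab_row lam i = tab_row lam j & tab_col lam (x i) = tab_col lam (x j)]).
  by exists 0; rewrite scale0r (row_col_cancel nij).
have [|p pR qC] := @tab_perm _ lam x.
  move=> i j er ec; apply/eqP; apply: contra_notT no => nij.
  by exists i, j.
exists ((-1) ^+ (p^-1 * x)%g); rewrite -{1}(mulKVg p x) regM !mulmxA row_symR //.
by rewrite -mulmxA col_altL // scalemxAr.
Qed.

Lemma sandwich lam (M : 'M[K]_N) : in_gring M -> exists c : K,
  row_sym lam *m M *m col_alt lam = c *: (row_sym lam *m col_alt lam).
Proof.
move=> <-; have [c cE] := boolp.choice (row_col_scalar lam).
exists (\sum_g gcoef M g * c g); rewrite mul_sum_mx scaler_suml.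
by apply: eq_bigr => g _; rewrite cE scalerA.
Qed.

(** A row permutation that is inverse to a column permutation fixes every cell, so only one pair
    contributes to the identity. *)
Lemma gcoef_young1 lam : gcoef (row_sym lam *m col_alt lam) 1%g = 1.
Proof.
rewrite -young_symmetrizerE /gcoef /young_symmetrizer summxE.
rewrite (bigD1 1%g) ?row_stab1 //= [X in _ + X]big1 ?addr0 => [|p /andP[pR p1]].
  rewrite summxE (bigD1 1%g) ?col_stab1 //= [X in _ + X]big1 ?addr0 => [|q /andP[qC q1]].
    by rewrite mulg1 odd_perm1 scale1r regE mulg1 eqxx.
  by rewrite mxE mul1g regE mul1g (negPf q1) mulr0.
rewrite summxE big1 // => q qC; rewrite mxE regE mul1g.
case: eqP => [e|]; last by rewrite mulr0.
case/eqP: p1; apply/permP => i; rewrite perm1; apply: (@tab_inj _ lam).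
  by apply/row_stabP.
have pq : p = (q^-1)%g by apply/eqP; rewrite eq_mulgV1 invgK e.
by rewrite pq; apply/col_stabP; rewrite col_stabV.
Qed.

Lemma tr_gring (M : 'M[K]_N) : in_gring M -> \tr M = N%:R * gcoef M 1%g.
Proof. by move=> {1}<-; rewrite -[galg _]mulmx1 -(repr_mx1 aG) tr_galg invg1. Qed.

(** The scalar comes from [sandwich]. It is not 0, because an element of square 0 has trace 0,
    whereas the coefficient 1 of the identity gives a nonzero trace. *)
Lemma young_quasi_idem lam : exists2 alpha : K, alpha != 0 &
  (row_sym lam *m col_alt lam) *m (row_sym lam *m col_alt lam)
    = alpha *: (row_sym lam *m col_alt lam).
Proof.
have [|c cE] := @sandwich lam (col_alt lam *m row_sym lam).
  by apply: in_gringM; [apply: col_alt_in_gring|apply: row_sym_in_gring].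
exists c; last by rewrite -cE !mulmxA.
apply: contra_neq (natr_card_neq0 {perm 'I_n} char0) => c0.
rewrite -[LHS]mulr1 -[X in _ * X](gcoef_young1 lam) -tr_gring; last first.
  by apply: in_gringM; [apply: row_sym_in_gring|apply: col_alt_in_gring].
rewrite (mxtrace_quasi_idem (a := 0)) ?mul0r // -c0 -cE !mulmxA //.
Qed.

(** The element a b a is self-adjoint, being a palindrome in the self-adjoint factors a and b. Its
    class sum agrees with that of r a b, since a moves cyclically inside a class sum; hence after
    normalisation it has the Specht character. *)
Lemma young_idem_ex lam : exists f : 'S_n -> K, exists tau c,
  [/\ primitive_idem f tau,
      galg f = c *: (row_sym lam *m col_alt lam *m row_sym lam) &
      forall g, specht_char K lam g = idem_char f g].
Proof.
have [alpha a0 aE] := young_quasi_idem lam.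
set a := row_sym lam in aE *; set b := col_alt lam in aE *.
have ga : in_gring a := row_sym_in_gring lam.
have gb : in_gring b := col_alt_in_gring lam.
have r0 : (#|row_stab lam|%:R : K) != 0.
  rewrite (proj1 (pcharf0P K) char0) -lt0n; apply/card_gt0P; exists 1%g; exact: row_stab1.
have aa : a *m a = #|row_stab lam|%:R *: a := row_sym_sqr lam.
set r : K := #|row_stab lam|%:R in r0 aa.
(* The constant comes from (a b a)(a b a) = a b (a a) b a = r (a b a b) a = r alpha (a b a). *)
set c := (r * alpha)^-1; pose F := c *: (a *m b *m a).
have c0 : c != 0 by rewrite invr_neq0 ?mulf_neq0.
have gF : in_gring F by rewrite /F; apply: in_gringZ; apply: in_gringM => //; apply: in_gringM.
have key u : exists t, F *m aG u *m F = t *: F.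
  have gu : in_gring (aG u) by apply/in_gringP/envelop_mx_id; rewrite inE.
  have [|t tE] := @sandwich lam (b *m a *m aG u *m a).
    by do ![apply: in_gringM => //].
  have e : a *m b *m a *m aG u *m (a *m b *m a) = t *: (a *m b *m a).
    by rewrite !mulmxA in tE *; rewrite tE -scalemxAl.
  by exists (c * t); rewrite /F -!scalemxAl -!scalemxAr e !scalerA; congr (_ *: _); ring.
have [tau tauE] := boolp.choice key.
exists (gcoef F), tau, c; rewrite /primitive_idem gF; split=> //; first split => //.
- rewrite /F -scalemxAl -scalemxAr scalerA.
  have -> : a *m b *m a *m (a *m b *m a) = a *m b *m (a *m a) *m b *m a by rewrite !mulmxA.
  rewrite aa -scalemxAr -!scalemxAl -[_ *m a *m b]mulmxA aE -scalemxAl !scalerA.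
  by congr (_ *: _); rewrite /c; field; rewrite r0 a0.
- by rewrite /F linearZ /= !trmx_mul /a /b row_symT col_altT mulmxA.
- rewrite /F linearZ /= mulf_neq0 // -mulmxA mxtrace_mulC -mulmxA aa -scalemxAr linearZ mulf_neq0 //=.
  rewrite mxtrace_mulC tr_gring; last exact: in_gringM.
  by rewrite gcoef_young1 mulr1 natr_card_neq0.
move=> g; have gc : in_gring (a *m b) by apply: in_gringM.
transitivity (alpha^-1 * \sum_h gcoef (a *m b) (h * g^-1 * h^-1)%g).
  rewrite -(tr_specht_galg a0) ?gc // /specht_char.
  by rewrite /specht_repr young_symmetrizerE.
have -> : \sum_h gcoef (a *m b) (h * g^-1 * h^-1)%g = idem_char (gcoef (a *m b)) g by [].
apply: (mulfI (natr_card_neq0 {perm 'I_n} char0)).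
rewrite mulrCA !idem_char_class gF gc /F.
have -> : class_galg (c *: (a *m b *m a)) = c *: class_galg (a *m b *m a).
  rewrite /class_galg [RHS]scaler_sumr; apply: eq_bigr => h _.
  by rewrite -scalemxAr -scalemxAl.
rewrite -(class_galg_mulC (a *m b) ga) mulmxA aa.
have -> : class_galg (r *: a *m b) = r *: class_galg (a *m b).
  rewrite /class_galg [RHS]scaler_sumr; apply: eq_bigr => h _.
  by rewrite -scalemxAl -scalemxAr -scalemxAl.
rewrite scalerA -scalemxAl linearZ /=; congr (_ * _).
by rewrite /c invfM mulrAC mulVf ?mul1r.
Qed.

Lemma specht_idem : exists (f : Defs.partn n -> 'S_n -> K) tau,
  [/\ forall lam, primitive_idem (f lam) (tau lam),
      forall lam mu u, lam != mu -> galg (f lam) *m aG u *m galg (f mu) = 0 &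
      forall lam g, specht_char K lam g = idem_char (f lam) g].
Proof.
have [f fE] := boolp.choice young_idem_ex; have [tau tauE] := boolp.choice fE.
exists f, tau; split=> [lam|lam mu u ne|lam g]; try by have [c []] := tauE lam.
have [c [_ -> _]] := tauE lam; have [d [_ -> _]] := tauE mu.
rewrite -!scalemxAl -!scalemxAr.
have gu : in_gring (aG u) by apply/in_gringP/envelop_mx_id; rewrite inE.
suff -> : row_sym lam *m col_alt lam *m row_sym lam *m aG u *m
    (row_sym mu *m col_alt mu *m row_sym mu) = 0 by rewrite !scaler0.
have [h|h] := row_col_orth ne.
  have := gring_sandwich0 (in_gringM gu (row_sym_in_gring mu)) h.
  set M := row_sym lam *m _ *m col_alt mu => h'.
  transitivity (row_sym lam *m col_alt lam *m M *m row_sym mu).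
    by rewrite /M !mulmxA.
  by rewrite h' mulmx0 mul0mx.
(* The transpose reverses the order of the factors and puts the vanishing sandwich of the second
   case into the order needed here. *)
have hT x : col_alt lam *m aG x *m row_sym mu = 0.
  apply: trmx_inj; rewrite !trmx_mul row_symT col_altT trmx_reg mulmxA h.
  by rewrite trmx0.
have := gring_sandwich0 (in_gringM (row_sym_in_gring lam) gu) hT.
set M := col_alt lam *m _ *m row_sym mu => h'.
transitivity (row_sym lam *m M *m col_alt mu *m row_sym mu).
  by rewrite /M !mulmxA.
by rewrite h' mulmx0 !mul0mx.
Qed.
End Young.

(** * Cycle types and partitions *)

Section CycleType.
Variable n : nat.
Implicit Types s t : 'S_n.

Lemma iter_modn_order s x i : iter (i %% fingraph.order s x)%N s x = iter i s x.
Proof.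
rewrite {2}(divn_eq i (fingraph.order s x)) addnC iterD; congr (iter _ _ _).
elim: (i %/ _)%N => //= q IHq; rewrite mulSn iterD -IHq iter_order //; exact: perm_inj.
Qed.

Lemma eq_iter_order s x i j :
  (iter i s x == iter j s x) = (i == j %[mod fingraph.order s x])%N.
Proof.
rewrite -(iter_modn_order s x i) -(iter_modn_order s x j).
apply/eqP/eqP => [e|-> //]; have o0 := fingraph.order_gt0 s x.
rewrite -[LHS](findex_iter (f := s) (x := x)) ?ltn_pmod // e.
by rewrite findex_iter ?ltn_pmod.
Qed.

Lemma froot_perm s x : froot s (s x) = froot s x.
Proof.
apply/esym/eqP; rewrite root_connect; last exact/fconnect_sym/perm_inj.
exact: fconnect1.
Qed.

Lemma froot_iter s x i : froot s (iter i s x) = froot s x.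
Proof. by elim: i => //= i IHi; rewrite froot_perm. Qed.

(** Sorting by decreasing cycle length turns the list of lengths into a partition and lets the
    orbits of two permutations be matched by position. *)
Definition cycle_reps s : seq 'I_n :=
  sort (fun x y => fingraph.order s y <= fingraph.order s x)%N
    [seq x <- enum 'I_n | froots s x].

Definition cycle_type s : seq nat := map (fingraph.order s) (cycle_reps s).

Lemma mem_cycle_reps s x : (x \in cycle_reps s) = (froot s x == x).
Proof. by rewrite mem_sort mem_filter mem_enum andbT. Qed.

Lemma cycle_reps_uniq s : uniq (cycle_reps s).
Proof. by rewrite sort_uniq filter_uniq ?enum_uniq. Qed.

Lemma froot_reps s x : froot s x \in cycle_reps s.
Proof. by rewrite mem_cycle_reps (root_root (fconnect_sym (@perm_inj _ s))). Qed.

Lemma iter_froot s x : iter (findex s (froot s x) x) s (froot s x) = x.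
Proof.
apply: iter_findex; rewrite fconnect_sym; last exact: perm_inj.
exact: connect_root.
Qed.

(* Match the orbit representatives of s and t by position in the sorted lists and
   transport along the iterates. *)
Lemma cycle_type_conj s t : cycle_type s = cycle_type t -> exists u : 'S_n, t = (s ^ u)%g.
Proof.
move=> est; have esz : size (cycle_reps s) = size (cycle_reps t).
  by move: (congr1 size est); rewrite !size_map.
pose G r := nth r (cycle_reps t) (index r (cycle_reps s)).
have ltG r : r \in cycle_reps s -> (index r (cycle_reps s) < size (cycle_reps t))%N.
  by move=> rs; rewrite -esz index_mem.
have GP r : r \in cycle_reps s -> G r \in cycle_reps t by move=> rs; rewrite mem_nth ?ltG.
have Gord r : r \in cycle_reps s -> fingraph.order t (G r) = fingraph.order s r.
  move=> rs; have := congr1 (fun w => nth 0%N w (index r (cycle_reps s))) est.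
  by rewrite (nth_map r) ?index_mem // nth_index // (nth_map r) ?ltG.
have Ginj r r' : r \in cycle_reps s -> r' \in cycle_reps s -> G r = G r' -> r = r'.
  move=> rs rs' /eqP; rewrite /G (@set_nth_default _ _ r' r) ?ltG // nth_uniq ?ltG ?cycle_reps_uniq //.
  by move=> /eqP e; rewrite -(nth_index r rs) e nth_index.
pose sg x := iter (findex s (froot s x) x) t (G (froot s x)).
have sgs x : sg (s x) = t (sg x).
  rewrite /sg froot_perm -iterS; apply/eqP; rewrite eq_iter_order Gord ?froot_reps //.
  rewrite -eq_iter_order iterS (iter_froot s x).
  by have := iter_froot s (s x); rewrite froot_perm => ->.
have sg_inj : injective sg.
  move=> x y e; have er : froot s x = froot s y.
    apply: Ginj; rewrite ?froot_reps //.
    have := GP _ (froot_reps s x); have := GP _ (froot_reps s y).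
    rewrite !mem_cycle_reps => /eqP <- /eqP <-.
    by have := congr1 (froot t) e; rewrite !froot_iter.
  rewrite -(iter_froot s x) -(iter_froot s y); move/eqP: e.
  rewrite /sg er eq_iter_order Gord ?froot_reps // => e; apply/eqP.
  by rewrite eq_iter_order.
exists (perm sg_inj); apply/permP => x.
have [y ->] : exists y, x = perm sg_inj y by exists ((perm sg_inj)^-1%g x); rewrite permKV.
by rewrite permJ !permE sgs.
Qed.

Lemma sumn_cycle_type s : sumn (cycle_type s) = n.
Proof.
rewrite sumnE big_map -[RHS](card_ord n) -sum1_card.
rewrite [RHS](partition_big (froot s) (mem (cycle_reps s))) => [|x _]; last exact: froot_reps.
rewrite -big_uniq ?cycle_reps_uniq //=; apply: eq_big_seq => r.
rewrite mem_cycle_reps => /eqP er; rewrite sum1dep_card /fingraph.order.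
apply: eq_card => x; rewrite !inE -[in RHS]er.
by rewrite (root_connect (fconnect_sym (@perm_inj _ s))) fconnect_sym //; apply: perm_inj.
Qed.

Lemma cycle_type_gt0 s : all (ltn 0) (cycle_type s).
Proof. by apply/allP => _ /mapP[x _ ->] /=; apply: fingraph.order_gt0. Qed.

Lemma size_cycle_type s : (size (cycle_type s) <= n)%N.
Proof.
rewrite size_map -[X in (_ <= X)%N](card_ord n) -(card_uniqP (cycle_reps_uniq s)).
exact: max_card.
Qed.

Lemma cycle_type_sorted s : sorted geq (cycle_type s).
Proof.
rewrite sorted_map; apply: sort_sorted => x y; exact: leq_total.
Qed.

Definition padded_type s := cycle_type s ++ nseq (n - size (cycle_type s)) 0%N.

Lemma size_padded_type s : size (padded_type s) == n.
Proof. by rewrite size_cat size_nseq subnKC ?size_cycle_type. Qed.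

Lemma padded_typeE s : map val (map (@inord n) (padded_type s)) = padded_type s.
Proof.
rewrite -map_comp map_id_in // => k; rewrite mem_cat => /orP[kc|/nseqP[-> _]] /=; last first.
  by rewrite inordK.
rewrite inordK // ltnS -(sumn_cycle_type s).
elim: (cycle_type s) kc => //= m c IHc; rewrite inE => /orP[/eqP->|/IHc h].
  exact: leq_addr.
exact: leq_trans h (leq_addl _ _).
Qed.

Definition padded_tuple s : n.-tuple 'I_n.+1 :=
  Tuple (introT eqP (etrans (size_map (@inord n) _) (eqP (size_padded_type s)))).

Fact padded_type_partn s :
  sorted geq (map val (padded_tuple s)) && (sumn (map val (padded_tuple s)) == n).
Proof.
rewrite padded_typeE sumn_cat sumn_nseq mul0n addn0 sumn_cycle_type eqxx andbT.
have gt : transitive geq by move=> a b c h1 h2; apply: leq_trans h2 h1.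
rewrite sorted_pairwise // pairwise_cat -!sorted_pairwise // cycle_type_sorted /=.
apply/andP; split; first by apply/allrelP => x y _ /nseqP[-> _].
by elim: (n - _)%N => [|[|k]].
Qed.

Definition cycle_partn s : Defs.partn n :=
  exist (fun t : n.-tuple 'I_n.+1 => sorted geq (map val t) && (sumn (map val t) == n))
    _ (padded_type_partn s).

Lemma cycle_partn_conj s t : cycle_partn s = cycle_partn t -> exists u : 'S_n, t = (s ^ u)%g.
Proof.
move=> /(congr1 (fun p : Defs.partn n => map val (val (val p)))) /=; rewrite !padded_typeE.
(* Keeping the positive parts removes exactly the padding, as cycle lengths are positive. *)
move=> /(congr1 (seq.filter (ltn 0))); rewrite !filter_cat.
have z k : seq.filter (ltn 0) (nseq k 0%N) = [::] by elim: k.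
by rewrite !z !cats0 !(all_filterP (cycle_type_gt0 _)); apply: cycle_type_conj.
Qed.

Lemma card_classes_partn : (#|classes [set: 'S_n]| <= #|{: Defs.partn n}|)%N.
Proof.
rewrite -(@card_in_imset _ _ (fun C : {set 'S_n} => cycle_partn (repr C))) ?max_card //.
move=> _ _ /imsetP[s _ ->] /imsetP[t _ ->] /cycle_partn_conj[u].
have [x _ ->] := repr_class [set: 'S_n]%G s; have [y _ ->] := repr_class [set: 'S_n]%G t.
rewrite -conjgM => e; apply/esym/class_eqP/imsetP.
exists (x * u * y^-1)%g; rewrite ?inE // conjgM -e -conjgM mulgV conjg1 //.
Qed.
End CycleType.

(** * The colength as an average of the cocharacter over squares *)

Section Average.
Variables (K : fieldType) (V : nalg K -> Prop) (n : nat).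
Hypothesis char0 : [pchar K] =i pred0.

Lemma colength_average :
  (#|{: 'S_n}| * colength V n)%:R = \sum_(h : 'S_n) cocharacter V (h * h)%g :> K.
Proof.
have [f [tau [prim orth fE]]] := specht_idem n char0.
have [m0 m0E] := idem_char_decomp char0 prim orth (card_classes_partn n) (Pn_repr V n).
have mE : forall s : 'S_n,
    cocharacter V s = \sum_(lam : Defs.partn n) (multiplicity V n lam)%:R * specht_char K lam s.
  pose P := [set m : {ffun Defs.partn n -> nat} | forall s : 'S_n,
    cocharacter V s = \sum_(lam : Defs.partn n) (m lam)%:R * specht_char K lam s]%classic.
  suff : P (multiplicity V n) by [].
  (* [multiplicity] is a chosen solution of its defining equation, so it suffices that [m0] is
     one. *)
  apply: xgetPex; exists [ffun lam => m0 lam] => s; rewrite /cocharacter m0E.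
  by apply: eq_bigr => lam _; rewrite ffunE fE.
under eq_bigr => h _ do rewrite mE.
rewrite exchange_big /= natrM /colength natr_sum mulr_sumr; apply: eq_bigr => lam _.
rewrite -mulr_sumr mulrC; congr (_ * _).
under eq_bigr => h _ do rewrite fE.
by rewrite (sum_idem_char_sqr char0 (prim lam)) cardsT.
Qed.
End Average.

(** * Multilinear identities of Htilde *)

Section Update.
Variables (K : fieldType) (A : nalg K).

Definition upd (X : eqType) T (v : X -> T) j a : X -> T := fun i => if i == j then a else v i.

Lemma updK (X : eqType) T (v : X -> T) j : upd v j (v j) =1 v.
Proof. by move=> i; rewrite /upd; case: eqP => [->|]. Qed.

Lemma upd_same (X : eqType) T (v : X -> T) j a : upd v j a j = a.
Proof. by rewrite /upd eqxx. Qed.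

Lemma eq_in_meval (X : eqType) (v w : X -> A) m :
  {in leaves m, v =1 w} -> meval v m = meval w m.
Proof.
elim: m => [x|p IHp q IHq] /= e; first by apply: e; rewrite inE.
by rewrite IHp ?IHq // => x xq; apply: e; rewrite mem_cat xq ?orbT.
Qed.

Lemma eq_meval (X : eqType) (v w : X -> A) m : v =1 w -> meval v m = meval w m.
Proof. by move=> e; apply: eq_in_meval => x _. Qed.

Lemma meval_upd_notin (X : eqType) (v : X -> A) j a m :
  j \notin leaves m -> meval (upd v j a) m = meval v m.
Proof.
move=> jm; apply: eq_in_meval => x xm; rewrite /upd.
by case: eqP xm jm => // -> ->.
Qed.

Lemma meval_deriv (X : eqType) (D : {additive A -> A}) (v : X -> A) m :
  (forall x y, D (nmul A x y) = nmul A (D x) y + nmul A x (D y)) ->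
  uniq (leaves m) ->
  D (meval v m) = \sum_(j <- leaves m) meval (upd v j (D (v j))) m.
Proof.
move=> Dmul; elim: m => [x|p IHp q IHq] /=; first by rewrite big_seq1 upd_same.
rewrite cat_uniq => /and3P[up /hasPn pq uq]; rewrite Dmul big_cat /=.
rewrite IHp // IHq // linear_sumlz linear_sumr; congr (_ + _).
  apply: eq_big_seq => j jp.
  rewrite [in RHS](@meval_upd_notin _ _ _ _ q) //.
  by apply: contraL jp => /pq.
apply: eq_big_seq => j jq.
by rewrite [in RHS](@meval_upd_notin _ _ _ _ p) //; apply: pq.
Qed.

Lemma meval_upd_linear (X : eqType) (v : X -> A) m j a x y :
  uniq (leaves m) -> j \in leaves m ->
  meval (upd v j (a *: x + y)) m = a *: meval (upd v j x) m + meval (upd v j y) m.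
Proof.
elim: m => [z|p IHp q IHq] /=; first by rewrite inE => _ /eqP->; rewrite !upd_same.
rewrite cat_uniq mem_cat => /and3P[up /hasPn pq uq].
have [jp _|njp /= jq] := boolP (j \in leaves p).
  have nq : j \notin leaves q by apply: contraL jp => /pq.
  by rewrite IHp // !(@meval_upd_notin _ _ _ _ q) // linearPl.
by rewrite IHq // !(@meval_upd_notin _ _ _ _ p) // linearPr.
Qed.

Section Multilinear.
Variables (n : nat) (u : mlmon n -> K).

Definition mlsum (v : 'I_n -> A) : A := \sum_m u m *: meval v (val m).

Lemma mlmon_uniq (m : mlmon n) : uniq (leaves (val m)).
Proof. by rewrite (perm_uniq (valP m)) enum_uniq. Qed.

Lemma mem_mlmon (m : mlmon n) j : j \in leaves (val m).
Proof. by rewrite (perm_mem (valP m)) mem_enum. Qed.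

Lemma size_mlmon (m : mlmon n) : size (leaves (val m)) = n.
Proof. by rewrite (perm_size (valP m)) size_enum_ord. Qed.

Lemma eq_mlsum v w : v =1 w -> mlsum v = mlsum w.
Proof. by move=> e; apply: eq_bigr => m _; rewrite (eq_meval _ e). Qed.

Lemma mlsum_deriv (D : {linear A -> A}) v :
  (forall x y, D (nmul A x y) = nmul A (D x) y + nmul A x (D y)) ->
  D (mlsum v) = \sum_j mlsum (upd v j (D (v j))).
Proof.
move=> Dmul; rewrite linear_sum exchange_big; apply: eq_bigr => m _ /=.
rewrite linearZ /= (meval_deriv _ Dmul) ?mlmon_uniq // scaler_sumr.
by rewrite (perm_big _ (valP m)) big_enum.
Qed.

Lemma mlsum_upd_linear v j a x y :
  mlsum (upd v j (a *: x + y)) = a *: mlsum (upd v j x) + mlsum (upd v j y).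
Proof.
rewrite /mlsum scaler_sumr -big_split; apply: eq_bigr => m _ /=.
by rewrite meval_upd_linear ?mlmon_uniq ?mem_mlmon // scalerDr !scalerA mulrC.
Qed.

Lemma mlsum_upd0 v j : mlsum (upd v j 0) = 0.
Proof.
by have := mlsum_upd_linear v j (-1) 0 0; rewrite scaler0 addr0 scaleN1r addNr.
Qed.

Lemma mlsum_updD v j x y : mlsum (upd v j (x + y)) = mlsum (upd v j x) + mlsum (upd v j y).
Proof. by have := mlsum_upd_linear v j 1 x y; rewrite !scale1r. Qed.

Lemma mlsum_updZ v j a x : mlsum (upd v j (a *: x)) = a *: mlsum (upd v j x).
Proof. by have := mlsum_upd_linear v j a x 0; rewrite mlsum_upd0 !addr0. Qed.
End Multilinear.
End Update.

Section HtildeDerivations.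
Variable K : fieldType.
Local Notation A := (Htilde K).

Definition ea : A := (delta_mx 0 0, 0).
Definition eb : A := (delta_mx 0 1, 0).
Definition ec : A := (delta_mx 0 2, 0).
Definition eT (f : {poly K}) : A := (0, f).

Lemma Htilde_mulE (x y : A) : nmul A x y = (heis_mul x.1 y.1, heis_act x.2 y.1).
Proof. by []. Qed.

Lemma HtildeE (x : A) : x = x.1 0 0 *: ea + x.1 0 1 *: eb + x.1 0 2 *: ec + eT x.2.
Proof.
case: x => y f; apply: injective_projections => /=; last by rewrite !scaler0 !add0r.
apply/rowP => i; rewrite !mxE /=.
by case: i => [[|[|[|i]]] lt] //=; rewrite ?mulr1 ?mulr0 ?addr0 ?add0r;
  congr (y 0 _); apply: ord_inj.
Qed.

(* der_a and der_b are the right multiplications by a and b. der_e and der_h come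
   from the linear symplectic transformations of the plane spanned by a and b,
   which act on T through the oscillator representation. *)
Definition der_a (x : A) : A := (x.1 0 1 *: delta_mx 0 2, x.2^`()).
Definition der_b (x : A) : A := (- x.1 0 0 *: delta_mx 0 2, 'X * x.2).
Definition der_e (x : A) : A := (x.1 0 0 *: delta_mx 0 1, - 2^-1 *: ('X^2 * x.2)).
Definition der_h (x : A) : A :=
  (- x.1 0 0 *: delta_mx 0 0 + x.1 0 1 *: delta_mx 0 1, 'X * x.2^`()).

Fact der_a_linear : linear der_a.
Proof.
move=> k [y f] [z g]; rewrite /der_a /=; congr (_, _) => /=.
  by rewrite !mxE scalerDl scalerA.
by rewrite derivD derivZ.
Qed.
HB.instance Definition _ := GRing.isLinear.Build K A A _ der_a der_a_linear.

Fact der_b_linear : linear der_b.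
Proof.
move=> k [y f] [z g]; rewrite /der_b /=; congr (_, _) => /=.
  by rewrite !mxE opprD scalerDl scalerA mulrN.
by rewrite mulrDr scalerAr.
Qed.
HB.instance Definition _ := GRing.isLinear.Build K A A _ der_b der_b_linear.

Fact der_e_linear : linear der_e.
Proof.
move=> k [y f] [z g]; rewrite /der_e /=; congr (_, _) => /=.
  by rewrite !mxE scalerDl scalerA.
by rewrite mulrDr scalerDr -scalerAr !scalerA mulrC.
Qed.
HB.instance Definition _ := GRing.isLinear.Build K A A _ der_e der_e_linear.

Fact der_h_linear : linear der_h.
Proof.
move=> k [y f] [z g]; rewrite /der_h /=; congr (_, _) => /=.
  by rewrite !mxE scalerDr !scalerA opprD !scalerDl mulrN addrACA.
by rewrite derivD derivZ mulrDr scalerAr.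
Qed.
HB.instance Definition _ := GRing.isLinear.Build K A A _ der_h der_h_linear.

Lemma der_aM x y : der_a (nmul A x y) = nmul A (der_a x) y + nmul A x (der_a y).
Proof.
case: x y => [y f] [z g]; rewrite !Htilde_mulE /der_a /heis_mul /heis_act /=; congr (_, _) => /=.
  by rewrite !mxE /= !(mulr0, mul0r, subr0, subrr, scale0r, addr0).
rewrite !derivD !derivZ derivM derivX mul1r !mxE /= -!mul_polyC ?polyCB ?polyCM ?polyCN.
by rewrite !polyC0 !polyC1; ring.
Qed.

Lemma der_bM x y : der_b (nmul A x y) = nmul A (der_b x) y + nmul A x (der_b y).
Proof.
case: x y => [y f] [z g]; rewrite !Htilde_mulE /der_b /heis_mul /heis_act /=; congr (_, _) => /=.
  by rewrite !mxE /= !(mulr0, mul0r, subr0, subrr, oppr0, scale0r, addr0).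
rewrite !derivM derivX mul1r !mxE /= -!mul_polyC ?polyCN ?polyCM ?polyCN.
by rewrite ?polyC0 ?polyC1; ring.
Qed.

Lemma der_hM x y : der_h (nmul A x y) = nmul A (der_h x) y + nmul A x (der_h y).
Proof.
case: x y => [y f] [z g]; rewrite !Htilde_mulE /der_h /heis_mul /heis_act /=; congr (_, _) => /=.
  rewrite !mxE /= !(mulr0, mulr1, mul0r, subr0, subrr, oppr0, scale0r, addr0, add0r).
  by rewrite -scalerDl; apply/esym/eqP; rewrite scaler_eq0; apply/orP; left; apply/eqP; ring.
rewrite !(derivD, derivZ, derivM, derivX) mul1r !mxE /= -!mul_polyC.
by rewrite !(mulr0, mulr1, addr0, add0r) ?polyCN; ring.
Qed.

Lemma der_eM x y : (2 : K) != 0 ->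
  der_e (nmul A x y) = nmul A (der_e x) y + nmul A x (der_e y).
Proof.
move=> two; case: x y => [y f] [z g]; rewrite !Htilde_mulE /der_e /heis_mul /heis_act /=.
congr (_, _) => /=.
  rewrite !mxE /= !(mulr0, mulr1, mul0r, subr0, sub0r, subrr, oppr0, scale0r, addr0, add0r).
  by rewrite -scalerDl; apply/esym/eqP; rewrite scaler_eq0; apply/orP; left; apply/eqP; ring.
rewrite !(derivD, derivZ, derivM, derivX) !mxE /= -!mul_polyC.
rewrite !(mulr0, mulr1, mul1r, addr0, add0r, polyC0, mul0r) !polyCN.
have h2 : (2^-1)%:P * 2 = 1 :> {poly K} by rewrite -polyC_natr -polyCM mulVf.
move: h2; set h := (2^-1)%:P => h2.
transitivity (- h * ('X^2 * ((z 0 0)%:P * f^`() + (z 0 1)%:P * ('X * f) + (z 0 2)%:P * f))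
   + (z 0 0)%:P * ('X * f) * (1 - h * 2)).
  by rewrite h2 subrr mulr0 addr0.
by ring.
Qed.
End HtildeDerivations.

(* A labeling l : 'I_n -> lab encodes the substitution of f in T, a, b, c for the
   variables labeled LI, LA, LB, LC respectively. *)
Definition lab := (bool * bool)%type.
Notation LI := ((false, false) : lab).
Notation LA := ((false, true) : lab).
Notation LB := ((true, false) : lab).
Notation LC := ((true, true) : lab).

Section Labelings.
Variable n : nat.
Implicit Type l : {ffun 'I_n -> lab}.

Definition cnt l x := (\sum_i (l i == x))%N.

Definition lupd l j x : {ffun 'I_n -> lab} := [ffun i => if i == j then x else l i].

Lemma cnt_lupd l j y x : (cnt (lupd l j y) x + (l j == x) = cnt l x + (y == x))%N.
Proof.
rewrite /cnt (bigD1 j) //= [in RHS](bigD1 j) //= ffunE eqxx.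
rewrite (eq_bigr (fun i => (l i == x) : nat)) => [|i /negPf ij]; last by rewrite ffunE ij.
by rewrite addnAC [RHS]addnAC; congr (_ + _)%N; rewrite addnC.
Qed.

Definition balanced d l := (cnt l LI == 1%N) && (cnt l LA == cnt l LB + d)%N.

Lemma cnt1P l x : cnt l x = 1%N -> exists2 i, l i = x & forall j, l j = x -> j = i.
Proof.
move=> c1; have [i /eqP ix|no] := pickP (fun i => l i == x); last first.
  by move: c1; rewrite /cnt big1 // => i _; rewrite no.
exists i => // j jx; apply/eqP; apply: contraPT c1 => ij.
by rewrite /cnt (bigD1 i) //= (bigD1 j) //= ix jx eqxx.
Qed.
End Labelings.

(** * Elements that vanish on balanced labelings *)

Section Kernel.
Variable K : fieldType.
Hypothesis char0 : [pchar K] =i pred0.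
Local Notation A := (Htilde K).

Lemma natf_neq0 k : (k.+1%:R : K) != 0.
Proof. by rewrite (proj1 (pcharf0P K) char0). Qed.

Definition lval (f : {poly K}) (x : lab) : A :=
  match x with
  | (false, false) => eT f
  | (false, true) => ea K
  | (true, false) => eb K
  | (true, true) => ec K
  end.

Lemma meval_fst0 (X : eqType) (v : X -> A) a m :
  a \in leaves m -> (v a).1 = 0 -> (meval v m).1 = 0.
Proof.
move=> + va; elim: m => [x|p IHp q IHq] /=; first by rewrite inE => /eqP <-.
rewrite ?Htilde_mulE /= mem_cat => /orP[/IHp|/IHq] ->.
  by rewrite /heis_mul !mxE !mul0r subrr scale0r.
by rewrite /heis_mul !mxE !mulr0 subrr scale0r.
Qed.

Lemma meval_snd0 (X : eqType) (v : X -> A) m :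
  (forall a, a \in leaves m -> (v a).2 = 0) -> (meval v m).2 = 0.
Proof.
elim: m => [x|p IHp q IHq] /= va; first by apply: va; rewrite inE.
rewrite ?Htilde_mulE /= IHp => [|a ap]; last by rewrite va // mem_cat ap.
by rewrite /heis_act deriv0 !mulr0 !scaler0 !addr0.
Qed.

(** A right factor acts only through its H-component, which is 0 as soon as one of its arguments
    lies in T. Both arguments from T would thus have to lie in the left factor, down to a single
    variable. *)
Lemma meval_snd02 (X : eqType) (v : X -> A) a b m :
  a != b -> a \in leaves m -> b \in leaves m -> (v a).1 = 0 -> (v b).1 = 0 ->
  (meval v m).2 = 0.
Proof.
move=> ab + + va vb; elim: m => [x|p IHp q IHq] /=.
  by rewrite !inE => /eqP ax /eqP bx; rewrite ax bx eqxx in ab.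
rewrite ?Htilde_mulE /= !mem_cat.
have z c : c \in leaves q -> (v c).1 = 0 -> heis_act (meval v p).2 (meval v q).1 = 0.
  move=> cq vc; rewrite (meval_fst0 cq vc) /heis_act !mxE !scale0r !addr0 //.
case/orP => [ap|/z ->//] /orP[bp|/z ->//].
by rewrite IHp // /heis_act deriv0 !mulr0 !scaler0 !addr0.
Qed.

Lemma meval_fst_center X (v : X -> A) m : (1 < size (leaves m))%N ->
  (meval v m).1 0 0 = 0 /\ (meval v m).1 0 1 = 0.
Proof.
case: m => [x|p q] //= _; rewrite ?Htilde_mulE /heis_mul /= !mxE /=.
by rewrite !mulr0.
Qed.

(** Products of two elements of H are multiples of the central element c, so products of three or
    more vanish. *)
Lemma meval_fst_nil X (v : X -> A) m : (2 < size (leaves m))%N -> (meval v m).1 = 0.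
Proof.
case: m => [x|p q] //=; rewrite size_cat => s3; rewrite ?Htilde_mulE /heis_mul /=.
have [p2|p1] := ltnP 1 (size (leaves p)).
  by have [-> ->] := meval_fst_center v p2; rewrite !mul0r subrr scale0r.
have q2 : (1 < size (leaves q))%N by move: (size_leaves p); lia.
by have [-> ->] := meval_fst_center v q2; rewrite !mulr0 subrr scale0r.
Qed.

Lemma deriv_eq0 (p : {poly K}) : p^`() = 0 -> p = p.[0]%:P.
Proof.
move=> dp; apply/polyP => -[|i]; first by rewrite coefC /= horner_coef0.
rewrite coefC /=; apply/eqP; have := congr1 (fun q : {poly K} => q`_i) dp.
by rewrite coef_deriv coef0 -mulr_natr => /eqP; rewrite mulf_eq0 (negPf (natf_neq0 i)) orbF.
Qed.

Section LabelSums.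
Variables (n : nat) (u : mlmon n -> K).
Implicit Type l : {ffun 'I_n -> lab}.

Definition labsum l f := mlsum u (fun i => lval f (l i)).

Lemma labsum_upd l f j x :
  mlsum u (upd (fun i => lval f (l i)) j (lval f x)) = labsum (lupd l j x) f.
Proof. by apply: eq_mlsum => i; rewrite /upd ffunE; case: eqP. Qed.

Lemma labsum_updI l f g j : cnt l LI = 1%N -> l j = LI ->
  mlsum u (upd (fun i => lval f (l i)) j (eT g)) = labsum l g.
Proof.
move=> /cnt1P[i0 li0 uniq] /uniq ->; apply: eq_mlsum => i; rewrite /upd.
case: eqP => [->|ne]; first by rewrite li0.
by case E: (l i) => [[] []] //; case: ne; apply: uniq.
Qed.

Lemma labsum_deriv_h l : cnt l LI = 1%N ->
  der_h (labsum l 1) = ((cnt l LB)%:R - (cnt l LA)%:R) *: labsum l 1.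
Proof.
move=> l1; rewrite /labsum (mlsum_deriv _ _ (@der_hM K)) -/(labsum l 1).
rewrite /cnt !natr_sum -sumrB scaler_suml; apply: eq_bigr => j _ /=.
have -> : der_h (lval 1 (l j)) = ((l j == LB)%:R - (l j == LA)%:R) *: lval 1 (l j).
  case: (l j) => [[] []] /=; rewrite /der_h /ec /eb /ea /eT /= !mxE /= ?subr0 ?sub0r ?subrr ?oppr0;
   rewrite ?scale0r ?scale1r ?add0r ?addr0 ?deriv0 ?derivC ?mulr0 //.
  by apply: injective_projections; rewrite /= ?scaler0.
rewrite mlsum_updZ; congr (_ *: _); apply: (eq_mlsum u (updK (fun i => lval 1 (l i)) j)).
Qed.

(** [der_a] sends b to c and kills a, c and the constant 1, so differentiating a value turns one
    label LB at a time into LC. *)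
Lemma labsum_deriv_a l : cnt l LI = 1%N ->
  (labsum l 1).2^`() = \sum_(j | l j == LB) (labsum (lupd l j LC) 1).2.
Proof.
move=> l1; rewrite -[LHS]/(der_a (labsum l 1)).2 /labsum (mlsum_deriv _ _ (@der_aM K)).
rewrite raddf_sum [RHS]big_mkcond; apply: eq_bigr => j _ /=.
have e : der_a (lval 1 (l j)) = if l j == LB then ec K else 0.
  by case: (l j) => [[] []] /=; rewrite /der_a /ec /= !mxE /= ?scale0r ?scale1r ?deriv0 ?derivC.
rewrite e; case: eqP => [lj|_]; last by rewrite mlsum_upd0.
by rewrite (@labsum_upd l 1 j LC).
Qed.

Lemma labsum_deriv_b l f : cnt l LI = 1%N ->
  'X * (labsum l f).2 = (labsum l ('X * f)).2
     - \sum_(j | l j == LA) (labsum (lupd l j LC) f).2.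
Proof.
move=> l1; have [i0 li0 uniq] := cnt1P l1.
rewrite -[LHS]/(der_b (labsum l f)).2 /labsum (mlsum_deriv _ _ (@der_bM K)).
have e j : der_b (lval f (l j)) = if l j == LA then - ec K else
    if l j == LI then eT ('X * f) else 0.
  by case: (l j) => [[] []] /=; rewrite /der_b /ec /eT /= !mxE /= ?oppr0 ?scale0r ?scale1r ?scaleN1r ?mulr0 ?oppr0;
   rewrite // -[- (_, _)]/(- _, - _) oppr0.
rewrite (bigD1 i0) //= e li0 /= labsum_updI //; congr (_ + _).
rewrite raddf_sum -sumrN [RHS]big_mkcond [RHS](bigD1 i0) //= li0 /= add0r; apply: eq_bigr => j nj.
rewrite e; case: eqP => [lj|_]; last first.
  case: eqP => [/uniq ji|_]; last by rewrite mlsum_upd0.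
  by rewrite ji eqxx in nj.
by rewrite -scaleN1r mlsum_updZ scaleN1r (@labsum_upd l f j LC).
Qed.

Lemma labsum_deriv_e l f : cnt l LI = 1%N ->
  - 2^-1 *: ('X^2 * (labsum l f).2) = (labsum l (- 2^-1 *: ('X^2 * f))).2
     + \sum_(j | l j == LA) (labsum (lupd l j LB) f).2.
Proof.
move=> l1; have [i0 li0 uniq] := cnt1P l1.
rewrite -[LHS]/(der_e (labsum l f)).2 /labsum (mlsum_deriv _ _ (fun x y => der_eM x y (natf_neq0 1))).
have e j : der_e (lval f (l j)) = if l j == LA then eb K else
    if l j == LI then eT (- 2^-1 *: ('X^2 * f)) else 0.
  by case: (l j) => [[] []] /=; rewrite /der_e /eb /eT /= !mxE /= ?scale0r ?scale1r ?mulr0 ?scaler0.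
rewrite (bigD1 i0) //= e li0 /= labsum_updI //; congr (_ + _).
rewrite raddf_sum [RHS]big_mkcond [RHS](bigD1 i0) //= li0 /= add0r; apply: eq_bigr => j nj.
rewrite e; case: eqP => [lj|_]; last first.
  case: eqP => [/uniq ji|_]; last by rewrite mlsum_upd0.
  by rewrite ji eqxx in nj.
by rewrite (@labsum_upd l f j LB).
Qed.

Lemma labsumD l f g a : cnt l LI = 1%N ->
  (labsum l (a *: f + g)).2 = a *: (labsum l f).2 + (labsum l g).2.
Proof.
move=> l1; have [i0 li0 _] := cnt1P l1.
rewrite -!(fun h => labsum_updI 0 h l1 li0).
have -> : eT (a *: f + g) = a *: eT f + eT g.
  by apply: injective_projections; rewrite //= scaler0 addr0.
by rewrite mlsum_upd_linear.
Qed.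

Hypothesis u0 : forall l, balanced 0 l -> (labsum l 1).2.[0] = 0.

(* By der_h the value at a labeling has T-component a multiple of
   X^(#LB - #LA), so only balanced labelings can give a nonzero constant term. *)
Lemma labsum_horner0 l : cnt l LI = 1%N -> (labsum l 1).2.[0] = 0.
Proof.
move=> l1; have [e|ne] := eqVneq (cnt l LA) (cnt l LB).
  by apply: u0; rewrite /balanced l1 addn0 e !eqxx.
have := congr1 (fun x : A => x.2.[0]) (labsum_deriv_h l1).
rewrite /= hornerM hornerX mul0r hornerZ => /esym/eqP.
rewrite mulf_eq0 subr_eq0 => /orP[|/eqP //].
case: ltngtP ne => // [lt|lt] _; [|rewrite eq_sym]; rewrite -subr_eq0 -natrB ?(ltnW lt) //.
- by rewrite -(subnSK lt) (negPf (natf_neq0 _)).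
- by rewrite -(subnSK lt) (negPf (natf_neq0 _)).
Qed.

(** Induction on the number of labels LB: the derivative is a sum of values with one label LB fewer,
    so the value is constant, and its constant term is 0 by [labsum_horner0]. *)
Lemma labsum1_eq0 l : cnt l LI = 1%N -> (labsum l 1).2 = 0.
Proof.
move: {2}(cnt l LB) (leqnn (cnt l LB)) => k; elim: k l => [|k IHk] l lk l1.
  rewrite (@deriv_eq0 (labsum l 1).2) ?labsum_horner0 // labsum_deriv_a // big1 // => j lj.
  have := cnt_lupd l j LC LB; rewrite lj /=; lia.
rewrite (@deriv_eq0 (labsum l 1).2) ?labsum_horner0 // labsum_deriv_a // big1 // => j lj.
apply: IHk.
  by have := cnt_lupd l j LC LB; rewrite lj /=; lia.
by have := cnt_lupd l j LC LI; rewrite (eqP lj) /=; lia.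
Qed.

(** [labsum_deriv_b] expresses the value at X f through values at f, with at most one label LA
    turned into LC; this carries the vanishing from constants to all polynomials. *)
Lemma labsum_eq0 l f : cnt l LI = 1%N -> (labsum l f).2 = 0.
Proof.
elim/poly_ind: f l => [|f c IHf] l l1.
  by have := labsumD 0 0 (-1) l1; rewrite scaler0 addr0 scaleN1r addNr.
rewrite -[f * 'X]scale1r labsumD // scale1r.
have -> : (labsum l c%:P).2 = 0.
  have := labsumD 1 0 c l1; rewrite addr0 -mul_polyC mulr1 => ->.
  rewrite labsum1_eq0 // scaler0 add0r.
  by have := labsumD 0 0 (-1) l1; rewrite scaler0 addr0 scaleN1r addNr.
rewrite addr0; have := labsum_deriv_b f l1.
rewrite IHf // mulr0 big1 ?subr0 => [|j lj]; first by rewrite mulrC.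
by apply: IHf; have := cnt_lupd l j LC LI; rewrite (eqP lj) /=; lia.
Qed.

Lemma mlsum_basic_eq0 (v : 'I_n -> A) :
  (forall j, exists x f, v j = lval f x) -> (mlsum u v).2 = 0.
Proof.
move=> vb; have [x xP] := boolp.choice vb; have [f fP] := boolp.choice xP.
pose l := finfun x.
have sumE : (mlsum u v).2 = \sum_m u m *: (meval v (val m)).2.
  by rewrite /mlsum (raddf_sum (@snd _ _)).
have [[i li]|no] := pselect (exists i, x i = LI); last first.
  rewrite sumE big1 // => m _; rewrite meval_snd0 ?scaler0 // => a _.
  rewrite fP; case E: (x a) => [[] []] //=; by case: no; exists a.
have [[j [nj lj]]|no] := pselect (exists j, j != i /\ x j = LI).
  rewrite sumE big1 // => m _; rewrite (meval_snd02 nj) ?mem_mlmon ?scaler0 //.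
    by rewrite fP lj.
  by rewrite fP li.
have ui j : x j = LI -> j = i.
  by move=> lj; apply/eqP; apply: contra_notT no => nj; exists j.
rewrite (@eq_mlsum _ _ _ u v (fun j => lval (f i) (l j))).
  apply: labsum_eq0; rewrite /cnt (bigD1 i) //= big1 ?addn0 => [|j nj]; first by rewrite ffunE li.
  by rewrite ffunE; case: eqP => // /ui e; rewrite e eqxx in nj.
move=> j; rewrite ffunE fP; case E: (x j) => [[] []] //.
by rewrite (ui _ E).
Qed.

Lemma mlsum_eq0 (v : 'I_n -> A) : (2 < n)%N -> mlsum u v = 0.
Proof.
move=> n3; apply: injective_projections.
  rewrite /mlsum (raddf_sum (@fst _ _)) big1 // => m _ /=.
  by rewrite meval_fst_nil ?scaler0 // size_mlmon.
(* Induction on the number k of leading arguments left arbitrary; linearity splits one of them into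
   multiples of a, b, c and an element of T. *)
suff main k : forall v, (forall j : 'I_n, (k <= j)%N -> exists x f, v j = lval f x) ->
    (mlsum u v).2 = 0.
  by apply: (main n) => j; rewrite leqNgt ltn_ord.
elim: k => [|k IHk] {}v vb; first by apply: mlsum_basic_eq0 => j; apply: vb.
have [kn|nk] := ltnP k n; last first.
  by apply: IHk => j kj; move: (ltn_ord j); rewrite ltnNge (leq_trans nk kj).
pose i := Ordinal kn.
have upd0 x f : (mlsum u (upd v i (lval f x))).2 = 0.
  apply: IHk => j kj; rewrite /upd; case: eqP => [_|ne]; first by exists x, f.
  apply: vb; rewrite ltn_neqAle kj andbT; apply/eqP => e; apply: ne.
  by apply: ord_inj.
rewrite (@eq_mlsum _ _ _ u v (upd v i (v i))); last by move=> j; rewrite updK.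
rewrite [v i]HtildeE !mlsum_updD !mlsum_updZ /=.
rewrite (upd0 LA 0) (upd0 LB 0) (upd0 LC 0) (upd0 LI).
by rewrite !scaler0 !addr0.
Qed.
End LabelSums.
End Kernel.

(** * Relations between the values of a multilinear element *)

Section Operators.
Variables (K : fieldType) (n : nat).
Hypothesis char0 : [pchar K] =i pred0.
Local Notation Lb := ({ffun 'I_n -> lab}).
Implicit Types (l : Lb) (F G : Lb -> K).

(* eop and fop are the sl_2 operators of the tensor power of the plane spanned by
   LA and LB; gop expresses the action of der_e on the polynomial argument. *)
Definition eop F l := \sum_(j | l j == LA) F (lupd l j LB).
Definition fop F l := \sum_(j | l j == LB) F (lupd l j LA).
Definition gop F l :=
  2^-1 * \sum_(j | l j == LA) \sum_(i | lupd l j LC i == LA) F (lupd (lupd l j LC) i LC).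

Lemma lupd_id l j x : l j = x -> lupd l j x = l.
Proof. by move=> lj; apply/ffunP => i; rewrite ffunE; case: eqP => [->|]. Qed.

Lemma lupd_same l j x y : lupd (lupd l j x) j y = lupd l j y.
Proof. by apply/ffunP => i; rewrite !ffunE; case: eqP. Qed.

Lemma lupdC l i j x y : i != j -> lupd (lupd l i x) j y = lupd (lupd l j y) i x.
Proof.
move=> ij; apply/ffunP => k; rewrite !ffunE.
by case: eqP => // ->; rewrite eq_sym (negPf ij).
Qed.

Lemma lupdE l j x : lupd l j x j = x.
Proof. by rewrite ffunE eqxx. Qed.

Lemma lupd_neq l j x i : i != j -> lupd l j x i = l i.
Proof. by move=> ij; rewrite ffunE (negPf ij). Qed.

Lemma natr_cnt l x : (cnt l x)%:R = \sum_(j | l j == x) 1 :> K.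
Proof.
rewrite /cnt natr_sum [RHS]big_mkcond; apply: eq_bigr => j _.
by case: eqP.
Qed.

Lemma op_swap F l x y : x != y ->
  \sum_(j | l j == x) \sum_(i | lupd l j y i == y) F (lupd (lupd l j y) i x)
  = (cnt l x)%:R * F l
    + \sum_(j | l j == x) \sum_(i | l i == y) F (lupd (lupd l j y) i x).
Proof.
move=> xy; rewrite natr_cnt mulr_suml -big_split; apply: eq_bigr => j /eqP lj /=.
rewrite (bigD1 j) ?lupdE //= lupd_same lupd_id // mul1r; congr (_ + _).
apply: eq_bigl => i; case: (eqVneq i j) => [->|ij]; last by rewrite lupd_neq ?andbT.
by rewrite andbF lj (negPf xy).
Qed.

Lemma op_commutator F l :
  eop (fop F) l - fop (eop F) l = ((cnt l LA)%:R - (cnt l LB)%:R) * F l.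
Proof.
rewrite /eop /fop !op_swap // mulrBl opprD addrACA [X in _ + X](_ : _ = 0) ?addr0 //.
apply/eqP; rewrite subr_eq0; apply/eqP; rewrite exchange_big; apply: eq_bigr => i /eqP li /=.
apply: eq_bigr => j /eqP lj; rewrite lupdC //.
by apply/eqP => e; rewrite e li in lj.
Qed.

Lemma cnt_le l x : (cnt l x <= n)%N.
Proof.
rewrite /cnt -[X in (_ <= X)%N](card_ord n) -sum1_card; apply: leq_sum => i _.
exact: leq_b1.
Qed.

(* fop (eop^(s+1) F) = - (s+1)(d+1+s) eop^s F, and eop is nilpotent. *)
Lemma lowest_weight_eq0 F d :
  (forall l, F l != 0 -> cnt l LA = (cnt l LB + d.+1)%N) ->
  (forall l, fop F l = 0) -> forall l, F l = 0.
Proof.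
move=> Fw fF; pose E s := iter s eop F.
have Ew s l : E s l != 0 -> cnt l LA = (cnt l LB + d.+1 + s.*2)%N.
  elim: s l => [|s IHs] l /=; first by move/Fw; lia.
  rewrite /eop => nz; have [j /andP[/eqP lj Ej]] : exists j, (l j == LA) && (E s (lupd l j LB) != 0).
    apply/existsP; apply: contraR nz => /existsPn no; apply/eqP/big1 => j lj.
    by have := no j; rewrite lj /= negbK => /eqP.
  have := IHs _ Ej; have := cnt_lupd l j LB LA; have := cnt_lupd l j LB LB.
  by rewrite lj /=; lia.
pose c s := (s.+1 * (d.+1 + s))%N.
have fE s l : fop (E s.+1) l = - (c s)%:R * E s l.
  have comm t k : fop (E t.+1) k = eop (fop (E t)) k - (d.+1 + t.*2)%:R * E t k.
    have := op_commutator (E t) k; rewrite -[eop (E t)]/(E t.+1).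
    have -> : ((cnt k LA)%:R - (cnt k LB)%:R) * E t k = (d.+1 + t.*2)%:R * E t k.
      have [->|/Ew ->] := eqVneq (E t k) 0; first by rewrite !mulr0.
      by rewrite -addnA natrD addrAC subrr add0r.
    by move=> <-; rewrite opprB addrC subrK.
  elim: s l => [|s IHs] l; rewrite comm.
    rewrite [X in X - _](_ : _ = 0) ?sub0r; last by rewrite /eop big1 // => j _; apply: fF.
    by rewrite /c mul1n addn0 mulNr.
  rewrite (_ : eop _ l = - (c s)%:R * E s.+1 l); last first.
    by rewrite /E /= /eop mulr_sumr; apply: eq_bigr => j _; rewrite IHs.
  rewrite !mulNr -opprD -mulrDl -natrD; congr (- (_%:R * _)).
  by rewrite /c; lia.
have E0 : forall l, E n.+1 l = 0.
  move=> l; apply/eqP; apply: contraT => /Ew; have := cnt_le l LA; lia.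
have down s : (forall l, E s.+1 l = 0) -> forall l, E s l = 0.
  move=> Es l; have := fE s l; rewrite /fop big1 => [/esym/eqP|j _]; last by rewrite Es.
  rewrite mulf_eq0 oppr_eq0 (proj1 (pcharf0P K) char0) /c muln_eq0 addSn /=.
  by move/eqP.
suff all s : (forall l, E s l = 0) -> forall l, E 0%N l = 0 by exact: all E0.
by elim: s => [|s IHs] // Es; apply: IHs; apply: down.
Qed.

Definition lswap l : Lb := [ffun i => if l i == LA then LB else if l i == LB then LA else l i].

Lemma lswapK : involutive lswap.
Proof. by move=> l; apply/ffunP => i; rewrite !ffunE; case: (l i) => [[] []]. Qed.

Lemma cnt_lswapA l : cnt (lswap l) LA = cnt l LB.
Proof. by apply: eq_bigr => i _; rewrite ffunE; case: (l i) => [[] []]. Qed.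

Lemma cnt_lswapB l : cnt (lswap l) LB = cnt l LA.
Proof. by apply: eq_bigr => i _; rewrite ffunE; case: (l i) => [[] []]. Qed.

Lemma lswap_lupd l j : lswap (lupd l j LA) = lupd (lswap l) j LB.
Proof. by apply/ffunP => i; rewrite !ffunE; case: (i == j). Qed.

Lemma highest_weight_eq0 F d :
  (forall l, F l != 0 -> cnt l LB = (cnt l LA + d.+1)%N) ->
  (forall l, eop F l = 0) -> forall l, F l = 0.
Proof.
move=> Fw eF l; rewrite -(lswapK l); move: (lswap l) => {l}.
apply: (@lowest_weight_eq0 _ d) => l.
  by move/Fw; rewrite cnt_lswapA cnt_lswapB.
rewrite -[RHS](eF (lswap l)) /eop /fop; apply: eq_big => j.
  by rewrite ffunE; case: (l j) => [[] []].
by rewrite lswap_lupd.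
Qed.

(** As F has weight 0, the commutation relation shows that [fop F] is killed by [eop]; but its
    weight is -2, and a nonzero highest weight vector has no negative weight. *)
Lemma eop_fop_eq0 F :
  (forall l, F l != 0 -> cnt l LA = cnt l LB) ->
  (forall l, eop F l = 0) -> forall l, fop F l = 0.
Proof.
move=> Fw eF; apply: (@highest_weight_eq0 _ 1) => l.
  rewrite /fop => nz; have [j /andP[/eqP lj Fj]] : exists j, (l j == LB) && (F (lupd l j LA) != 0).
    apply/existsP; apply: contraR nz => /existsPn no; apply/eqP/big1 => j lj.
    by have := no j; rewrite lj /= negbK => /eqP.
  have := Fw _ Fj; have := cnt_lupd l j LA LA; have := cnt_lupd l j LA LB.
  by rewrite lj /=; lia.
have := op_commutator F l; rewrite [fop (eop F) l]big1 => [|j _]; last exact: eF.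
rewrite subr0 => ->; have [->|/Fw ->] := eqVneq (F l) 0; first by rewrite mulr0.
by rewrite subrr mul0r.
Qed.

Lemma eop_adj F G : \sum_l G l * eop F l = \sum_l fop G l * F l.
Proof.
rewrite (eq_bigr (fun l => \sum_j (l j == LA)%:R * (G l * F (lupd l j LB)))); last first.
  move=> l _; rewrite /eop mulr_sumr big_mkcond; apply: eq_bigr => j _.
  by case: eqP; rewrite ?mul1r ?mul0r.
rewrite [RHS](eq_bigr (fun l => \sum_j (l j == LB)%:R * (G (lupd l j LA) * F l))); last first.
  move=> l _; rewrite /fop mulr_suml big_mkcond; apply: eq_bigr => j _.
  by case: eqP; rewrite ?mul1r ?mul0r.
rewrite exchange_big [RHS]exchange_big; apply: eq_bigr => j _ /=.
rewrite [LHS](eq_bigr (fun l => if l j == LA then G l * F (lupd l j LB) else 0)); last first.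
  by move=> l _; case: eqP; rewrite ?mul1r ?mul0r.
rewrite [RHS](eq_bigr (fun l => if l j == LB then G (lupd l j LA) * F l else 0)); last first.
  by move=> l _; case: eqP; rewrite ?mul1r ?mul0r.
rewrite -!big_mkcond /= (reindex_onto (fun l => lupd l j LA) (fun l => lupd l j LB)) /=; last first.
  by move=> l /eqP lj; rewrite lupd_same lupd_id.
apply: eq_big => l; rewrite lupdE eqxx lupd_same /=.
  by apply/eqP/eqP => [<-|lj]; rewrite ?lupdE ?lupd_id.
by move=> /eqP ->.
Qed.

(** Taking constant terms in [labsum_deriv_e] kills its left side. The remaining value at -X^2/2 is
    reduced by [labsum_deriv_b], once for each factor X, to values with two labels LA turned into
    LC. *)
Lemma labsum_relation (u : mlmon n -> K) l : cnt l LI = 1%N ->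
  eop (fun k => (labsum u k 1).2.[0]) l = gop (fun k => (labsum u k 1).2.[0]) l.
Proof.
move=> l1.
have l1' j k : cnt k LI = 1%N -> k j == LA -> cnt (lupd k j LC) LI = 1%N.
  by move=> k1 /eqP kj; have := cnt_lupd k j LC LI; rewrite kj /=; lia.
have step k f : cnt k LI = 1%N -> (labsum u k ('X * f)).2.[0] =
    \sum_(j | k j == LA) (labsum u (lupd k j LC) f).2.[0].
  move=> k1; have := congr1 (fun p => p.[0]) (labsum_deriv_b u f k1).
  by rewrite hornerM hornerX mul0r hornerD hornerN horner_sum => /esym/eqP; rewrite subr_eq0 => /eqP.
have := congr1 (fun p => p.[0]) (labsum_deriv_e char0 u 1 l1).
rewrite hornerZ hornerM hornerXn expr0n mul0r mulr0 hornerD horner_sum => /esym/eqP.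
rewrite addrC addr_eq0 => /eqP; rewrite -[LHS]/(eop (fun k => (labsum u k 1).2.[0]) l) => ->.
have -> : (labsum u l (- 2^-1 *: ('X^2 * 1))).2 = - 2^-1 *: (labsum u l ('X * 'X)).2.
  rewrite mulr1 expr2; have := labsumD u ('X * 'X) 0 (- 2^-1) l1; rewrite addr0 => ->.
  by have := labsumD u 0 0 (-1) l1; rewrite scaler0 addr0 scaleN1r addNr => ->; rewrite addr0.
rewrite hornerZ mulNr opprK /gop; congr (_ * _); rewrite step //; apply: eq_bigr => j lj.
by rewrite -[in LHS](mulr1 'X) step //; apply: l1'.
Qed.
End Operators.

(** * Bracket functions and the invariant theory of sl_2 *)

Section Brackets.
Variables (K : fieldType) (n : nat).
Hypothesis char0 : [pchar K] =i pred0.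
Local Notation Lb := ({ffun 'I_n -> lab}).
Implicit Types (l : Lb) (F G : Lb -> K) (D : {set 'I_n}) (w : seq ('I_n * 'I_n)).

(* The c-coordinate of the product in H of the elements labeled x and y. *)
Definition bracket (x y : lab) : K :=
  ((x == LB) && (y == LA))%:R - ((x == LA) && (y == LB))%:R.

Definition pairs_flat w : seq 'I_n := flatten [seq [:: p.1; p.2] | p <- w].

(** The intended value of a monomial in which variable i takes the argument from T, the variables of
    each pair are multiplied inside H, and all others are labeled LC. *)
Definition bracket_fun i w l : K :=
  [&& l i == LI & [forall z, (z \in i :: pairs_flat w) || (l z == LC)]]%:R
   * \prod_(p <- w) bracket (l p.1) (l p.2).

(** Relabeling x and j by LC meets the demand of [bracket_fun i w] on positions outside its
    pairs. *)
Lemma bracket_fun_cons i w x j l : uniq (i :: pairs_flat ((x, j) :: w)) ->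
  bracket_fun i ((x, j) :: w) l
  = bracket (l x) (l j) * bracket_fun i w (lupd (lupd l x LC) j LC).
Proof.
rewrite /= !inE !negb_or => /and3P[/and3P[ix ij iw] /andP[xj xw] /andP[jw uw]].
rewrite /bracket_fun big_cons /= mulrCA; congr (_ * (_%:R * _)); last first.
  apply: eq_big_seq => p pw; have pf q : q \in [:: p.1; p.2] -> q \in pairs_flat w.
    by move=> qp; apply/flatten_mapP; exists p.
  have px q : q \in [:: p.1; p.2] -> lupd (lupd l x LC) j LC q = l q.
    move=> /pf qw; rewrite !lupd_neq //.
      by apply: contraNneq xw => <-.
    by apply: contraNneq jw => <-.
  by rewrite !px ?inE ?eqxx ?orbT.
rewrite !lupd_neq //; congr (_ && _); apply: eq_forallb => z.
rewrite !inE; have [->|zj] := eqVneq z j; first by rewrite lupdE !orbT.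
rewrite lupd_neq //; have [->|zx] := eqVneq z x; first by rewrite lupdE !orbT.
by rewrite lupd_neq.
Qed.

Lemma lupd4 l x j a b c d :
  lupd (lupd (lupd (lupd l x a) j b) x c) j d = lupd (lupd l x c) j d.
Proof. by apply/ffunP => z; rewrite !ffunE; case: (z == j); case: (z == x). Qed.

(** [eop] and [fop] leave the positions of LI and LC unchanged, so a function can be treated on one
    such support at a time. *)
Definition on_support i D l :=
  [&& i \notin D, l i == LI &
    [forall z, (z != i) ==> if z \in D then (l z == LA) || (l z == LB) else l z == LC]].

Lemma on_supportP i D l : on_support i D l ->
  [/\ i \notin D, l i = LI, forall z, z \in D -> l z = LA \/ l z = LB &
      forall z, z != i -> z \notin D -> l z = LC].
Proof.
case/and3P => iD /eqP li /forallP h; split=> // z.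
  move=> zD; have := h z; rewrite zD; case: eqP => [e|_] /=.
    by rewrite -e zD in iD.
  by case/orP => /eqP; [left|right].
by move=> zi zD; have := h z; rewrite zi (negPf zD) => /eqP.
Qed.

Lemma on_support_lupd i D l j x y : x \in [:: LA; LB] -> y \in [:: LA; LB] -> l j = x ->
  on_support i D (lupd l j y) = on_support i D l.
Proof.
move=> xAB yAB lj.
have xy z : (x == LA) || (x == LB) by move: xAB; rewrite !inE.
have [ji|ij] := eqVneq i j.
  rewrite /on_support -ji lupdE ji lj.
  by move: xAB yAB; rewrite !inE => /orP[]/eqP-> /orP[]/eqP->; rewrite !andbF.
rewrite /on_support lupd_neq //; congr [&& _, _ & _]; apply: eq_forallb => z.
have [->|zj] := eqVneq z j; last by rewrite lupd_neq.
rewrite lupdE lj; move: xAB yAB.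
by rewrite !inE => /orP[]/eqP-> /orP[]/eqP->; case: (j \in D).
Qed.

Definition bracket_span i D k F :=
  exists s : seq (K * seq ('I_n * 'I_n)),
   (forall cw, cw \in s -> [/\ size cw.2 = k, uniq (i :: pairs_flat cw.2) &
                              {subset pairs_flat cw.2 <= D}])
   /\ forall l, F l = \sum_(cw <- s) cw.1 * bracket_fun i cw.2 l.

Lemma bracket_span0 i D k F : (forall l, F l = 0) -> bracket_span i D k F.
Proof. by move=> F0; exists [::]; split=> // l; rewrite big_nil. Qed.

Lemma bracket_spanD i D k F G H : bracket_span i D k F -> bracket_span i D k G ->
  (forall l, H l = F l + G l) -> bracket_span i D k H.
Proof.
move=> [s [sP sE]] [t [tP tE]] HE; exists (s ++ t); split=> [cw|l].
  by rewrite mem_cat => /orP[/sP|/tP].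
by rewrite HE sE tE big_cat.
Qed.

Lemma bracket_span_sum i D k I (r : seq I) (F : I -> Lb -> K) H :
  (forall j, bracket_span i D k (F j)) ->
  (forall l, H l = \sum_(j <- r) F j l) -> bracket_span i D k H.
Proof.
move=> FP; elim: r H => [|j r IHr] H HE.
  by apply: bracket_span0 => l; rewrite HE big_nil.
apply: (bracket_spanD (FP j) (IHr (fun l => \sum_(j <- r) F j l) _)) => // l.
by rewrite HE big_cons.
Qed.

Lemma bracket_spanZ i D k a F H : bracket_span i D k F ->
  (forall l, H l = a * F l) -> bracket_span i D k H.
Proof.
move=> [s [sP sE]] HE; exists [seq (a * cw.1, cw.2) | cw <- s]; split=> [cw|l].
  by move=> /mapP[cw' /sP h ->].
rewrite HE sE big_map mulr_sumr; apply: eq_bigr => cw _ /=; by rewrite mulrA.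
Qed.

Lemma bracket_span_cons i D k F H x j : x \in D -> j \in D -> x != j -> i \notin D ->
  bracket_span i (D :\ x :\ j) k F ->
  (forall l, H l = bracket (l x) (l j) * F (lupd (lupd l x LC) j LC)) ->
  bracket_span i D k.+1 H.
Proof.
move=> xD jD xj iD [s [sP sE]] HE; exists [seq (cw.1, (x, j) :: cw.2) | cw <- s].
have uP cw : cw \in s -> uniq (i :: pairs_flat ((x, j) :: cw.2)).
  move=> /sP[_ /= /andP[iw uw] sub]; rewrite !inE !negb_or iw uw xj /=.
  have -> : i != x by apply: contraNneq iD => ->.
  have -> : i != j by apply: contraNneq iD => ->.
  have -> : x \notin pairs_flat cw.2 by apply/negP => /sub; rewrite !inE eqxx andbF.
  by have -> : j \notin pairs_flat cw.2 by apply/negP => /sub; rewrite !inE eqxx.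
split=> [cw /mapP[cw' cws ->]|l] /=.
  have [sz _ sub] := sP _ cws; split; [by rewrite /= sz|exact: uP|].
  move=> z; rewrite /= !inE => /or3P[/eqP->|/eqP->|] // /sub; by rewrite !inE => /and3P[].
rewrite HE sE mulr_sumr big_map; apply: eq_big_seq => cw cws /=.
by rewrite bracket_fun_cons ?uP // mulrCA.
Qed.

(* Both eop F = 0 and fop F = 0 say that the sum of F over all ways of moving the
   label a of x to a position labeled b vanishes. *)
Lemma exchange_sum F i D k x l a b :
  a \in [:: LA; LB] -> b \in [:: LA; LB] -> a != b ->
  (forall l, F l != 0 -> [/\ on_support i D l, cnt l LA = k & cnt l LB = k]) ->
  l x = a ->
  \sum_(j | lupd l x b j == b) F (lupd (lupd l x b) j a) = 0 ->
  k.+1%:R * F l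
  = \sum_(j in D :\ x) (l j == b)%:R * (F l - F (lupd (lupd l x b) j a)).
Proof.
move=> aAB bAB ab Fs lx; rewrite (bigD1 x) ?lupdE //= lupd_same lupd_id // => e0.
have out l' : ~~ on_support i D l' -> F l' = 0.
  by move=> no; apply/eqP; apply: contraNT no => /Fs[].
have [on|noff] := boolP (on_support i D l); last first.
  rewrite out // mulr0 big1 // => j; rewrite !inE => /andP[jx _].
  case: eqP => [lj|_]; last by rewrite mul0r.
  rewrite out ?subrr ?mulr0 //; rewrite (@on_support_lupd i D _ _ b) ?lupd_neq //.
  by rewrite (@on_support_lupd i D _ _ a).
have [iD li AB C] := on_supportP on.
have -> : \sum_(j in D :\ x) (l j == b)%:R * (F l - F (lupd (lupd l x b) j a))
    = \sum_(j | (lupd l x b j == b) && (j != x)) (F l - F (lupd (lupd l x b) j a)).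
  rewrite big_mkcond [RHS]big_mkcond; apply: eq_bigr => j _; rewrite !inE.
  have [->|jx] := eqVneq j x; first by rewrite andbF.
  rewrite lupd_neq //= andbT; case: eqP => [lj|_]; last by rewrite mul0r if_same.
  rewrite mul1r; case: ifP => // /negbT jD; exfalso.
  have [ji|ji] := eqVneq j i; first by move: bAB; rewrite -lj ji li !inE.
  by move: bAB; rewrite -lj (C j ji jD) !inE.
rewrite sumrB; move/eqP: e0; rewrite addrC addr_eq0 => /eqP ->; rewrite opprK.
have -> : \sum_(j | (lupd l x b j == b) && (j != x)) F l = (cnt l b)%:R * F l.
  rewrite natr_cnt mulr_suml; apply: eq_big => [j|j _]; last by rewrite mul1r.
  have [->|jx] := eqVneq j x; first by rewrite lx andbF (negPf ab).
  by rewrite lupd_neq // andbT.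
have [->|/Fs[_ cA cB]] := eqVneq (F l) 0; first by rewrite !mulr0 addr0.
have -> : cnt l b = k by move: bAB; rewrite !inE => /orP[]/eqP->.
by rewrite -natr1 mulrDl mul1r.
Qed.

Lemma on_support_erase i D l x j a b : x \in D -> j \in D -> x != j ->
  on_support i D (lupd (lupd l x a) j b) -> l x = LC -> l j = LC ->
  on_support i (D :\ x :\ j) l.
Proof.
move=> xD jD xj /on_supportP[iD li AB C] lx lj.
have ix : i != x by apply: contraNneq iD => ->.
have ij : i != j by apply: contraNneq iD => ->.
rewrite /on_support !inE (negPf iD) !andbF /=; rewrite !lupd_neq // in li.
rewrite li eqxx; apply/forallP => z; apply/implyP => zi; rewrite !inE.
have [->|zj] := eqVneq z j; first by rewrite lj.
have [->|zx] := eqVneq z x; first by rewrite lx.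
have e : lupd (lupd l x a) j b z = l z by rewrite !lupd_neq.
have [zD|zD] /= := boolP (z \in D); rewrite -e; last by rewrite C.
by have [->|->] := AB z zD.
Qed.

(* The first fundamental theorem for sl_2: fix x in D; averaging over the
   exchanges of x with the other positions writes F as a combination of functions
   bracket (l x) (l j) * F', where F' is again killed by eop on D minus {x, j}. *)
Lemma eop_zero_span i D k F :
  (forall l, F l != 0 -> [/\ on_support i D l, cnt l LA = k & cnt l LB = k]) ->
  (forall l, eop F l = 0) -> bracket_span i D k F.
Proof.
elim: k D F => [|k IHk] D F Fs eF.
  pose base : Lb := [ffun j => if j == i then LI else LC].
  exists [:: (F base, [::])]; split=> [cw|l]; first by rewrite inE => /eqP->.
  rewrite big_seq1 /bracket_fun big_nil mulr1 /=.
  have zl l' x : cnt l' x = 0%N -> forall z, l' z != x.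
    move=> c0 z; apply: contra_eq_neq c0 => lz.
    by rewrite /cnt (bigD1 z) //= lz eqxx.
  have Fb l' : F l' != 0 -> l' = base.
    case/Fs => /on_supportP[iD li AB C] /zl nA /zl nB; apply/ffunP => z; rewrite ffunE.
    case: eqP => [->//|/eqP zi]; apply: C => //; apply/negP => /AB.
    by case=> e; [have := nA z|have := nB z]; rewrite e eqxx.
  case: andP => [[/eqP li /forallP lC]|no]; last first.
    rewrite mulr0; apply/eqP; apply: contra_notT no => /Fb ->.
    by split; [rewrite ffunE eqxx|apply/forallP => z; rewrite inE ffunE; case: (z == i)].
  rewrite mulr1; congr F; apply/ffunP => z; rewrite ffunE.
  by have := lC z; rewrite inE; case: eqP => [->|_ /= /eqP].
have [[l0 nz0]|F0] := pselect (exists l, F l != 0); last first.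
  apply: bracket_span0 => l; apply/eqP; apply: contra_notT F0 => nz; by exists l.
have [/on_supportP[iD _ AB0 C0] cA _] := Fs _ nz0.
have [x /eqP xA] : exists x, l0 x == LA.
  apply/existsP; apply: contraPT cA => /existsPn no; rewrite /cnt big1 // => z _.
  by rewrite (negPf (no z)).
have l0i : l0 i = LI by have [/on_supportP[]] := Fs _ nz0.
have xi : x != i by apply/eqP => e; rewrite -e xA in l0i.
have xD : x \in D by apply/negPn/negP => nxD; have := C0 x xi nxD; rewrite xA.
have fF := eop_fop_eq0 char0 (F := F) _ eF.
(* The contraction of F with the bracket at positions x and j; it is set to 0 unless both carry LC,
   so that it lives on D without x and j. *)
pose Fj j l := if (l x == LC) && (l j == LC) then
  F (lupd (lupd l x LB) j LA) - F (lupd (lupd l x LA) j LB) else 0.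
pose H j l := bracket (l x) (l j) * Fj j (lupd (lupd l x LC) j LC).
have Fj_span j : j \in D :\ x -> bracket_span i (D :\ x :\ j) k (Fj j).
  rewrite !inE => /andP[jx jD]; have xj : x != j by rewrite eq_sym.
  apply: IHk => l; rewrite /Fj.
    case: andP => [[/eqP lx /eqP lj]|_]; last by rewrite eqxx.
    have count y z : cnt (lupd (lupd l x y) j z) LA = k.+1 ->
        cnt (lupd (lupd l x y) j z) LB = k.+1 ->
        [&& y \in [:: LA; LB], z \in [:: LA; LB] & y != z] ->
        cnt l LA = k /\ cnt l LB = k.
      have := cnt_lupd l x y LA; have := cnt_lupd l x y LB.
      have := cnt_lupd (lupd l x y) j z LA; have := cnt_lupd (lupd l x y) j z LB.
      rewrite lupd_neq // lx lj !inE => h1 h2 h3 h4 h5 h6 /and3P[/orP[]/eqP ? /orP[]/eqP ? p];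
        subst y z; move: p => // _; split; move: h1 h2 h3 h4; rewrite /=; lia.
    have [e|/Fs[on cA' cB']] := eqVneq (F (lupd (lupd l x LB) j LA)) 0.
      rewrite e sub0r oppr_eq0 => /Fs[on cA' cB']; have [] := count _ _ cA' cB' isT.
      by split=> //; apply: on_support_erase on lx lj.
    move=> _; have [] := count _ _ cA' cB' isT.
    by split=> //; apply: on_support_erase on lx lj.
  rewrite /eop; have [/andP[/eqP lx /eqP lj]|no] := boolP ((l x == LC) && (l j == LC)); last first.
    rewrite big1 // => y /eqP ly; case: ifP => // /andP[].
    have [->|yx] := eqVneq x y; first by rewrite lupdE.
    have [->|yj] := eqVneq j y; first by rewrite lupdE.
    by rewrite !lupd_neq // => lx lj; rewrite lx lj in no.
  (* Of the two positions x and j, the one labeled LA contributes to [eop] the value with LB at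
     both. This contribution cancels in the difference that defines [Fj j], leaving the terms at the
     other positions. *)
  have e1 : eop F (lupd (lupd l x LB) j LA) = F (lupd (lupd l x LB) j LB)
     + \sum_(y | l y == LA) F (lupd (lupd (lupd l y LB) x LB) j LA).
    rewrite /eop (bigD1 j) ?lupdE //= lupd_same; congr (_ + _); apply: eq_big => [y|y /andP[ly yj]].
      have [->|yj] := eqVneq y j; first by rewrite lj andbF.
      have [->|yx] := eqVneq y x; first by rewrite lupd_neq // lupdE lx.
      by rewrite !lupd_neq ?andbT.
    have yx : y != x by apply/eqP => e; move: ly; rewrite e lupd_neq // lupdE.
    by rewrite (lupdC _ LA LB) 1?eq_sym // (lupdC _ LB LB) // eq_sym.
  have e2 : eop F (lupd (lupd l x LA) j LB) = F (lupd (lupd l x LB) j LB)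
     + \sum_(y | l y == LA) F (lupd (lupd (lupd l y LB) x LA) j LB).
    rewrite /eop (bigD1 x) /=; last by rewrite lupd_neq // lupdE.
    rewrite (lupdC (lupd l x LA) LB LB) 1?eq_sym // lupd_same; congr (_ + _).
    apply: eq_big => [y|y /andP[ly yx]].
      have [->|yx] := eqVneq y x; first by rewrite lx andbF.
      have [->|yj] := eqVneq y j; first by rewrite lupdE lj.
      by rewrite !lupd_neq ?andbT.
    have yj : y != j by apply/eqP => e; move: ly; rewrite e lupdE.
    by rewrite (lupdC _ LB LB) 1?eq_sym // (lupdC _ LA LB) // eq_sym.
  transitivity (eop F (lupd (lupd l x LB) j LA) - eop F (lupd (lupd l x LA) j LB)); last first.
    by rewrite !eF subrr.
  rewrite e1 e2 opprD addrACA subrr add0r -sumrB; apply: eq_bigr => y /eqP ly.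
  have yx : x != y by apply/eqP => e; rewrite -e lx in ly.
  have yj : j != y by apply/eqP => e; rewrite -e lj in ly.
  by rewrite !(lupd_neq _ _ yx) !(lupd_neq _ _ yj) lx lj.
have HE j l : j \in D :\ x -> H j l = bracket (l x) (l j) *
    (F (lupd (lupd l x LB) j LA) - F (lupd (lupd l x LA) j LB)).
  rewrite !inE => /andP[jx _]; have xj : x != j by rewrite eq_sym.
  by rewrite /H /Fj lupdE lupd_neq // lupdE /= !lupd4.
(* In [exchange_sum] the [k.+1] labels opposite to that of x each contribute F l once, and the
   trivial exchange of x with itself adds one more. *)
have main l : k.+2%:R * F l = \sum_(j in D :\ x) H j l.
  case E: (l x) => [[] []].
  - have [e|/Fs[/on_supportP[_ _ AB _] _ _]] := eqVneq (F l) 0; last by have [] := AB x xD; rewrite E.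
    by rewrite e mulr0 big1 // => j jD; rewrite HE // E /bracket /= subrr mul0r.
  - rewrite (@exchange_sum F i D k.+1 x l LB LA) //; last exact: eF.
    apply: eq_bigr => j jD; rewrite HE // E /bracket /= subr0.
    by case: eqP => [lj|_]; rewrite ?mul0r // (lupd_id E) (lupd_id lj).
  - rewrite (@exchange_sum F i D k.+1 x l LA LB) //.
      apply: eq_bigr => j jD; rewrite HE // E /bracket /= sub0r mulNr -mulrN opprB.
      by case: eqP => [lj|_]; rewrite ?mul0r // (lupd_id E) (lupd_id lj).
    by apply: fF => l' /Fs[_ -> ->].
  have [e|/Fs[/on_supportP[_ _ AB _] _ _]] := eqVneq (F l) 0; last by have [] := AB x xD; rewrite E.
  by rewrite e mulr0 big1 // => j jD; rewrite HE // E /bracket /= subrr mul0r.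
apply: (@bracket_spanZ i D k.+1 (k.+2%:R)^-1 (fun l => \sum_(j in D :\ x) H j l)); last first.
  by move=> l; rewrite -main mulKf // (proj1 (pcharf0P K) char0).
apply: (@bracket_span_sum i D k.+1 _ (index_enum 'I_n) (fun j l => if j \in D :\ x then H j l else 0)); last first.
  by move=> l; rewrite big_mkcond.
move=> j; have [jD|_] := boolP (j \in D :\ x); last exact: bracket_span0.
move: (jD); rewrite !inE => /andP[jx jD'].
have xj : x != j by rewrite eq_sym.
by apply: (bracket_span_cons xD jD' xj iD (Fj_span j jD)) => l.
Qed.
End Brackets.

(** * Functions on labelings realised by multilinear elements *)

Section Image.
Variables (K : fieldType) (n : nat).
Hypothesis char0 : [pchar K] =i pred0.
Local Notation Lb := ({ffun 'I_n -> lab}).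
Implicit Types (l : Lb) (F G : Lb -> K) (D : {set 'I_n}) (w : seq ('I_n * 'I_n)).

Definition evalab l (m : monom 'I_n) : K :=
  (meval (fun i => lval 1 (l i)) m : Htilde K).2.[0].

Lemma labsumE (u : mlmon n -> K) l :
  (labsum u l 1).2.[0] = \sum_m u m * evalab l (val m).
Proof.
rewrite /labsum /mlsum (raddf_sum (@snd _ _)) horner_sum; apply: eq_bigr => m _.
by rewrite /= hornerZ.
Qed.

Definition bracket_monom i w : monom 'I_n :=
  foldl (@MMul _) (MVar i)
    ([seq MMul (MVar p.1) (MVar p.2) | p <- w]
     ++ [seq MVar z | z <- enum 'I_n & z \notin i :: pairs_flat w]).

Lemma leaves_foldl (X : Type) (m : monom X) s :
  leaves (foldl (@MMul _) m s) = leaves m ++ flatten (map (@leaves X) s).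
Proof. by elim: s m => [|m' s IHs] m /=; rewrite ?cats0 // IHs /= catA. Qed.

Lemma bracket_monom_mlmon i w : uniq (i :: pairs_flat w) ->
  perm_eq (leaves (bracket_monom i w)) (enum 'I_n).
Proof.
move=> uw; rewrite /bracket_monom leaves_foldl map_cat flatten_cat /= -!map_comp.
have -> : flatten [seq (@leaves _ \o (fun p => MMul (MVar p.1) (MVar p.2))) p | p <- w] = pairs_flat w by [].
have -> : flatten [seq (@leaves _ \o MVar) z | z <- enum 'I_n & z \notin i :: pairs_flat w]
   = [seq z <- enum 'I_n | z \notin i :: pairs_flat w].
  by elim: [seq z <- _ | _] => //= z s ->.
rewrite -cat_cons; apply: uniq_perm; rewrite ?enum_uniq //.
  rewrite cat_uniq uw filter_uniq ?enum_uniq // andbT.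
  by apply/hasPn => z; rewrite mem_filter => /andP[].
by move=> z; rewrite mem_cat mem_filter mem_enum andbT orbN.
Qed.

Lemma meval_foldl (v : 'I_n -> Htilde K) m s :
  (meval v (foldl (@MMul _) m s)).2
  = foldl (fun f m' => heis_act f (meval v m').1) (meval v m).2 s.
Proof. by elim: s m => //= m' s IHs m; rewrite IHs. Qed.

Lemma heis_act_c (f : {poly K}) a : heis_act f (a *: delta_mx 0 2) = a *: f.
Proof. by rewrite /heis_act !mxE /= !mulr0 !scale0r !add0r mulr1. Qed.

Lemma heis_act0 (y : 'rV[K]_3) : heis_act 0 y = 0.
Proof. by rewrite /heis_act deriv0 mulr0 !scaler0 !addr0. Qed.

Lemma lval_coord (x : lab) :
  ((lval (1 : {poly K}) x).1 0 0 = (x == LA)%:R) * ((lval (1 : {poly K}) x).1 0 1 = (x == LB)%:R).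
Proof. by case: x => [[] []] /=; rewrite !mxE. Qed.

Lemma pairs_count w l x : x \in [:: LA; LB] ->
  \prod_(p <- w) bracket K (l p.1) (l p.2) != 0 ->
  (\sum_(z <- pairs_flat w) (l z == x))%N = size w.
Proof.
move=> xAB; elim: w => [|[p q] w IHw]; first by rewrite /pairs_flat /= !big_nil.
rewrite /pairs_flat /= !big_cons /= mulf_eq0 negb_or => /andP[b0 /IHw ->].
move: b0 xAB; rewrite /bracket !inE.
case: (l p) => [[] []]; case: (l q) => [[] []] /=; rewrite ?subrr ?eqxx // => _;
by case/orP => /eqP -> /=; rewrite ?add0n ?add1n.
Qed.

(** A nonzero product of brackets uses [size w] labels LA and as many LB inside the pairs. As l has
    no more of them, all other variables carry LC, which acts as the identity on T. *)
Lemma evalab_bracket i w l : uniq (i :: pairs_flat w) -> balanced 0 l ->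
  (cnt l LA <= size w)%N -> evalab l (bracket_monom i w) = bracket_fun K i w l.
Proof.
move=> uw /andP[/eqP l1 /eqP]; rewrite addn0 => lAB lw.
rewrite /evalab /bracket_monom meval_foldl foldl_cat /bracket_fun.
have [li|nli] := eqVneq (l i) LI; last first.
  rewrite mul0r [meval _ _]/= (_ : (lval 1 (l i)).2 = 0); last first.
    by case E: (l i) nli => [[] []].
  suff z s : foldl (fun f m' => heis_act f (meval (fun i => lval 1 (l i)) m' : Htilde K).1) 0 s = 0.
    by rewrite !z horner0.
  by elim: s => //= m s; rewrite heis_act0.
have pairsE f : foldl (fun f m' => heis_act f (meval (fun i => lval 1 (l i)) m' : Htilde K).1) f
   [seq MMul (MVar p.1) (MVar p.2) | p <- w] = (\prod_(p <- w) bracket K (l p.1) (l p.2)) *: f.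
  elim: w f {uw lw} => [|[p q] w IHw] f /=; first by rewrite big_nil scale1r.
  rewrite IHw big_cons /heis_mul /= heis_act_c !lval_coord scalerA mulrC; congr (_ * _ *: _).
  rewrite /bracket; by case: (l p) => [[] []]; case: (l q) => [[] []] /=; rewrite ?mulr0 ?mul0r ?mulr1 ?subrr.
rewrite [meval _ (MVar i)]/= li /= pairsE.
have [P0|P0] := eqVneq (\prod_(p <- w) bracket K (l p.1) (l p.2)) 0.
  rewrite P0 scale0r mulr0.
  suff z s : foldl (fun f m' => heis_act f (meval (fun i => lval 1 (l i)) m' : Htilde K).1) 0 s = 0.
    by rewrite z horner0.
  by elim: s => //= m s; rewrite heis_act0.
have restC z : z \notin i :: pairs_flat w -> l z = LC.
  move=> zn; move: (zn); rewrite inE negb_or => /andP[zi zw].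
  have nx x : x \in [:: LA; LB] -> (cnt l x <= size w)%N -> l z != x.
    move=> xAB cx; apply/negP => /eqP lz; move: cx; apply/negP; rewrite -ltnNge.
    rewrite -(pairs_count xAB P0) /cnt [X in (_ < X)%N](bigID (fun z => z \in pairs_flat w)) /=.
    have uw' : uniq (pairs_flat w) by case/andP: uw.
    rewrite [X in (X < _)%N]big_uniq //=.
    rewrite -[X in (X < _)%N]addn0 ltn_add2l (bigD1 z) //= lz eqxx //.
  have [i0 _ ui] := cnt1P l1.
  have := nx LA isT lw; have := nx LB isT (leq_trans (eq_leq (esym lAB)) lw).
  case E: (l z) => [[] []] // _ _.
  by move: zi; rewrite (ui _ E) (ui _ li) eqxx.
rewrite (_ : [forall z, _]) ?mul1r; last first.
  by apply/forallP => z; have [//|/restC ->] := boolP (z \in _).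
have : {in [seq z <- enum 'I_n | z \notin i :: pairs_flat w], forall z, l z = LC}.
  by move=> z; rewrite mem_filter => /andP[/restC].
elim: [seq z <- _ | _] => [|z s IHs] h /=; first by rewrite hornerZ hornerC mulr1.
by rewrite h ?inE ?eqxx //= -[delta_mx _ _]scale1r heis_act_c scale1r IHs // => y ys; apply: h; rewrite inE ys orbT.
Qed.

Lemma bracket_span_image i D k F : bracket_span i D k F ->
  exists u : mlmon n -> K, forall l, balanced 0 l -> (cnt l LA <= k)%N ->
    (labsum u l 1).2.[0] = F l.
Proof.
move=> [s [sP sE]].
suff [u uE] : exists u : mlmon n -> K, forall l, balanced 0 l -> (cnt l LA <= k)%N ->
    (labsum u l 1).2.[0] = \sum_(cw <- s) cw.1 * bracket_fun K i cw.2 l.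
  by exists u => l bl lk; rewrite uE // sE.
elim: s sP {sE} => [|[c w] s IHs] sP.
  by exists (fun=> 0) => l _ _; rewrite labsumE big_nil big1 // => m _; rewrite mul0r.
have [|u uE] := IHs; first by move=> cw cws; apply: sP; rewrite inE cws orbT.
have [/= sz uw _] := sP (c, w) (mem_head _ _).
pose m0 : mlmon n := exist (fun m => perm_eq (leaves m) (enum 'I_n)) _ (bracket_monom_mlmon uw).
exists (fun m => c * (m == m0)%:R + u m) => l bl lk.
rewrite labsumE (eq_bigr (fun m => c * (m == m0)%:R * evalab l (val m) + u m * evalab l (val m))); last first.
  by move=> m _; rewrite mulrDl.
rewrite big_split big_cons /= -(labsumE u) uE //; congr (_ + _).
rewrite (bigD1 m0) //= big1 ?addr0 => [|m /negPf ->]; last by rewrite mulr0 mul0r.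
by rewrite eqxx mulr1 evalab_bracket ?sz.
Qed.

(** A labeling with one label LI determines its support: the position of LI and the set of positions
    labeled LA or LB. *)
Lemma on_support_sum l a : cnt l LI = 1%N ->
  \sum_(p : 'I_n * {set 'I_n}) (if on_support p.1 p.2 l then a else 0) = a :> K.
Proof.
move=> /cnt1P[i li ui]; pose D := [set z | (l z == LA) || (l z == LB)].
have on : on_support i D l.
  rewrite /on_support inE li eqxx /=; apply/forallP => z; apply/implyP => zi.
  rewrite inE; case: ifP => // no; case E: (l z) no => [[] []] // _.
  by rewrite (ui _ E) eqxx in zi.
rewrite (bigD1 (i, D)) //= on big1 ?addr0 // => -[j E] /= ne.
case: ifP => // onE; case/eqP: ne.
have [iD _ AB C] := on_supportP onE.
have ji : j = i by apply: ui; case: (on_supportP onE).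
rewrite ji; congr (_, _); apply/setP => z; rewrite inE; apply/idP/idP => [/AB[]->|] //.
apply: contraLR => zE; have [->|zi] := eqVneq z i; first by rewrite li.
by rewrite C // ji.
Qed.

Lemma labsum_sumu (I : finType) (u : I -> mlmon n -> K) l :
  (labsum (fun m => \sum_p u p m) l 1).2.[0] = \sum_p (labsum (u p) l 1).2.[0].
Proof.
rewrite labsumE; under [RHS]eq_bigr => p _ do rewrite labsumE.
by rewrite exchange_big; apply: eq_bigr => m _; rewrite mulr_suml.
Qed.

Lemma eop_supp F l : eop F l != 0 -> exists2 j, l j = LA & F (lupd l j LB) != 0.
Proof.
move=> nz; have [j /andP[/eqP lj Fj]] : exists j, (l j == LA) && (F (lupd l j LB) != 0).
  apply/existsP; apply: contraR nz => /existsPn no; apply/eqP/big1 => j lj.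
  by have := no j; rewrite lj /= negbK => /eqP.
by exists j.
Qed.

(* Peel off F by increasing number k of labels LA: the labelings met by gop have fewer
   labels LA than those met by eop, so the part of F with the least k is killed by eop, hence is a
   combination of brackets, which are values of multilinear monomials. *)
Lemma image_full F :
  (forall l, F l != 0 -> balanced 0 l) ->
  (forall l, balanced 2 l -> eop F l = gop F l) ->
  exists u : mlmon n -> K, forall l, balanced 0 l -> (labsum u l 1).2.[0] = F l.
Proof.
suff main d k F' : (n < k + d)%N -> (forall l, F' l != 0 -> balanced 0 l) ->
  (forall l, balanced 2 l -> eop F' l = gop F' l) ->
  (forall l, F' l != 0 -> (k <= cnt l LA)%N) ->
  exists u : mlmon n -> K, forall l, balanced 0 l -> (labsum u l 1).2.[0] = F' l.
  by move=> Fs Fr; apply: (main n.+1 0%N).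
elim: d k F' => [|d IHd] k {}F nk Fs Fr Fk.
  exists (fun=> 0) => l bl; rewrite labsumE big1 => [|m _]; last by rewrite mul0r.
  apply/esym/eqP; apply: contraT => /Fk; have := cnt_le l LA; lia.
pose Fp (p : 'I_n * {set 'I_n}) l := if on_support p.1 p.2 l && (cnt l LA == k) then F l else 0.
have Fp_span p : bracket_span p.1 p.2 k (Fp p).
  apply: eop_zero_span => // l.
    rewrite /Fp; case: andP => [[on /eqP lk]|_]; last by rewrite eqxx.
    by move=> /Fs /andP[_ /eqP]; rewrite addn0 => <-.
  have e j : l j = LA -> (on_support p.1 p.2 (lupd l j LB) = on_support p.1 p.2 l) *
       ((cnt (lupd l j LB) LA == k) = (cnt l LA == k.+1)).
    move=> lj; split; first exact: (@on_support_lupd _ _ _ _ _ LA).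
    have := cnt_lupd l j LB LA; rewrite lj /= addn0 => <-; by rewrite addn1 eqSS.
  have [/andP[on /eqP lk]|no] := boolP (on_support p.1 p.2 l && (cnt l LA == k.+1)); last first.
    rewrite /eop big1 // => j /eqP lj; rewrite /Fp !e //; by case: ifP no.
  transitivity (eop F l).
    by apply: eq_bigr => j /eqP lj; rewrite /Fp !e // on lk eqxx.
  have [bl|nbl] := boolP (balanced 2 l); last first.
    apply/eqP; apply: contraNT nbl => /eop_supp[j lj /Fs/andP[/eqP bI /eqP bA]].
    have := cnt_lupd l j LB LA; have := cnt_lupd l j LB LB; have := cnt_lupd l j LB LI.
    rewrite lj /balanced /=; lia.
  rewrite Fr // /gop big1 ?mulr0 // => j /eqP lj; apply: big1 => i /eqP li.
  apply/eqP; apply: contraT => /Fk.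
  have := cnt_lupd l j LC LA; have := cnt_lupd (lupd l j LC) i LC LA.
  by rewrite lj li /=; lia.
have [u uE] := boolp.choice (fun p => bracket_span_image (Fp_span p)).
have u0E l : balanced 0 l -> (cnt l LA <= k)%N ->
    (labsum (fun m => \sum_p u p m) l 1).2.[0] = if cnt l LA == k then F l else 0.
  move=> bl lk; rewrite labsum_sumu.
  rewrite (eq_bigr (fun p => if on_support p.1 p.2 l then if cnt l LA == k then F l else 0 else 0)).
    by rewrite on_support_sum //; case/andP: bl => /eqP.
  by move=> p _; rewrite uE // /Fp; case: (on_support _ _ _); case: (_ == k).
pose u0 m := \sum_p u p m.
pose Ph l := (labsum u0 l 1).2.[0].
(* The remainder vanishes on labelings with at most k labels LA, and it satisfies the same relation
   because the subtracted values do, by [labsum_relation]. *)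
pose F1 l := if balanced 0 l then F l - Ph l else 0.
have [||||u1 u1E] := IHd k.+1 F1.
- by rewrite addSnnS.
- by move=> l; rewrite /F1; case: ifP; rewrite ?eqxx.
- move=> l bl; have bal j : l j = LA -> balanced 0 (lupd l j LB).
    move=> lj; case/andP: bl => /eqP lI /eqP lA.
    have := cnt_lupd l j LB LA; have := cnt_lupd l j LB LB; have := cnt_lupd l j LB LI.
    rewrite lj /balanced /=; lia.
  have bal2 j i : l j = LA -> lupd l j LC i = LA -> balanced 0 (lupd (lupd l j LC) i LC).
    move=> lj li; case/andP: bl => /eqP lI /eqP lA.
    have := cnt_lupd l j LC LA; have := cnt_lupd l j LC LB; have := cnt_lupd l j LC LI.
    have := cnt_lupd (lupd l j LC) i LC LA; have := cnt_lupd (lupd l j LC) i LC LB.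
    have := cnt_lupd (lupd l j LC) i LC LI.
    rewrite lj li /balanced /=; lia.
  have -> : eop F1 l = eop F l - eop Ph l.
    by rewrite /eop -sumrB; apply: eq_bigr => j /eqP lj; rewrite /F1 bal.
  have -> : gop F1 l = gop F l - gop Ph l.
    rewrite /gop -mulrBr -sumrB; congr (_ * _); apply: eq_bigr => j /eqP lj.
    by rewrite -sumrB; apply: eq_bigr => i /eqP li; rewrite /F1 bal2.
  by rewrite Fr // labsum_relation //; case/andP: bl => /eqP.
- move=> l; rewrite /F1; case: ifP => [bl|_]; last by rewrite eqxx.
  rewrite ltnNge; apply: contraNN => lk; rewrite /Ph u0E //.
  have [e|ne] := eqVneq (cnt l LA) k; first by rewrite subrr.
  by rewrite subr0; apply: contraNT ne => /Fk kl; rewrite eqn_leq lk kl.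
exists (fun m => u0 m + u1 m) => l bl.
rewrite labsumE (eq_bigr (fun m => u0 m * evalab l (val m) + u1 m * evalab l (val m))); last first.
  by move=> m _; rewrite mulrDl.
by rewrite big_split /= -(labsumE u0) -(labsumE u1) u1E // /F1 bl addrC subrK.
Qed.
End Image.

(* A, P and Q act on the terms of the exact sequence 0 -> r -> x -> y -> 0. *)
Lemma mxtrace_exact (K : fieldType) (r x y : nat) (A : 'M[K]_r) (P : 'M[K]_x) (Q : 'M[K]_y)
    (S : 'M[K]_(r, x)) (E : 'M[K]_(x, y)) :
  row_free S -> row_full E -> S *m E = 0 ->
  (forall v : 'rV_x, v *m E = 0 -> (v <= S)%MS) ->
  A *m S = S *m P -> P *m E = E *m Q -> \tr A = \tr P - \tr Q.
Proof.
move=> Sf /row_fullP[B BE] SE kerE AS PE.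
(* [B] splits [E], so [1%:M - E *m B] projects onto the kernel of [E], which lies in the row space
   of [S]; the factor [L] turns out to split [S]. *)
have [L LE] : exists L, 1%:M - E *m B = L *m S.
  apply/submxP/row_subP => i; apply: kerE.
  by rewrite -row_mul mulmxBl mul1mx -mulmxA BE mulmx1 subrr row0.
have SL : S *m L = 1%:M.
  apply: (row_free_inj Sf); rewrite mul1mx -mulmxA -LE mulmxBr mulmx1 mulmxA SE.
  by rewrite mul0mx subr0.
rewrite -[A]mulmx1 -SL mulmxA AS -mulmxA mxtrace_mulC -mulmxA -LE.
rewrite mulmxBr mulmx1 linearB /=; congr (_ - _).
by rewrite mulmxA PE mxtrace_mulC mulmxA BE mul1mx.
Qed.

(** * The cocharacter from an exact sequence of permutation modules *)

Section Cocharacter.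
Variables (K : fieldType) (n : nat).
Hypothesis char0 : [pchar K] =i pred0.
Local Notation Lb := ({ffun 'I_n -> lab}).
Implicit Types (l : Lb) (F G : Lb -> K).

Definition lact (s : 'S_n) l : Lb := [ffun i => l (s i)].
Definition labels d : {set Lb} := [set l | balanced d l].

Lemma cnt_lact s l x : cnt (lact s l) x = cnt l x.
Proof.
rewrite /cnt [RHS](reindex_inj (@perm_inj _ s)); apply: eq_bigr => i _.
by rewrite ffunE.
Qed.

Lemma lact_labels s l d : (lact s l \in labels d) = (l \in labels d).
Proof. by rewrite !inE /balanced !cnt_lact. Qed.

Lemma lact_lupd s l j x : lact s (lupd l (s j) x) = lupd (lact s l) j x.
Proof. by apply/ffunP => i; rewrite !ffunE (inj_eq perm_inj). Qed.

Lemma eop_lact s F l : eop (F \o lact s) l = eop F (lact s l).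
Proof.
rewrite /eop (reindex_inj (@perm_inj _ s)) /=.
by apply: eq_big => [j|j _]; rewrite ?ffunE // lact_lupd.
Qed.

Lemma gop_lact s F l : gop (F \o lact s) l = gop F (lact s l).
Proof.
rewrite /gop (reindex_inj (@perm_inj _ s)) /=; congr (_ * _).
apply: eq_big => [j|j _]; first by rewrite ffunE.
rewrite (reindex_inj (@perm_inj _ s)) /=.
by apply: eq_big => [i|i _]; rewrite -?lact_lupd ?ffunE // !lact_lupd.
Qed.

Definition rop F l := eop F l - gop F l.

Lemma eop_linear c F G l : eop (fun k => c * F k + G k) l = c * eop F l + eop G l.
Proof. by rewrite /eop mulr_sumr -big_split. Qed.

Lemma gop_linear c F G l : gop (fun k => c * F k + G k) l = c * gop F l + gop G l.
Proof.
rewrite /gop mulrCA -mulrDr; congr (_ * _); rewrite mulr_sumr -big_split; apply: eq_bigr => j _ /=.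
by rewrite mulr_sumr -big_split.
Qed.

Lemma eq_rop F G l : F =1 G -> rop F l = rop G l.
Proof. by move=> /funext ->. Qed.

Lemma rop_sum I (r : seq I) (c : I -> K) (F : I -> Lb -> K) l :
  rop (fun k => \sum_(i <- r) c i * F i k) l = \sum_(i <- r) c i * rop (F i) l.
Proof.
elim: r => [|i r IHr].
  rewrite big_nil /rop /eop /gop big1 => [|j _]; last by rewrite big_nil.
  rewrite big1 ?mulr0 ?subr0 // => j _; apply: big1 => i _; exact: big_nil.
rewrite big_cons -IHr (@eq_rop _ (fun k => c i * F i k + \sum_(i <- r) c i * F i k)).
  by rewrite /rop eop_linear gop_linear mulrBr opprD addrACA.
by move=> k; rewrite big_cons.
Qed.

Definition ldelta d (a : 'I_#|labels d|) l : K := (l == enum_val a)%:R.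

Definition rel_mx : 'M[K]_(#|labels 0|, #|labels 2|) :=
  \matrix_(a, b) rop (ldelta a) (enum_val b).

Definition eval_mx : 'M[K]_(#|{: mlmon n}|, #|labels 0|) :=
  \matrix_(i, a) evalab K (enum_val a) (val (enum_val i)).

Definition perm_lab_mx d (s : 'S_n) : 'M[K]_#|labels d| :=
  \matrix_(a, b) (enum_val a == lact s (enum_val b))%:R.

Definition lext d (v : 'rV[K]_#|labels d|) l := \sum_a v 0 a * ldelta a l.

Lemma lextE d (v : 'rV[K]_#|labels d|) b : lext v (enum_val b) = v 0 b.
Proof.
rewrite /lext (bigD1 b) //= /ldelta eqxx mulr1 big1 ?addr0 // => a ab.
by rewrite (inj_eq enum_val_inj) eq_sym (negPf ab) mulr0.
Qed.

Lemma lext_supp d (v : 'rV[K]_#|labels d|) l : lext v l != 0 -> balanced d l.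
Proof.
apply: contraNT => nl; rewrite /lext big1 // => a _; rewrite /ldelta.
case: eqP => [e|_]; last by rewrite mulr0.
by have := enum_valP a; rewrite -e inE (negPf nl).
Qed.

Lemma mul_rel_mx (v : 'rV_#|labels 0|) b : (v *m rel_mx) 0 b = rop (lext v) (enum_val b).
Proof. by rewrite mxE /lext rop_sum; apply: eq_bigr => a _; rewrite mxE. Qed.

Lemma mul_eval_mx (u : 'rV_#|{: mlmon n}|) a :
  (u *m eval_mx) 0 a = (labsum (fun m => u 0 (enum_rank m)) (enum_val a) 1).2.[0].
Proof.
rewrite mxE labsumE (reindex enum_rank) /=; last first.
  by exists enum_val => i _; [apply: enum_rankK|apply: enum_valK].
by apply: eq_bigr => m _; rewrite mxE enum_rankK.
Qed.

Lemma eval_rel_mx : eval_mx *m rel_mx = 0.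
Proof.
apply/row_matrixP => i; rewrite row_mul row0; apply/rowP => b; rewrite mul_rel_mx mxE.
pose u : 'rV[K]_#|{: mlmon n}| := delta_mx 0 i.
have /andP[/eqP l1 /eqP lA] : balanced 2 (enum_val b) by have := enum_valP b; rewrite inE.
pose P l := (labsum (fun m => u 0 (enum_rank m)) l 1).2.[0].
have e l : balanced 0 l -> lext (row i eval_mx) l = P l.
  move=> bl; have lin : l \in labels 0 by rewrite inE.
  rewrite -(enum_rankK_in lin lin) lextE rowE mul_eval_mx //.
have := labsum_relation char0 (fun m => u 0 (enum_rank m)) l1 => rel.
apply/eqP; rewrite subr_eq0; apply/eqP; apply: etrans (etrans rel _).
  apply: eq_bigr => j /eqP lj; apply: e.
  have := cnt_lupd (enum_val b) j LB LA; have := cnt_lupd (enum_val b) j LB LB.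
  have := cnt_lupd (enum_val b) j LB LI; rewrite lj /balanced /=; lia.
congr (_ * _); apply: eq_bigr => j /eqP lj; apply: eq_bigr => k /eqP lk; apply/esym/e.
have := cnt_lupd (enum_val b) j LC LA; have := cnt_lupd (enum_val b) j LC LB.
have := cnt_lupd (enum_val b) j LC LI.
have := cnt_lupd (lupd (enum_val b) j LC) k LC LA.
have := cnt_lupd (lupd (enum_val b) j LC) k LC LB.
have := cnt_lupd (lupd (enum_val b) j LC) k LC LI.
rewrite lj lk /balanced /=; lia.
Qed.

(* The part of a vector of the kernel of the transpose on its labelings with the
   most labels LA has weight 2 and is killed by fop. *)
Lemma rel_mx_full : row_full rel_mx.
Proof.
rewrite /row_full -mxrank_tr; apply: inj_row_free => g gE.
have gE' (a : 'I_#|labels 0|) : \sum_l lext g l * rop (ldelta a) l = 0.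
  transitivity ((g *m rel_mx^T) 0 a); last by rewrite gE mxE.
  rewrite mxE.
  rewrite (bigID (mem (labels 2))) /= [X in _ + X]big1 ?addr0; last first.
    move=> l nl; have [->|/lext_supp bl] := eqVneq (lext g l) 0; first by rewrite mul0r.
    by rewrite inE bl in nl.
  by rewrite big_enum_val; apply: eq_bigr => b _; rewrite lextE !mxE.
(* Downward induction on the number of labels LA, which is at most n. *)
suff main d k : (n < k + d)%N -> forall l, (k <= cnt l LA)%N -> lext g l = 0.
  by apply/rowP => b; rewrite -lextE mxE; apply: (main n.+1 0%N).
elim: d k => [|d IHd] k nk l lk.
  by move: (cnt_le l LA); lia.
have IH l' : (k < cnt l' LA)%N -> lext g l' = 0 by apply: IHd; rewrite addSnnS.
have [lk'|ne] := eqVneq (cnt l LA) k; last by apply: IH; lia.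
pose G l := if cnt l LA == k then lext g l else 0.
suff G0 : G l = 0 by move: G0; rewrite /G lk' eqxx.
apply: (@lowest_weight_eq0 K n char0 G 1).
  move=> l'; rewrite /G; case: ifP => _; last by rewrite eqxx.
  by move=> /lext_supp/andP[_ /eqP].
move=> l'; have [kA|nA] := eqVneq (cnt l' LA).+1 k; last first.
  rewrite /fop big1 // => j /eqP lj; rewrite /G.
  case: eqP => // e; have := cnt_lupd l' j LA LA; rewrite lj /=; lia.
have fG : fop G l' = fop (lext g) l'.
  apply: eq_bigr => j /eqP lj; rewrite /G.
  case: eqP => // e; have := cnt_lupd l' j LA LA; rewrite lj /=; lia.
rewrite fG; have [bl|nbl] := boolP (balanced 0 l'); last first.
  rewrite /fop big1 // => j /eqP lj; apply/eqP; apply: contraNT nbl => /lext_supp/andP[/eqP lI /eqP lA].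
  have := cnt_lupd l' j LA LA; have := cnt_lupd l' j LA LB; have := cnt_lupd l' j LA LI.
  rewrite lj /balanced /=; lia.
have lin : l' \in labels 0 by rewrite inE.
(* The kernel equation is tested on the delta function at [l'], which has k - 1 labels LA. Its [gop]
   part occurs only at labelings with k + 1 labels LA, where g vanishes by induction. *)
have := gE' (enum_rank_in lin l'); rewrite /rop.
under eq_bigr => m _ do rewrite mulrBr.
rewrite sumrB eop_adj [X in _ - X]big1 ?subr0; last first.
  move=> m _; have [mk|mk] := leqP (cnt m LA) k; last by rewrite IH // mul0r.
  rewrite /gop big1 ?mulr0 // => j /eqP mj; apply: big1 => i /eqP mi.
  rewrite /ldelta enum_rankK_in //; case: eqP => // e.
  have := cnt_lupd m j LC LA; have := cnt_lupd (lupd m j LC) i LC LA.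
  rewrite e mj mi /=; lia.
rewrite (bigD1 l') //= big1 ?addr0 => [|m ml].
  by rewrite /ldelta enum_rankK_in // eqxx mulr1.
by rewrite /ldelta enum_rankK_in // (negPf ml) mulr0.
Qed.

Lemma ker_rel_mx (w : 'rV_#|labels 0|) : w *m rel_mx = 0 ->
  exists u : 'rV_#|{: mlmon n}|, w = u *m eval_mx.
Proof.
move=> wE; have [||u uE] := @image_full K n char0 (lext w); first exact: lext_supp.
  move=> l bl; have lin : l \in labels 2 by rewrite inE.
  apply/eqP; rewrite -subr_eq0; apply/eqP.
  have := congr1 (fun M => fun_of_matrix M 0 (enum_rank_in lin l)) wE.
  by rewrite mul_rel_mx mxE enum_rankK_in.
exists (\row_i u (enum_val i)); apply/rowP => a; rewrite mul_eval_mx.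
rewrite -lextE -uE; last by have := enum_valP a; rewrite inE.
rewrite !labsumE; apply: eq_bigr => m _; by rewrite mxE enum_rankK.
Qed.

Lemma eval_mx_act s : mlmx K s *m eval_mx = eval_mx *m perm_lab_mx 0 s.
Proof.
apply/matrixP => i a.
have lin : lact s (enum_val a) \in labels 0 by rewrite lact_labels enum_valP.
transitivity (evalab K (lact s (enum_val a)) (val (enum_val i))).
  rewrite mxE (bigD1 (enum_rank (mlact s (enum_val i)))) //= big1 ?addr0.
    rewrite !mxE !eqxx mul1r enum_rankK /evalab /=; congr (_.2.[0]).
    elim: (sval (enum_val i)) => /= [j|p -> q -> //]; by rewrite ffunE.
  by move=> j /negPf nj; rewrite !mxE eqxx /= nj mul0r.
rewrite mxE (bigD1 (enum_rank_in lin (lact s (enum_val a)))) //= big1 ?addr0.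
  by rewrite !mxE enum_rankK_in // eqxx mulr1.
move=> b nb; rewrite !mxE; case: eqP => [e|_]; last by rewrite mulr0.
by case/eqP: nb; apply: enum_val_inj; rewrite enum_rankK_in.
Qed.

Lemma rel_mx_act s : perm_lab_mx 0 s *m rel_mx = rel_mx *m perm_lab_mx 2 s.
Proof.
apply/matrixP => a b.
have lin : lact s (enum_val b) \in labels 2 by rewrite lact_labels enum_valP.
transitivity (rop (ldelta a) (lact s (enum_val b))).
  rewrite /rop -eop_lact -gop_lact -/(rop _ _).
  rewrite mxE -[RHS]/(rop (fun l => ldelta a (lact s l)) (enum_val b)).
  under eq_bigr => c _ do rewrite [rel_mx c b]mxE.
  rewrite -(rop_sum _ (perm_lab_mx 0 s a)); apply: eq_rop => k.
  have [lin'|nk] := boolP (k \in labels 0).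
    rewrite (bigD1 (enum_rank_in lin' k)) //= big1 ?addr0.
      by rewrite mxE /ldelta enum_rankK_in // eqxx mulr1 eq_sym.
    move=> c nc; rewrite /ldelta; case: eqP => [e|_]; last by rewrite mulr0.
    by case/eqP: nc; apply: enum_val_inj; rewrite enum_rankK_in.
  rewrite big1 => [|c _].
    rewrite /ldelta; case: eqP => // e; case/negP: nk.
    by rewrite -(lact_labels s) e enum_valP.
  rewrite /ldelta; case: eqP => [e|_]; last by rewrite mulr0.
  by rewrite e enum_valP in nk.
rewrite mxE (bigD1 (enum_rank_in lin (lact s (enum_val b)))) //= big1 ?addr0.
  by rewrite !mxE enum_rankK_in // eqxx mulr1.
move=> c nc; rewrite !mxE; case: eqP => [e|_]; last by rewrite mulr0.
by case/eqP: nc; apply: enum_val_inj; rewrite enum_rankK_in.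
Qed.

Lemma tr_perm_lab_mx d s : \tr (perm_lab_mx d s) = #|[set l in labels d | lact s l == l]|%:R.
Proof.
rewrite /mxtrace; under eq_bigr => a _ do rewrite mxE.
rewrite -natr_sum; congr (_%:R).
rewrite -(big_enum_val (fun l => (l == lact s l) : nat)) -sum1_card.
rewrite big_mkcond [RHS]big_mkcond; apply: eq_bigr => l _; rewrite !inE eq_sym.
by case: (balanced d l).
Qed.

Hypothesis n3 : (2 < n)%N.

Lemma eval_mx_ker (u : 'rV_#|{: mlmon n}|) :
  u *m eval_mx = 0 <-> (u <= mlid (variety_of (Htilde K)) n)%MS.
Proof.
split=> [uE | /mlidP uI].
  apply/mlidP => B; apply => v; rewrite npeval_mlpoly.
  apply: (mlsum_eq0 char0 (u := fun m => u 0 (enum_rank m))) => // l bl.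
  have lin : l \in labels 0 by rewrite inE.
  by rewrite -(enum_rankK_in lin lin) -mul_eval_mx uE mxE.
apply/rowP => a; rewrite mul_eval_mx mxE.
pose v k : Htilde K := if insub k is Some j then lval 1 (enum_val a j) else 0.
have := uI (Htilde K) (fun f h => h) v; rewrite npeval_mlpoly.
have ve : v \o val =1 (fun j => lval 1 (enum_val a j)).
  by move=> j; rewrite /v /= valK.
move=> h; transitivity ((0 : Htilde K).2.[0]); last by rewrite horner0.
rewrite -[in RHS]h; congr (_.2.[0]).
by apply: eq_bigr => m _; rewrite (eq_meval _ ve).
Qed.

Lemma cocharacterE s : cocharacter (variety_of (Htilde K)) s =
  #|[set l in labels 0 | lact s l == l]|%:R - #|[set l in labels 2 | lact s l == l]|%:R
   :> K.
Proof.
rewrite -!tr_perm_lab_mx /cocharacter /Pn_repr.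
set U := mlid _ _; set Umod := mlid_module _ _.
(* [J] lifts the quotient to multilinear elements and [I] projects onto it; [eval_mx] factors
   through the quotient because it kills [U]. *)
pose J := val_factmod (U := U) 1%:M; pose I := in_factmod U 1%:M.
have JI : J *m I = 1%:M by rewrite -in_factmodE val_factmodK.
have UE : U *m eval_mx = 0.
  by apply/row_matrixP => i; rewrite row_mul row0; apply/eval_mx_ker/row_sub.
have IJ : I *m (J *m eval_mx) = eval_mx.
  rewrite mulmxA -val_factmodE -[in RHS](mul1mx eval_mx) -[in RHS](add_sub_fact_mod U 1%:M).
  rewrite mulmxDl [X in X + _](_ : _ = 0) ?add0r //.
  by have /submxP[D ->] := val_submodP (in_submod U 1%:M); rewrite -mulmxA UE mulmx0.
apply: (@mxtrace_exact _ _ _ _ _ _ _ (J *m eval_mx) rel_mx).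
- apply: inj_row_free => v; rewrite mulmxA => /eval_mx_ker.
  by rewrite -val_factmodE -in_factmod_eq0 val_factmodK => /eqP.
- exact: rel_mx_full.
- by rewrite -mulmxA eval_rel_mx mulmx0.
- by move=> v /ker_rel_mx[u ->]; rewrite -[X in (u *m X <= _)%MS]IJ mulmxA submxMl.
- rewrite -[factmod_repr Umod s]/(in_factmod U (J *m mlmx K s)) in_factmodE.
  by rewrite -mulmxA IJ -!mulmxA eval_mx_act.
- exact: rel_mx_act.
Qed.
End Cocharacter.

(** * Counting labelings fixed by squares *)

Section SquareFix.
Variables (n : nat) (P : finType).
Implicit Types (z : {ffun 'I_n -> P}) (g h : 'S_n).

Definition content z : {ffun P -> 'I_n.+1} := [ffun p => inord #|[set i | z i == p]|].

Lemma contentE z p : content z p = #|[set i | z i == p]| :> nat.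
Proof. by rewrite ffunE inordK // ltnS -[X in (_ <= X)%N](card_ord n) max_card. Qed.

Definition precomp z g : {ffun 'I_n -> P} := [ffun i => z (g i)].

Lemma content_precomp z g : content (precomp z g) = content z.
Proof.
apply/ffunP => p; apply: val_inj; rewrite /= !contentE -(card_imset _ (@perm_inj _ g)).
apply: eq_card => i; rewrite inE; apply/imsetP/eqP => [[j]|zi].
  by rewrite inE ffunE => /eqP <- ->.
by exists (g^-1%g i); rewrite ?inE ?ffunE permKV ?zi.
Qed.

Lemma eq_content_precomp z z' : content z = content z' -> exists g, precomp z g = z'.
Proof.
move=> e; have /tuple_permP[g gE] : perm_eq [tuple z' i | i < n] [tuple z i | i < n].
  have cE (y : {ffun 'I_n -> P}) p : count_mem p [tuple y i | i < n] = #|[set i | y i == p]|.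
    rewrite /= count_map -sum1_count -sum1_card big_enum_cond /=.
    by apply: eq_bigl => i; rewrite inE.
  rewrite /perm_eq; apply/allP => p _ /=; rewrite !cE -!contentE e //.
exists g; apply/ffunP => i; rewrite ffunE.
have := congr1 (fun t : seq P => nth (z i) t i) gE.
by rewrite -!tnth_nth !tnth_mktuple => ->.
Qed.

(** This number is 0 or the order of the stabilizer of z, according to whether z' lies in the orbit
    of z. *)
Definition fibre z z' := (\sum_(g : 'S_n) (precomp z g == z'))%N.

Lemma precomp_eq z g h : (precomp z h == precomp z g) = (precomp z (g^-1 * h)%g == z).
Proof.
apply/eqP/eqP => e; apply/ffunP => i; rewrite ffunE.
  have := congr1 (fun y : {ffun 'I_n -> P} => y (g^-1%g i)) e.
  by rewrite !ffunE permM permKV.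
have := congr1 (fun y : {ffun 'I_n -> P} => y (g i)) e.
by rewrite !ffunE permM permK.
Qed.

Lemma fibre_orbit z z' : content z = content z' -> fibre z z' = fibre z z.
Proof.
move=> /eq_content_precomp[g <-]; rewrite /fibre (reindex_inj (mulgI g)).
by apply: eq_bigr => h _; rewrite precomp_eq mulKg.
Qed.

Lemma fibre_diag z z' : content z = content z' -> fibre z' z' = fibre z z.
Proof.
move=> /eq_content_precomp[g <-]; rewrite /fibre [RHS](reindex_inj (mulIg g)) [RHS](reindex_inj (mulgI g^-1%g)).
apply: eq_bigr => h _; rewrite /= -mulgA -precomp_eq.
by congr (nat_of_bool (_ == _)); apply/ffunP => i; rewrite !ffunE permM.
Qed.

Lemma sum_fibre z : (\sum_(z' | content z' == content z) fibre z z' = #|{: 'S_n}|)%N.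
Proof.
rewrite /fibre exchange_big -sum1_card; apply: eq_bigr => g _ /=.
rewrite (bigD1 (precomp z g)) ?content_precomp //= eqxx big1 // => z' /andP[_ /negPf].
by rewrite eq_sym => ->.
Qed.

Variable tau : P -> P.
Hypothesis tauK : involutive tau.
Definition ptau z : {ffun 'I_n -> P} := [ffun i => tau (z i)].

Lemma content_ptau z p : content (ptau z) p = content z (tau p).
Proof.
apply: val_inj; rewrite /= !contentE; apply: eq_card => i.
by rewrite !inE ffunE (can2_eq tauK tauK).
Qed.

Definition sym_contents : {set {ffun P -> 'I_n.+1}} :=
  [set M : {ffun P -> 'I_n.+1} | (\sum_p M p == n)%N & [forall p, M (tau p) == M p]].

Lemma sum_content z : (\sum_p content z p = n)%N.
Proof.
under eq_bigr => p _ do rewrite contentE -sum1_card.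
rewrite -[RHS](card_ord n) -sum1_card [RHS](partition_big z predT) //=.
by apply: eq_bigr => p _; apply: eq_bigl => i; rewrite inE.
Qed.

Lemma content_surj (M : {ffun P -> 'I_n.+1}) : (\sum_p M p = n)%N -> exists z, content z = M.
Proof.
move=> Mn; pose s := flatten [seq nseq (M p) p | p <- enum P].
have sn : size s == n.
  rewrite size_flatten /shape -map_comp sumnE big_map -[X in _ == X]Mn -big_enum; apply/eqP.
  by apply: eq_bigr => p _ /=; rewrite size_nseq.
exists [ffun i => tnth (Tuple sn) i]; apply/ffunP => p; apply: val_inj.
rewrite /= contentE.
transitivity (count_mem p s).
  have E : s = map (tnth (Tuple sn)) (enum 'I_n) by rewrite map_tnth_enum.
  rewrite [X in count_mem p X]E count_map -sum1_count -sum1_card big_enum_cond /=.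
  by apply: eq_bigl => i; rewrite inE ffunE.
rewrite /s count_flatten sumnE !big_map -enumT big_enum /= (bigD1 p) //= count_nseq /= eqxx mul1n.
rewrite big1 ?addn0 // => q qp; by rewrite count_nseq /= (negPf qp).
Qed.

(* The g with [precomp z g = ptau z] exist only when the content of z is
   tau-invariant, and then they form a coset of the stabilizer of z. *)
Lemma sum_fibre_tau (C : pred {ffun P -> 'I_n.+1}) :
  (\sum_(z | C (content z)) fibre z (ptau z)
   = #|{: 'S_n}| * #|[set M in sym_contents | C M]|)%N.
Proof.
rewrite (partition_big content C) //= mulnC -sum_nat_const [RHS]big_mkcond [LHS]big_mkcond.
apply: eq_bigr => M _; rewrite !inE; case: (boolP (C M)) => [CM|_]; last by rewrite andbF.
rewrite andbT; case: ifP => [/andP[/eqP /content_surj[z0 z0M] /forallP Msym]|nsym].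
  rewrite -(sum_fibre z0); apply: eq_big => z; first by rewrite z0M; case: eqP => [->|_]; rewrite ?CM ?andbF.
  move=> /andP[_ /eqP zM]; have e : content z = content z0 by rewrite zM.
  rewrite (fibre_orbit (z' := ptau z)) ?(fibre_diag (esym e)) ?(fibre_orbit (esym e)) //.
  by apply/ffunP => p; rewrite content_ptau zM (eqP (Msym p)).
rewrite big1 // => z /andP[_ /eqP zM]; rewrite /fibre big1 // => g _.
case: eqP => // e; move: nsym; rewrite -zM sum_content eqxx /=.
by move/negP; case; apply/forallP => p; rewrite -content_ptau -e content_precomp.
Qed.
End SquareFix.

Section LabelSquares.
Variable n : nat.
Local Notation Lb := ({ffun 'I_n -> lab}).

Definition pswap (p : lab * lab) := (p.2, p.1).

Lemma pswapK : involutive pswap. Proof. by case. Qed.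

Definition row_total (M : {ffun lab * lab -> 'I_n.+1}) x := (\sum_y M (x, y))%N.

Definition balanced_content d (M : {ffun lab * lab -> 'I_n.+1}) :=
  (row_total M LI == 1%N) && (row_total M LA == row_total M LB + d)%N.

Lemma row_total_content (z : {ffun 'I_n -> lab * lab}) x :
  row_total (content z) x = cnt [ffun i => (z i).1] x.
Proof.
rewrite /row_total /cnt; under eq_bigr => y _ do rewrite contentE -sum1_card big_mkcond.
rewrite exchange_big; apply: eq_bigr => i _ /=; rewrite ffunE.
under eq_bigr => y _ do rewrite inE; case: (z i) => [a b] /=.
rewrite (bigD1 b) //= big1 ?addn0 => [|y yb]; first by rewrite xpair_eqE eqxx andbT; case: eqP.
by rewrite xpair_eqE [b == y]eq_sym (negPf yb) andbF.
Qed.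

(* A labeling l fixed by h^2 is the same as a map z = (l, l o h) into pairs of
   labels such that z o h is z with its components swapped. *)
Lemma sum_square_fix d :
  (\sum_(h : 'S_n) #|[set l in labels n d | lact (h * h)%g l == l]|
   = #|{: 'S_n}| * #|[set M in sym_contents n pswap | balanced_content d M]|)%N.
Proof.
rewrite -sum_fibre_tau; last exact: pswapK.
rewrite /fibre exchange_big /=; apply: eq_bigr => h _.
have balE (z : {ffun 'I_n -> lab * lab}) :
    balanced_content d (content z) = balanced d [ffun i => (z i).1].
  by rewrite /balanced_content !row_total_content.
transitivity #|[set z | balanced_content d (content z) && (precomp z h == ptau pswap z)]|; last first.
  by rewrite -sum1dep_card big_mkcondr; apply: eq_bigr => z _; case: eqP.
pose f (l : Lb) : {ffun 'I_n -> lab * lab} := [ffun i => (l i, l (h i))].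
have finj : injective f.
  by move=> l l' /ffunP e; apply/ffunP => i; have := e i; rewrite !ffunE; case.
have fst_f l : [ffun i => (f l i).1] = l by apply/ffunP => i; rewrite !ffunE.
rewrite -(card_imset _ finj); apply: eq_card => z; rewrite [RHS]inE balE.
apply/imsetP/andP => [[l]|[zb /eqP /ffunP zh]].
  rewrite !inE => /andP[bl /eqP /ffunP lh] ->; rewrite fst_f; split=> //.
  apply/eqP/ffunP => i; rewrite !ffunE /pswap /=; congr (_, _).
  by have := lh i; rewrite ffunE permM.
have zE i : z (h i) = pswap (z i) by have := zh i; rewrite !ffunE.
exists [ffun i => (z i).1]; last first.
  by apply/ffunP => i; rewrite !ffunE zE; case: (z i).
rewrite !inE zb /=; apply/eqP/ffunP => i.
by rewrite !ffunE permM !zE; case: (z i).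
Qed.
End LabelSquares.

(** * Counting symmetric matrices with balanced row sums *)

Section ContentCounts.
Local Open Scope nat_scope.

Lemma sum_interval N lo hi : \sum_(a < N) ((lo <= a < hi) : nat) = minn hi N - lo.
Proof.
elim: N => [|N IHN]; first by rewrite big_ord0; lia.
by rewrite big_ord_recr /= IHN; lia.
Qed.

Lemma sum_pred1 N c (b : nat -> bool) : \sum_(a < N) ((a == c :> nat) && b a : nat) = (c < N) && b c.
Proof.
elim: N => [|N IHN]; first by rewrite big_ord0.
rewrite big_ord_recr /= IHN; case: (eqVneq N c) => [->|ne] /=.
  by rewrite ltnn ltnSn.
by rewrite addn0 ltnS [c <= N]leq_eqVlt eq_sym (negPf ne).
Qed.

(* e1 and e2 are the two signs of a shift, so that the equation needs no
   subtraction; the bound N on the indices is larger than i and j. *)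
Definition box_count N i j e1 e2 :=
  \sum_(a < N) \sum_(c < N) ([&& a <= i, c <= j & a.*2 + c.*2 + e1 == i + j + e2] : nat).

(** The equation determines c as s - a, where a runs from s - j to the smaller of i and s. *)
Lemma box_countE N i j e1 e2 s : i < N -> j < N -> i + j + e2 = s.*2 + e1 ->
  box_count N i j e1 e2 = (minn i s).+1 - (s - j).
Proof.
move=> iN jN es; rewrite /box_count.
transitivity (\sum_(a < N) ((s - j <= a < (minn i s).+1) : nat)); last first.
  by rewrite sum_interval; lia.
apply: eq_bigr => a _.
transitivity (\sum_(c < N) ((c == s - a :> nat) && [&& a <= i, a <= s & c <= j] : nat)).
  by apply: eq_bigr => c _; congr nat_of_bool; lia.
by rewrite (sum_pred1 N (s - a) (fun c => [&& a <= i, a <= s & c <= j])); lia.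
Qed.

Lemma box_count0 N i j e1 e2 : odd (i + j + e2 + e1) -> box_count N i j e1 e2 = 0.
Proof.
move=> o; rewrite /box_count big1 // => a _; apply: big1 => c _.
by case: and3P => // -[_ _ /eqP e]; lia.
Qed.

(** The number of points with a + c = s in the rectangle [0,i] x [0,j] is symmetric about s =
    (i+j)/2 and constant up to distance |i-j|/2 from there, then drops by one per step until it is
    0. For i + j even, the step from the centre to its successor drops exactly when i = j. *)
Lemma box_count_even N i j : i < N -> j < N ->
  box_count N i j 0 0 = box_count N i j 0 2 + (i == j).
Proof.
move=> iN jN; have [od|ev] := boolP (odd (i + j)).
  by rewrite !box_count0; lia.
rewrite (@box_countE _ _ _ _ _ ((i + j)./2)) // ?(@box_countE _ _ _ _ _ ((i + j)./2.+1)) //; lia.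
Qed.

(** Here the two antidiagonals lie at distances 1/2 and 3/2 from the centre, so their lengths differ
    only for |i-j| = 1, and then by one. *)
Lemma box_count_odd N i j : i < N -> j < N ->
  box_count N i j 1 0 = box_count N i j 0 3 + ((i == j.+1) || (j == i.+1)).
Proof.
move=> iN jN; have [ev|od] := boolP (odd (i + j)); last by rewrite !box_count0; lia.
rewrite (@box_countE _ _ _ _ _ ((i + j)./2)) // ?(@box_countE _ _ _ _ _ ((i + j)./2.+2)) //; lia.
Qed.

Lemma box_count_shift N i j : box_count N i j 1 2 = box_count N i j 0 1.
Proof. by apply: eq_bigr => a _; apply: eq_bigr => c _; congr nat_of_bool; lia. Qed.

Definition simplex_count a N m := \sum_(x < a) \sum_(y < N) ((3 * x + y.*2 <= m) : nat).

(** Removing the slice x = 0 gives the recursion S(m) = floor(m/2) + 1 + S(m-3). With slope 7 the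
    upper bound grows from m - 3 to m by exactly 6 (m+2), which is at least 12 (floor(m/2) + 1). *)
Lemma simplex_count_bounds a N m : m < a -> m < N ->
  m * m <= 12 * simplex_count a N m <= m * m + 7 * m + 24.
Proof.
elim: a m => // a IHa m ma mN; rewrite /simplex_count big_ord_recl /=.
have -> : \sum_(y < N) ((3 * 0 + y.*2 <= m) : nat) = (m./2).+1.
  transitivity (\sum_(y < N) ((0 <= y < (m./2).+1) : nat)).
    by apply: eq_bigr => y _; congr nat_of_bool; lia.
  by rewrite sum_interval; lia.
have [m3|m3] := ltnP m 3.
  rewrite big1 ?addn0 => [|x _]; last by apply: big1 => y _; rewrite /bump /=; lia.
  by case: m m3 {ma mN} => [|[|[|m]]].
have -> : \sum_(x < a) \sum_(y < N) ((3 * bump 0 x + y.*2 <= m) : nat) = simplex_count a N (m - 3).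
  by apply: eq_bigr => x _; apply: eq_bigr => y _; rewrite /bump /=; congr nat_of_bool; lia.
have [k mk] : exists k, m = k + 3 by exists (m - 3); lia.
subst m; rewrite addnK; have ka : k < a by lia.
have kN : k < N by lia.
have := IHa k ka kN; have : k + 4 <= 2 * ((k + 3)./2).+1 <= k + 5 by lia.
move: (simplex_count a N k) ((k + 3)./2).+1 => S h; lia.
Qed.

Lemma card_cancel (T U : finType) (S : {set T}) (Q : {set U}) f g :
  {in S, forall x, f x \in Q} -> {in Q, forall y, g y \in S} ->
  {in S, cancel f g} -> {in Q, cancel g f} -> #|S| = #|Q|.
Proof.
move=> fS gQ fg gf; apply/eqP; rewrite eqn_leq; apply/andP; split.
  rewrite -(card_in_imset (can_in_inj fg)); apply: subset_leq_card.
  by apply/fintype.subsetP => _ /imsetP[x xS ->]; apply: fS.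
rewrite -(card_in_imset (can_in_inj gf)); apply: subset_leq_card.
by apply/fintype.subsetP => _ /imsetP[x xS ->]; apply: gQ.
Qed.

Lemma sum_lab (F : lab -> nat) : \sum_x F x = F LI + F LA + F LB + F LC.
Proof.
have -> : \sum_x F x = \sum_(a : bool) \sum_(b : bool) F (a, b).
  by rewrite pair_bigA; apply: eq_bigr => -[].
rewrite !big_bool /=; move: (F LI) (F LA) (F LB) (F LC) => a b c d. lia.
Qed.

Lemma sum_lab2 (F : lab * lab -> nat) : \sum_p F p =
  (F (LI, LI) + F (LI, LA) + F (LI, LB) + F (LI, LC)) +
  (F (LA, LI) + F (LA, LA) + F (LA, LB) + F (LA, LC)) +
  (F (LB, LI) + F (LB, LA) + F (LB, LB) + F (LB, LC)) +
  (F (LC, LI) + F (LC, LA) + F (LC, LB) + F (LC, LC)).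
Proof.
have -> : \sum_p F p = \sum_x \sum_y F (x, y) by rewrite pair_bigA; apply: eq_bigr => -[].
by rewrite sum_lab !(sum_lab (fun y => F (_, y))).
Qed.

Ltac ordlia :=
  repeat match goal with H : context [nat_of_ord _] |- _ => revert H end;
  repeat match goal with |- context [nat_of_ord ?x] => generalize (nat_of_ord x); intro end;
  intros; lia.

Section CountContents.
Variable n : nat.
Hypothesis n4 : 3 < n.
Local Notation N := n.+1.
Local Notation content_type := {ffun lab * lab -> 'I_N}.

Definition bal_contents d := [set M in sym_contents n pswap | balanced_content d M].

Lemma bal_contentsP d (M : content_type) : M \in bal_contents d ->
  (forall x y : lab, M (x, y) = M (y, x)) /\
  [/\ M (LI, LI) + M (LI, LA) + M (LI, LB) + M (LI, LC) = 1,
      M (LA, LI) + M (LA, LA) + M (LA, LB) + M (LA, LC)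
        = M (LB, LI) + M (LB, LA) + M (LB, LB) + M (LB, LC) + d
    & (M (LI, LI) + M (LI, LA) + M (LI, LB) + M (LI, LC)) +
      (M (LA, LI) + M (LA, LA) + M (LA, LB) + M (LA, LC)) +
      (M (LB, LI) + M (LB, LA) + M (LB, LB) + M (LB, LC)) +
      (M (LC, LI) + M (LC, LA) + M (LC, LB) + M (LC, LC)) = n].
Proof.
rewrite !inE /balanced_content /row_total !sum_lab => /andP[/andP[/eqP tot /forallP sy]].
move=> /andP[/eqP rI /eqP rA]; split; first by move=> x y; rewrite -(eqP (sy (x, y))).
by split=> //; rewrite -[RHS]tot sum_lab2.
Qed.

Lemma in_bal_contents d (M : content_type) :
  (forall x y : lab, M (x, y) = M (y, x)) ->
  M (LI, LI) + M (LI, LA) + M (LI, LB) + M (LI, LC) = 1 ->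
  M (LA, LI) + M (LA, LA) + M (LA, LB) + M (LA, LC)
    = M (LB, LI) + M (LB, LA) + M (LB, LB) + M (LB, LC) + d ->
  (M (LI, LI) + M (LI, LA) + M (LI, LB) + M (LI, LC)) +
  (M (LA, LI) + M (LA, LA) + M (LA, LB) + M (LA, LC)) +
  (M (LB, LI) + M (LB, LA) + M (LB, LB) + M (LB, LC)) +
  (M (LC, LI) + M (LC, LA) + M (LC, LB) + M (LC, LC)) = n -> M \in bal_contents d.
Proof.
move=> sy rI rA tot; rewrite !inE /balanced_content /row_total !sum_lab rI rA !eqxx !andbT.
apply/andP; split; last by apply/forallP => -[x y]; rewrite sy.
by apply/eqP; rewrite -[RHS]tot sum_lab2.
Qed.

(* A symmetric matrix with balanced content has exactly one 1 in its row LI, in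
   column y0. With entries aa, ab, ac, bb, bc, cc elsewhere, it is given by y0,
   ab, i = aa + bb, j = ac + bc, aa and ac; the total is then
   i + 2 j + 2 ab + cc = size_left y0. *)
Definition size_left (y0 : lab) := if y0 == LI then n.-1 else n.-2.

Definition param := ('I_N * 'I_N * 'I_N * ('I_N * 'I_N))%type.

Definition params d (y0 : lab) : {set param} :=
  [set t : param | let: (ab, i, j, (aa, ac)) := t in
    (i + j.*2 + ab.*2 <= size_left y0) &&
    [&& aa <= i, ac <= j & aa.*2 + ac.*2 + (y0 == LA) == i + j + ((y0 == LB) + d)]].

Definition param_of (M : content_type) : param :=
  (M (LA, LB), inord (M (LA, LA) + M (LB, LB)), inord (M (LA, LC) + M (LB, LC)),
   (M (LA, LA), M (LA, LC))).

Definition entry (y0 : lab) (t : param) (x y : lab) : nat :=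
  let: (ab, i, j, (aa, ac)) := t in
  match x, y with
  | (false, false), _ => y0 == y
  | _, (false, false) => y0 == x
  | (false, true), (false, true) => aa
  | (false, true), (true, false) => ab
  | (false, true), (true, true) => ac
  | (true, false), (false, true) => ab
  | (true, false), (true, false) => i - aa
  | (true, false), (true, true) => j - ac
  | (true, true), (false, true) => ac
  | (true, true), (true, false) => j - ac
  | (true, true), (true, true) => size_left y0 - (i + j.*2 + ab.*2)
  end.

Definition content_of y0 t : content_type := [ffun p => inord (entry y0 t p.1 p.2)].

Lemma content_ofE y0 t (x y : lab) : content_of y0 t (x, y) = entry y0 t x y :> nat.
Proof.
rewrite ffunE inordK //=; case: t => [[[ab i] j] [aa ac]] /=.
have := ltn_ord ab; have := ltn_ord i; have := ltn_ord j; have := ltn_ord aa; have := ltn_ord ac.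
have sl : size_left y0 < N by rewrite /size_left; case: ifP; lia.
by case: x => [[] []]; case: y => [[] []]; rewrite ?ltnS; try lia; case: (_ == _); lia.
Qed.

Lemma row_pick (M : content_type) d (y0 : lab) : M \in bal_contents d -> M (LI, y0) = 1 :> nat ->
  forall y : lab, M (LI, y) = (y0 == y) :> nat /\ M (y, LI) = (y0 == y) :> nat.
Proof.
move=> /bal_contentsP[sy [rI _ _]] h y; rewrite (sy y LI).
suff -> : M (LI, y) = (y0 == y) :> nat by [].
case: y0 h => [[] []] h; case: y => [[] []] /=; move: rI h;
  move: (nat_of_ord (M (LI, LI))) (nat_of_ord (M (LI, LA)))
        (nat_of_ord (M (LI, LB))) (nat_of_ord (M (LI, LC))) => a b c e; lia.
Qed.

Lemma bal_contents_sym d (M : content_type) : M \in bal_contents d ->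
  [/\ M (LB, LA) = M (LA, LB) :> nat, M (LC, LA) = M (LA, LC) :> nat
    & M (LC, LB) = M (LB, LC) :> nat].
Proof. by move=> /bal_contentsP[sy _]; split; rewrite sy. Qed.

Lemma param_ofK d (y0 : lab) (M : content_type) : M \in bal_contents d ->
  M (LI, y0) = 1 :> nat -> content_of y0 (param_of M) = M.
Proof.
move=> MS My; have r := row_pick MS My.
have [_ [rI rA tot]] := bal_contentsP MS.
have [e1 e2 e3] := bal_contents_sym MS.
have [i1 _] := r LI; have [i2 i5] := r LA; have [i3 i6] := r LB; have [i4 i7] := r LC.
clear r My.
suff h (x y : lab) : content_of y0 (param_of M) (x, y) = M (x, y) :> nat.
  by apply/ffunP => -[x y]; apply: val_inj; apply: h.
rewrite content_ofE /param_of /= ?inordK; try ordlia.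
case: x => [[] []]; case: y => [[] []];
  rewrite /= ?e1 ?e2 ?e3 ?i1 ?i2 ?i3 ?i4 ?i5 ?i6 ?i7 //; try ordlia.
move: i1 i2 i3 i4 i5 i6 i7; rewrite /size_left; case: (y0) => [[] []] /=; ordlia.
Qed.

Lemma card_bal_contents_pick d (y0 : lab) :
  #|[set M in bal_contents d | M (LI, y0) == 1 :> nat]| = #|params d y0|.
Proof.
apply: (@card_cancel _ _ _ _ param_of (content_of y0)).
- move=> M; rewrite inE => /andP[MS /eqP My]; have r := row_pick MS My.
  have [sy [rI rA tot]] := bal_contentsP MS.
  have [e1 e2 e3] := bal_contents_sym MS.
  rewrite inE /param_of /=.
  have [r1 _] := r LI; have [r2 i1] := r LA; have [r3 i2] := r LB; have [r4 i3] := r LC.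
  clear r sy My.
  rewrite !inordK; try ordlia.
  move: r1 r2 r3 r4 i1 i2 i3; rewrite /size_left; case: (y0) => [[] []] /=; ordlia.
- move=> [[[ab i] j] [aa ac]]; rewrite inE => /andP[h1 /and3P[h2 h3 /eqP h4]].
  rewrite inE content_ofE /= eqxx andbT; apply: in_bal_contents; rewrite ?content_ofE /=.
  + move=> x y; apply: val_inj; rewrite /= !content_ofE.
    by case: x => [[] []]; case: y => [[] []].
  + by case: (y0) => [[] []].
  + by move: h4 {h1}; case: (y0) => [[] []] /=; ordlia.
  + move: h1 h4; rewrite /size_left; case: (y0) => [[] []] /=; ordlia.
- by move=> M; rewrite inE => /andP[MS /eqP My]; apply: param_ofK MS My.
move=> [[[ab i] j] [aa ac]]; rewrite inE => /andP[h1 /and3P[h2 h3 _]].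
have := ltn_ord i; have := ltn_ord j => jN iN.
by rewrite /param_of; congr (_, _, _, (_, _)); apply: val_inj; rewrite /= !content_ofE /= ?inordK; ordlia.
Qed.

Lemma card_params d (y0 : lab) : #|params d y0|
  = \sum_(p : 'I_N * 'I_N * 'I_N) ((p.1.2 + p.2.*2 + p.1.1.*2 <= size_left y0) : nat)
       * box_count N p.1.2 p.2 (y0 == LA) ((y0 == LB) + d).
Proof.
transitivity (\sum_(p : 'I_N * 'I_N * 'I_N) \sum_(q : 'I_N * 'I_N)
    (if (p, q) \in params d y0 then 1 else 0)).
  by rewrite pair_bigA -sum1_card big_mkcond; apply: eq_bigr => -[].
apply: eq_bigr => -[[ab i] j] _ /=; rewrite /box_count pair_bigA big_distrr /=.
apply: eq_bigr => -[aa ac] _; rewrite inE /=.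
by case: (_ <= size_left y0); rewrite ?mul1n ?mul0n //=; case: ifP.
Qed.

Lemma entry_le1 d (M : content_type) (y0 : lab) : M \in bal_contents d -> M (LI, y0) <= 1.
Proof. by move=> /bal_contentsP[_ [rI _ _]]; case: y0 => [[] []]; ordlia. Qed.

(** The entries of row LI add up to 1, so summing them counts each matrix once and sorts the
    matrices by the column of the 1. *)
Lemma card_bal_contents d : #|bal_contents d| = \sum_y0 #|params d y0|.
Proof.
under eq_bigr => y0 _ do rewrite -card_bal_contents_pick -sum1_card.
transitivity (\sum_(y0 : lab) \sum_(M in bal_contents d) M (LI, y0)).
  rewrite exchange_big -sum1_card; apply: eq_bigr => M /bal_contentsP[_ [rI _ _]] /=.
  by rewrite sum_lab rI.
apply: eq_bigr => y0 _; rewrite [RHS](eq_bigl (fun M : content_type =>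
  (M \in bal_contents d) && (M (LI, y0) == 1 :> nat))); last by move=> M; rewrite inE.
rewrite big_mkcondr; apply: eq_bigr => M MS; have le1 := entry_le1 y0 MS.
by case: eqP => [->|ne] //; move: le1 ne; case: (nat_of_ord _) => [|[|]].
Qed.

Definition weighted_boxes m e1 e2 :=
  \sum_(p : 'I_N * 'I_N * 'I_N) ((p.1.2 + p.2.*2 + p.1.1.*2 <= m) : nat)
       * box_count N p.1.2 p.2 e1 e2.

Definition weighted_pairs m (r : nat -> nat -> bool) :=
  \sum_(p : 'I_N * 'I_N * 'I_N) ((p.1.2 + p.2.*2 + p.1.1.*2 <= m) && r p.1.2 p.2 : nat).

Lemma weighted_boxes_even m :
  weighted_boxes m 0 0 = weighted_boxes m 0 2 + weighted_pairs m (fun i j => i == j).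
Proof.
rewrite -big_split; apply: eq_bigr => -[[ab i] j] _ /=.
by rewrite box_count_even // mulnDr mulnb.
Qed.

Lemma weighted_boxes_odd m : weighted_boxes m 1 0
  = weighted_boxes m 0 3 + weighted_pairs m (fun i j => (i == j.+1) || (j == i.+1)).
Proof.
rewrite -big_split; apply: eq_bigr => -[[ab i] j] _ /=.
by rewrite box_count_odd // mulnDr mulnb.
Qed.

Lemma weighted_boxes_shift m : weighted_boxes m 1 2 = weighted_boxes m 0 1.
Proof. by apply: eq_bigr => p _; rewrite box_count_shift. Qed.

Lemma weighted_pairsE m r : weighted_pairs m r =
  \sum_(ab < N) \sum_(i < N) \sum_(j < N) ((i + j.*2 + ab.*2 <= m) && r i j : nat).
Proof.
under eq_bigr => ab _ do rewrite pair_bigA.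
rewrite pair_bigA /=; rewrite /weighted_pairs.
rewrite (reindex (fun p : 'I_N * ('I_N * 'I_N) => ((p.1, p.2.1), p.2.2))) //=.
by exists (fun p => (p.1.1, (p.1.2, p.2))) => [[a [b c]]|[[a b] c]] _.
Qed.

(** On the diagonal the constraint i + 2 j + 2 ab <= m reads 3 i + 2 ab <= m. *)
Lemma diag_count m : weighted_pairs m (fun i j => i == j) = simplex_count N N m.
Proof.
rewrite weighted_pairsE exchange_big; apply: eq_bigr => i _; apply: eq_bigr => ab _.
transitivity (\sum_(j < N) ((j == i :> nat) && (3 * i + ab.*2 <= m) : nat)).
  by apply: eq_bigr => j _; congr nat_of_bool; lia.
by rewrite (sum_pred1 N i (fun=> (3 * i + ab.*2 <= m))) ltn_ord.
Qed.

(** For i = j + 1 the constraint becomes 3 j + 2 ab <= m - 1, and for j = i + 1 it becomes 3 i + 2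
    ab <= m - 2. *)
Lemma offdiag_count m : 1 < m < N ->
  weighted_pairs m (fun i j => (i == j.+1) || (j == i.+1))
  = simplex_count N N (m - 1) + simplex_count N N (m - 2).
Proof.
move=> mN; rewrite weighted_pairsE.
transitivity (\sum_(ab < N) \sum_(i < N) \sum_(j < N)
   (((i == j.+1 :> nat) && (3 * j + ab.*2 <= m - 1) : nat)
    + ((j == i.+1 :> nat) && (3 * i + ab.*2 <= m - 2) : nat))).
  by do 3![apply: eq_bigr => ? _]; lia.
under eq_bigr => ab _ do (under eq_bigr => i _ do rewrite big_split; rewrite big_split).
rewrite big_split /=; congr (_ + _).
  under eq_bigr => ab _ do rewrite exchange_big.
  rewrite exchange_big; apply: eq_bigr => j _; apply: eq_bigr => ab _ /=.
  by rewrite (sum_pred1 N j.+1 (fun=> 3 * j + ab.*2 <= m - 1)); lia.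
rewrite exchange_big; apply: eq_bigr => i _; apply: eq_bigr => ab _ /=.
by rewrite (sum_pred1 N i.+1 (fun=> 3 * i + ab.*2 <= m - 2)); lia.
Qed.

Lemma card_bal_contents_diff :
  #|bal_contents 0| = #|bal_contents 2|
    + (simplex_count N N (n - 1) + simplex_count N N (n - 2)
       + simplex_count N N (n - 3) + simplex_count N N (n - 4)).
Proof.
rewrite !card_bal_contents !sum_lab !card_params /size_left /=.
rewrite !add0n !add1n -!/(weighted_boxes _ _ _).
(* Column LB for d = 0 equals column LA for d = 2 by the shift, and column LA for d = 0 is compared
   with LB for d = 2, which gives n - 3 and n - 4. Columns LI and LC give the diagonal counts for n
   - 1 and n - 2. *)
rewrite !weighted_boxes_even weighted_boxes_odd weighted_boxes_shift -!subn1 -!subnDA.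
rewrite !diag_count offdiag_count; last by lia.
have -> : n - (1 + 1) - 1 = n - 3 by lia.
have -> : n - (1 + 1) - 2 = n - 4 by lia.
have -> : n - (1 + 1) = n - 2 by lia.
by lia.
Qed.
End CountContents.
End ContentCounts.

(** * The exact colength and its asymptotics *)

Section Colength.
Variables (K : fieldType) (n : nat).
Hypotheses (char0 : [pchar K] =i pred0) (n4 : (3 < n)%N).

Lemma colengthE : (colength (variety_of (Htilde K)) n =
  simplex_count n.+1 n.+1 (n - 1) + simplex_count n.+1 n.+1 (n - 2)
  + simplex_count n.+1 n.+1 (n - 3) + simplex_count n.+1 n.+1 (n - 4))%N.
Proof.
(* The average is an equation in [K]; characteristic zero brings it back to natural numbers. *)
have inj (a b : nat) : a%:R = b%:R :> K -> a = b.
  wlog le_ab : a b / (a <= b)%N.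
    by move=> wl e; case: (leqP a b) => [|/ltnW] /wl; [apply|move->].
  move/eqP; rewrite eq_sym -subr_eq0 -natrB // ((proj1 (pcharf0P K)) char0) subn_eq0 => le_ba.
  by apply/eqP; rewrite eqn_leq le_ab.
apply/eqP; rewrite -(eqn_pmul2l (m := #|{: 'S_n}|)); last by apply/card_gt0P; exists 1%g.
apply/eqP/inj; rewrite colength_average //.
under eq_bigr => h _ do rewrite (cocharacterE char0 (ltnW n4)).
rewrite sumrB -!natr_sum !sum_square_fix -!/(bal_contents n _) card_bal_contents_diff //.
by rewrite mulnDr natrD addrC addKr.
Qed.

(** Summing [simplex_count_bounds] over m = n-1, ..., n-4 gives 4 n^2 - 20 n + 30 below and 4 n^2 +
    8 n + 56 above. *)
Lemma colength_bounds :
  (4 * n ^ 2 <= 12 * colength (variety_of (Htilde K)) n + 20 * n /\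
   12 * colength (variety_of (Htilde K)) n <= 4 * n ^ 2 + 60 * n)%N.
Proof.
rewrite colengthE.
have b k : (0 < k)%N -> _ := fun k0 => @simplex_count_bounds n.+1 n.+1 (n - k) ltac:(lia) ltac:(lia).
move: (b 1%N isT) (b 2%N isT) (b 3%N isT) (b 4%N isT).
do 4!move: (simplex_count _ _ _) => ?.
by move: n4 => h; rewrite -mulnn; nia.
Qed.
End Colength.

Local Open Scope classical_set_scope.
Local Open Scope ring_scope.

Theorem theorem2 (R : realType) (Phi : fieldType)
    (char0 : [pchar Phi] =i pred0) (eps : R) (eps_gt0 : 0 < eps) :
  (fun n : nat => (colength (variety_of (Htilde Phi)) n)%:R : R) =
  (fun n : nat => n%:R ^+ 2 / 3) +o_\oo (fun n : nat => n%:R `^ (1 + eps)).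
Proof.
apply/eqaddoP => d d0.
(* The bounds give an error of at most 5 n, with 5 = 60/12. This is within d n^(1+eps) once n^eps is
   at least 5/d, for instance for n above (5/d)^(1/eps). *)
have near5 : \forall n \near \oo, 5 / d <= n%:R `^ eps :> R.
  near=> n.
  have r0 : 0 <= 5 / d by rewrite divr_ge0 // ltW.
  rewrite -[leLHS]powRr1 // -[X in _ `^ X <= _](mulVf (lt0r_neq0 eps_gt0)) powRrM.
  apply: ge0_ler_powR; rewrite ?nnegrE ?powR_ge0 ?ler0n // ?ltW //.
  by near: n; exact: nbhs_infty_gtr.
near=> n.
have n4 : (3 < n)%N by near: n; exact: nbhs_infty_ge.
have n0 : n%:R != 0 :> R by rewrite pnatr_eq0; lia.
have le5 : 5 / d <= n%:R `^ eps by near: n.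
have [lo hi] := colength_bounds char0 n4.
rewrite [leRHS]/(d * `|_|).
rewrite (ger0_norm (powR_ge0 _ _)) powRD ?n0 ?implybT // powRr1 ?ler0n //.
have : 5 * n%:R <= d * (n%:R * n%:R `^ eps).
  rewrite mulrCA mulrC; apply: ler_wpM2l; first exact: ler0n.
  by rewrite mulrC -ler_pdivrMr.
apply: le_trans.
set c := colength _ _ in lo hi *.
have {}lo : 4 * n%:R ^+ 2 <= 12 * c%:R + 20 * n%:R :> R.
  by rewrite -natrX -!natrM -natrD ler_nat.
have {}hi : 12 * c%:R <= 4 * n%:R ^+ 2 + 60 * n%:R :> R.
  by rewrite -natrX -!natrM -natrD ler_nat.
rewrite -[X in `|X|]/(c%:R - n%:R ^+ 2 / 3 : R) ler_norml.
by apply/andP; split; lra.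
Unshelve. all: by end_near.
Qed.
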